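(* Let $\mathfrak{h}$ be a finite-dimensional complex vector space with a nondegenerate symmetric bilinear form $\langle\cdot,\cdot\rangle$, let $L$ be an additive subgroup of $\mathfrak{h}$ with $\langle\alpha,\alpha\rangle\in2\mathbb{Z}$ for all $\alpha\in L$, and let $\varepsilon:L\times L\to\mathbb{C}^\times$ be a function satisfying, for $\alpha,\beta,\gamma\in L$, $\varepsilon(\alpha,0)=\varepsilon(0,\alpha)=1$, $\varepsilon(\alpha,\beta+\gamma)\varepsilon(\beta,\gamma)=\varepsilon(\alpha+\beta,\gamma)\varepsilon(\alpha,\beta)$ and $\varepsilon(\alpha,\beta)\varepsilon(\beta,\alpha)^{-1}=(-1)^{\langle\alpha,\beta\rangle}$. Let $U$ be an $\hat{\mathfrak{h}}$-module of level $1$ satisfying Condition $C_L$. Set $V_{(\mathfrak{h},L)}=\mathbb{C}[L]\otimes M(1)$ and $V_{(\mathfrak{h},L)}(U)=\mathbb{C}[L]\otimes U$. For $\alpha,\beta\in L$, $v\in M(1)$, $w\in U$ define $$Y_W(e^\alpha\otimes v,x)(e^\beta\otimes w)=\varepsilon(\alpha,\beta)\,e^{\alpha+\beta}\otimes x^{\langle\alpha,\beta\rangle}E^-(-\alpha,x)\,Y_U(\bar\Delta(\beta,x)v,x)\,\bar\Delta(\alpha,-x)w,$$ and let $Y$ denote the map $Y_W$ in the case $U=M(1)$. Then $(V_{(\mathfrak{h},L)},Y,e^0\otimes\mathbf{1})$ carries the structure of a vertex algebra with $M(1)$ as a vertex subalgebra (via $v\mapsto e^0\otimes v$), and $(V_{(\mathfrak{h},L)}(U),Y_W)$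 carries the structure of a $V_{(\mathfrak{h},L)}$-module. Furthermore, if $U$ is irreducible (as an $\hat{\mathfrak{h}}$-module), then $V_{(\mathfrak{h},L)}(U)$ is an irreducible $V_{(\mathfrak{h},L)}$-module.
   Context: Everything is over $\mathbb{C}$. $\hat{\mathfrak{h}}=\mathfrak{h}\otimes\mathbb{C}[t,t^{-1}]\oplus\mathbb{C}\mathbf{k}$ is the Lie algebra with $\mathbf{k}$ central and $[u(m),v(n)]=m\langle u,v\rangle\delta_{m+n,0}\mathbf{k}$, where $h(n)=h\otimes t^n$; $\mathfrak{h}(n)=\{h(n)\mid h\in\mathfrak{h}\}$. An $\hat{\mathfrak{h}}$-module $W$ has level $\ell$ if $\mathbf{k}$ acts as the scalar $\ell$; it is restricted if for every $w\in W$, $\mathfrak{h}(n)w=0$ for $n$ sufficiently large. $M(1)=V_{\hat{\mathfrak{h}}}(1,0)=U(\hat{\mathfrak{h}})\otimes_{U(\mathfrak{h}\otimes\mathbb{C}[t]+\mathbb{C}\mathbf{k})}\mathbb{C}_1$, where $\mathfrak{h}\otimes\mathbb{C}[t]$ acts trivially and $\mathbf{k}$ acts as $1$ on $\mathbb{C}_1=\mathbb{C}$; $\mathbf{1}=1\otimes1$ and $\mathfrak{h}\subset M(1)$ via $h\mapsto h(-1)\mathbf{1}$. It is known that $M(1)$ has a unique vertex algebra structure with vacuum $\mathbf{1}$ and $Y(h,x)=h(x)=\sum_{n\in\mathbb{Z}}h(n)x^{-n-1}$ for $h\in\mathfrak{h}$, and that every restricted $\hat{\mathfrak{h}}$-module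 $U$ of level $1$ has a unique $M(1)$-module structure $Y_U$ with $Y_U(h,x)=h(x)$ for $h\in\mathfrak{h}$. Condition $C_L$ for an $\hat{\mathfrak{h}}$-module $U$: $U$ is a restricted $\hat{\mathfrak{h}}$-module of level $1$ such that for every $\alpha\in L$, $\alpha(0)$ is semisimple on $U$ with only integer eigenvalues and $\alpha(n)$ is locally nilpotent on $U$ for all $n\ge1$. ($M(1)$ satisfies Condition $C_L$, with $\alpha(0)=0$.) For $\alpha\in\mathfrak{h}$: $E^{\pm}(\alpha,x)=\exp\left(\sum_{n=1}^\infty\frac{\alpha(\pm n)}{\pm n}x^{\mp n}\right)$ and $\bar\Delta(\alpha,x)=(-x)^{\alpha(0)}\exp\left(\sum_{n=1}^\infty\frac{\alpha(n)}{-n}(-x)^{-n}\right)=(-x)^{\alpha(0)}E^+(-\alpha,-x)$, which for $\alpha\in L$ is well defined on modules satisfying Condition $C_L$. $\mathbb{C}[L]$ is the group algebra with basis $e^\alpha$ $(\alpha\in L)$. *)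

(* Defs.v *)
From HB Require Import structures.
From mathcomp Require Import all_boot all_order all_algebra.
From mathcomp Require Import finmap complex.
From mathcomp.multinomials Require Import monalg.
From mathcomp Require Import boolp classical_sets functions cardinality fsbigop reals.

Set Implicit Arguments.
Unset Strict Implicit.
Unset Printing Implicit Defensive.

Import Order.TTheory GRing.Theory Num.Theory.
Local Open Scope classical_set_scope.
Local Open Scope ring_scope.
Local Open Scope quotient_scope.

(* Throughout, [\sum_(i \in [set: T])] is the sum of [fsbigop] over the finite
   support of the summand. *)

Section Subspaces.
Context {K : fieldType} {V : lmodType K}.

Definition subspace (S : set V) : Prop :=
  [/\ S 0, forall x y, S x -> S y -> S (x + y)
    & forall (c : K) x, S x -> S (c *: x)].

Definition linspan (A : set V) : set V :=
  [set v | forall S : set V, subspace S -> A `<=` S -> S v].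

Lemma linspan_subspace (A : set V) : subspace (linspan A).
Proof.
split=> [S [S0 _ _] _ //|x y sx sy S sS AS|c x sx S sS AS].
  by have [_ SD _] := sS; apply: SD; [apply: sx | apply: sy].
by have [_ _ SZ] := sS; apply: SZ; apply: sx.
Qed.

Definition quot_rel (A : set V) : rel V := fun x y => `[< linspan A (x - y) >].

Lemma quot_rel_equiv (A : set V) : equiv_class_of (quot_rel A).
Proof.
have [s0 sD sZ] := linspan_subspace A.
split=> [x|x y|y x z].
- by apply/asboolP; rewrite subrr.
- by apply/asboolP/asboolP => /(sZ (-1)); rewrite scaleN1r opprB.
- move=> /asboolP sxy /asboolP syz; apply/asboolP.
  by have := sD _ _ sxy syz; rewrite addrA subrK.
Qed.

Canonical quot_equiv (A : set V) := EquivRelPack (quot_rel_equiv A).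

(* The quotient of V by the subspace spanned by A, not by A itself. *)
Definition quotmod (A : set V) := {eq_quot quot_rel A}.

End Subspaces.

Section QuotientModule.
Context {K : fieldType} {V : lmodType K} (A : set V).

HB.instance Definition _ := Choice.on (quotmod A).
HB.instance Definition _ := EqQuotient.on (quotmod A).

Lemma quotmodP (x y : V) :
  reflect (linspan A (x - y)) (x == y %[mod quotmod A]).
Proof. by rewrite piE; apply: asboolP. Qed.

Lemma quotmod_repr (x : V) : linspan A (repr (\pi_(quotmod A) x) - x).
Proof. by apply/quotmodP; rewrite reprK. Qed.

Definition quot_add := lift_op2 (quotmod A) +%R.
Definition quot_opp := lift_op1 (quotmod A) -%R.
Definition quot_scale (c : K) := lift_op1 (quotmod A) ( *:%R c).

Lemma pi_quot_add x y :
  \pi_(quotmod A) (x + y) = quot_add (\pi_(quotmod A) x) (\pi_(quotmod A) y).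
Proof.
have [_ sD sZ] := linspan_subspace A; rewrite /quot_add; unlock.
apply/esym/eqP/quotmodP; have := sD _ _ (quotmod_repr x) (quotmod_repr y).
by rewrite opprD addrACA.
Qed.

Lemma pi_quot_scale c x :
  \pi_(quotmod A) (c *: x) = quot_scale c (\pi_(quotmod A) x).
Proof.
have [_ sD sZ] := linspan_subspace A; rewrite /quot_scale; unlock.
apply/esym/eqP/quotmodP.
by have := sZ c _ (quotmod_repr x); rewrite scalerBr.
Qed.

Lemma pi_quot_opp x :
  \pi_(quotmod A) (- x) = quot_opp (\pi_(quotmod A) x).
Proof.
have [_ sD sZ] := linspan_subspace A; rewrite /quot_opp; unlock.
apply/esym/eqP/quotmodP.
by have := sZ (-1) _ (quotmod_repr x); rewrite scaleN1r opprB opprK addrC.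
Qed.

Lemma quot_addA : associative quot_add.
Proof.
elim/quotW=> x; elim/quotW=> y; elim/quotW=> z.
by rewrite -!pi_quot_add addrA.
Qed.

Lemma quot_addC : commutative quot_add.
Proof.
by elim/quotW=> x; elim/quotW=> y; rewrite -!pi_quot_add addrC.
Qed.

Lemma quot_add0 : left_id (\pi_(quotmod A) 0) quot_add.
Proof. by elim/quotW=> x; rewrite -pi_quot_add add0r. Qed.

Lemma quot_addN : left_inverse (\pi_(quotmod A) 0) quot_opp quot_add.
Proof. by elim/quotW=> x; rewrite -pi_quot_opp -pi_quot_add addNr. Qed.

HB.instance Definition _ := GRing.isZmodule.Build (quotmod A)
  quot_addA quot_addC quot_add0 quot_addN.

Lemma quot_scaleA a b (x : quotmod A) :
  quot_scale a (quot_scale b x) = quot_scale (a * b) x.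
Proof. by elim/quotW: x => x; rewrite -!pi_quot_scale scalerA. Qed.

Lemma quot_scale1 : left_id 1 quot_scale.
Proof. by elim/quotW=> x; rewrite -pi_quot_scale scale1r. Qed.

Lemma quot_scaleDr : right_distributive quot_scale +%R.
Proof.
move=> c; elim/quotW=> x; elim/quotW=> y.
rewrite -[LHS]/(quot_scale _ (quot_add _ _)).
by rewrite -pi_quot_add -!pi_quot_scale scalerDr pi_quot_add.
Qed.

Lemma quot_scaleDl (x : quotmod A) : {morph quot_scale^~ x : a b / a + b}.
Proof.
elim/quotW: x => x a b.
by rewrite -!pi_quot_scale scalerDl pi_quot_add.
Qed.

HB.instance Definition _ := GRing.Zmodule_isLmodule.Build K (quotmod A)
  quot_scaleA quot_scale1 quot_scaleDr quot_scaleDl.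

End QuotientModule.

(* The direct sum of copies of V indexed by I, i.e. the finitely supported
   functions I -> V; [<< v *g i >>] is v placed in the i-th summand and
   [g@_i] is the i-th component of g. *)
Section DirectSum.
Context {K : fieldType} (I : choiceType) (V : lmodType K).

Definition dsum := {malg V[I]}.

HB.instance Definition _ := GRing.Zmodule.on dsum.

Definition dsum_scale (c : K) (g : dsum) : dsum :=
  \sum_(i <- msupp g) << c *: g@_i *g i >>.

Lemma dsum_scaleE c (g : dsum) i : (dsum_scale c g)@_i = c *: g@_i.
Proof.
rewrite /dsum_scale raddf_sum [in RHS](monalgE g) raddf_sum scaler_sumr.
by apply: eq_bigr => /= j _; rewrite !mcoeffU scalerMnr.
Qed.

Lemma dsum_scaleA a b (g : dsum) :
  dsum_scale a (dsum_scale b g) = dsum_scale (a * b) g.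
Proof. by apply/malgP => i; rewrite !dsum_scaleE scalerA. Qed.

Lemma dsum_scale1 : left_id 1 dsum_scale.
Proof. by move=> g; apply/malgP => i; rewrite !dsum_scaleE scale1r. Qed.

Lemma dsum_scaleDr : right_distributive dsum_scale +%R.
Proof.
by move=> c g g'; apply/malgP=> i; rewrite mcoeffD !dsum_scaleE mcoeffD scalerDr.
Qed.

Lemma dsum_scaleDl (g : dsum) : {morph dsum_scale^~ g : a b / a + b}.
Proof.
by move=> a b; apply/malgP=> i; rewrite mcoeffD !dsum_scaleE scalerDl.
Qed.

HB.instance Definition _ := GRing.Zmodule_isLmodule.Build K dsum
  dsum_scaleA dsum_scale1 dsum_scaleDr dsum_scaleDl.

End DirectSum.

Section Lattice.
Context {h : zmodType} (L : zmodClosed h).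

Record lattice := Lattice { lattice_val : h; _ : lattice_val \in L }.

HB.instance Definition _ := [isSub for lattice_val].
HB.instance Definition _ := [Choice of lattice by <:].
HB.instance Definition _ := [SubChoice_isSubZmodule of lattice by <:].

End Lattice.

Section LieModules.
Context {K : fieldType} {g : lmodType K} (br : g -> g -> g).

Definition is_lie_module (W : lmodType K) (rho : g -> W -> W) : Prop :=
  [/\ forall x, linear (rho x), forall w, linear (rho^~ w)
    & forall x y w, rho (br x y) w = rho x (rho y w) - rho y (rho x w)].

(* The free associative algebra on the set g, with the words in g as a basis
   and concatenation of words as the product. *)
Definition free_alg := {malg K[seq g]}.
Definition word (s : seq g) : free_alg := << s >>.

(* These elements span the two-sided ideal generated by the
   gen(c x + y) - c gen(x) - gen(y) and the x y - y x - [x, y], so that U(g) is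
   the quotient of free_alg by their span. *)
Definition env_relation : set free_alg :=
  [set r | exists u c x y v, r = word (u ++ (c *: x + y) :: v)
             - (c *: word (u ++ x :: v) + word (u ++ y :: v))] `|`
  [set r | exists u x y v, r = word (u ++ x :: y :: v)
             - word (u ++ y :: x :: v) - word (u ++ br x y :: v)].

(* U(g) (x)_{U(b)} C_chi, for a subalgebra b with a character chi: as chi is
   one-dimensional this is U(g) modulo the left ideal generated by the
   elements x - chi x with x in b. *)
Definition induced_relation (b : set g) (chi : g -> K) : set free_alg :=
  env_relation `|`
  [set r | exists u x, b x /\ r = word (rcons u x) - chi x *: word u].

Definition induced (b : set g) (chi : g -> K) := quotmod (induced_relation b chi).

HB.instance Definition _ b chi := GRing.Lmodule.on (induced b chi).

Definition induced_vec b chi : induced b chi :=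
  \pi_(quotmod (induced_relation b chi)) (word [::]).

(* Left multiplication by the generator x. *)
Definition lmul_gen (x : g) (r : free_alg) : free_alg :=
  \sum_(s <- msupp r) r@_s *: word (x :: s).

Definition induced_act b chi (x : g) (v : induced b chi) : induced b chi :=
  \pi_(quotmod (induced_relation b chi)) (lmul_gen x (repr v)).

End LieModules.

Section InducedTheory.
Context {K : fieldType} {g : lmodType K} (br : g -> g -> g).
Context (b : set g) (chi : g -> K).

Local Notation I := (induced_relation br b chi).

Lemma free_algE (r : @free_alg K g) : r = \sum_(s <- msupp r) r@_s *: word s.
Proof.
rewrite [LHS]monalgE; apply: eq_bigr => s _.
by apply/malgP=> k; rewrite mcoeffZ !mcoeffU mulrnAr mulr1.
Qed.

Lemma lmul_genEw (x : g) (r : @free_alg K g) (D : {fset seq g}) :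
  (msupp r `<=` D)%fset -> lmul_gen x r = \sum_(s <- D) r@_s *: word (x :: s).
Proof.
move=> sD; rewrite /lmul_gen (big_fset_incl _ sD) //= => s _ /mcoeff_outdom ->.
by rewrite scale0r.
Qed.

Lemma lmul_gen_is_linear (x : g) : linear (@lmul_gen K g x).
Proof.
move=> c r r'; set D := (msupp r `|` msupp r' `|` msupp (c *: r + r'))%fset.
rewrite !(@lmul_genEw x _ D) /D.
- rewrite scaler_sumr -big_split /=; apply: eq_bigr => s _.
  by rewrite mcoeffD mcoeffZ scalerDl scalerA.
- by apply/fsubsetP=> s; rewrite !inE => ->; rewrite orbT.
- by apply/fsubsetP=> s; rewrite !inE => ->.
- by apply/fsubsetP=> s; rewrite !inE => ->; rewrite ?orbT.
Qed.

HB.instance Definition _ (x : g) :=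
  GRing.isLinear.Build K free_alg free_alg *:%R (lmul_gen x)
    (lmul_gen_is_linear x).

Lemma lmul_gen_word (x : g) (s : seq g) :
  lmul_gen x (word s) = word (x :: s) :> @free_alg K g.
Proof.
rewrite (@lmul_genEw x _ [fset s]%fset) ?msuppU_le //.
by rewrite big_seq_fset1 mcoeffUU scale1r.
Qed.

Lemma linspan_in r : I r -> linspan I r.
Proof. by move=> h S sS; apply. Qed.

Lemma linspan_lmul (x : g) r : linspan I r -> linspan I (lmul_gen x r).
Proof.
move=> sr; have [s0 sD sZ] := linspan_subspace I.
apply: (sr [set z | linspan I (lmul_gen x z)]).
  split=> /=; first by rewrite linear0.
    by move=> y z ? ?; rewrite linearD; apply: sD.
  by move=> c z ?; rewrite linearZ; apply: sZ.
move=> z [[[u [c [y [y' [v ->]]]]]|[u [y [y' [v ->]]]]]|[u [y [by_ ->]]]] /=;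
  rewrite !linearB /= ?linearD ?linearZ /= !lmul_gen_word; apply: linspan_in.
- by left; left; exists (x :: u), c, y, y', v; rewrite scalerN opprD.
- by left; right; exists (x :: u), y, y', v.
- by right; exists (x :: u), y; rewrite scalerN.
Qed.

Lemma induced_actE (x : g) r :
  induced_act x (\pi_(quotmod I) r : induced br b chi)
  = \pi_(quotmod I) (lmul_gen x r).
Proof.
apply/eqP/quotmodP; rewrite -linearB; apply: linspan_lmul; exact: quotmod_repr.
Qed.

Lemma induced_word_ind (S : set (induced br b chi)) : subspace S ->
  (forall s, S (\pi_(quotmod I) (word s))) -> forall v, S v.
Proof.
move=> [S0 SD SZ] Sword v; rewrite -[v]reprK [repr v]free_algE.
elim/big_ind: _ => [|y z Sy Sz|m _]; first exact: S0.
  by rewrite pi_quot_add; apply: SD.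
by rewrite pi_quot_scale; apply: SZ.
Qed.

Lemma induced_ind (S : set (induced br b chi)) :
  subspace S -> S (induced_vec br b chi) ->
  (forall x v, S v -> S (induced_act x v)) -> forall v, S v.
Proof.
move=> sS Svec Sact; apply: induced_word_ind => //; elim=> [|x s IHs] //.
by rewrite -lmul_gen_word -induced_actE; apply: Sact.
Qed.

Lemma induced_act_vec x : b x ->
  induced_act x (induced_vec br b chi) = chi x *: induced_vec br b chi.
Proof.
move=> bx; rewrite induced_actE lmul_gen_word.
rewrite -[RHS]/(quot_scale (chi x) (\pi_(quotmod I) _)) -pi_quot_scale.
by apply/eqP/quotmodP; apply: linspan_in; right; exists [::], x.
Qed.

Lemma induced_act_linear x : linear (@induced_act _ _ br b chi x).
Proof.
move=> c v w; rewrite -[v]reprK -[w]reprK.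
rewrite -[LHS]/(induced_act x (quot_add (quot_scale c
  (\pi_(quotmod I) (repr v))) (\pi_(quotmod I) (repr w)))).
rewrite -pi_quot_scale -pi_quot_add !induced_actE linearP.
by rewrite pi_quot_add pi_quot_scale.
Qed.

Lemma pi_linear c r r' : \pi_(quotmod I) (c *: r + r')
  = c *: (\pi_(quotmod I) r : induced br b chi) + \pi_(quotmod I) r'.
Proof. by rewrite pi_quot_add pi_quot_scale. Qed.

HB.instance Definition _ (x : g) := GRing.isLinear.Build K
  (induced br b chi) (induced br b chi) *:%R (@induced_act _ _ br b chi x)
  (induced_act_linear x).

Lemma induced_lie_module : is_lie_module br (@induced_act _ _ br b chi).
Proof.
split=> [|w c x y|x y w]; first exact: induced_act_linear.
- apply: (induced_word_ind (S := [set w | induced_act (c *: x + y) w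
    = c *: induced_act x w + induced_act y w])) => [|s] /=.
    split=> [|v v' ev ev'|d v ev] /=.
    + by rewrite !linear0 addr0.
    + by rewrite !linearD /= ev ev' addrACA.
    + by rewrite !linearZ /= ev scalerDr !scalerA mulrC.
  rewrite !induced_actE !lmul_gen_word -pi_linear.
  by apply/eqP/quotmodP; apply: linspan_in; left; left; exists [::], c, x, y, s.
- apply: (induced_word_ind (S := [set w | induced_act (br x y) w
    = induced_act x (induced_act y w) - induced_act y (induced_act x w)]))
    => [|s] /=.
    split=> [|v v' ev ev'|d v ev] /=.
    + by rewrite !linear0 addr0.
    + by rewrite !linearD /= ev ev' addrACA.
    + by rewrite !linearZ /= ev scalerDr.
  rewrite !(induced_actE _ (word _)) !lmul_gen_word.
  rewrite !(induced_actE _ (word _)) !lmul_gen_word addrC -scaleN1r -pi_linear.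
  apply/esym/eqP/quotmodP; apply: linspan_in; left; right.
  by exists [::], x, y, s; rewrite scaleN1r [- _ + _]addrC.
Qed.

End InducedTheory.

Definition irreducible_under {K : fieldType} (A : Type) (W : lmodType K)
    (act : A -> W -> W) : Prop :=
  (exists w : W, w != 0) /\
  forall S : set W, subspace S -> (forall a w, S w -> S (act a w)) ->
    S `<=` [set 0] \/ S = [set: W].

Section Heisenberg.
Context {K : fieldType} {h : lmodType K} (form : h -> h -> K).

(* h (x) C[t, t^-1] + C k: the n-th summand of the direct sum is h (x) t^n. *)
Definition heis := (dsum int h * K^o)%type.
HB.instance Definition _ := GRing.Lmodule.on heis.

Definition mode (u : h) (n : int) : heis := (<< u *g n >>, 0).
Definition central : heis := (0, 1).

Definition heis_bracket (x y : heis) : heis :=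
  (0, \sum_(m <- msupp x.1) m%:~R * form (x.1@_m) (y.1@_(- m))).

Definition is_heis_module (W : lmodType K) (rho : heis -> W -> W) : Prop :=
  is_lie_module heis_bracket rho.

Definition has_level (W : lmodType K) (rho : heis -> W -> W) (l : K) : Prop :=
  forall w, rho central w = l *: w.

Definition restricted (W : lmodType K) (rho : heis -> W -> W) : Prop :=
  forall w, exists N : int, forall n, N <= n -> forall u, rho (mode u n) w = 0.

(* The subalgebra h (x) C[t] + C k, and its character of level 1. *)
Definition heis_nonneg : set heis :=
  [set x | forall n : int, n < 0 -> x.1@_n = 0].

Definition M1 := induced heis_bracket heis_nonneg (fun x => x.2).
HB.instance Definition _ := GRing.Lmodule.on M1.

Definition M1_vac : M1 := induced_vec _ _ _.
Definition M1_act : heis -> M1 -> M1 := @induced_act _ _ _ _ _.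
Definition M1_incl (u : h) : M1 := M1_act (mode u (- 1)) M1_vac.

End Heisenberg.

Arguments heis {K} h.

Section Operators.
Context {K : fieldType} {W : lmodType K}.

Definition eigenvec (f : W -> W) (c : K) : set W := [set w | f w = c *: w].

(* W is the sum of the eigenspaces of f. *)
Definition semisimple_op (f : W -> W) : Prop :=
  linspan [set w | exists c, eigenvec f c w] = [set: W].

Definition integer_eigenvalues (f : W -> W) : Prop :=
  forall c w, w != 0 -> eigenvec f c w -> exists k : int, c = k%:~R.

Definition locally_nilpotent (f : W -> W) : Prop :=
  forall w, exists N, iter N f w = 0.

(* The coefficient of x^k in x^f w, for f semisimple with integer eigenvalues:
   the component of w in the k-eigenspace of f. *)
Definition xpow (f : W -> W) (k : int) (w : W) : W :=
  xget 0 [set u | eigenvec f k%:~R u /\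
     linspan [set z | exists2 c, c != k%:~R & eigenvec f c z] (w - u)].

(* The coefficient of z^r in (\sum_(n >= 1) a_n z^n)^k w. *)
Fixpoint series_pow (a : nat -> W -> W) (k r : nat) (w : W) : W :=
  if k is k'.+1 then \sum_(1 <= n < r.+1) a n (series_pow a k' (r - n)%N w)
  else if r == 0%N then w else 0.

(* The coefficient of z^r in exp(\sum_(n >= 1) a_n z^n) w; the k-th power of
   the series only involves z^r for r >= k. *)
Definition series_exp (a : nat -> W -> W) (r : nat) (w : W) : W :=
  \sum_(k < r.+1) (k`!%:R)^-1 *: series_pow a k r w.

End Operators.

Section ExponentialOperators.
Context {K : fieldType} {h : lmodType K} {W : lmodType K}.
Context (rho : heis h -> W -> W).

(* The coefficient of x^r in E^-(a, x) w. *)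
Definition Eminus (a : h) (r : nat) (w : W) : W :=
  series_exp (fun n => fun z => (- n%:R)^-1 *: rho (mode a (- n%:Z)) z) r w.

(* The coefficient of x^-r in E^+(a, x) w. *)
Definition Eplus (a : h) (r : nat) (w : W) : W :=
  series_exp (fun n => fun z => (n%:R)^-1 *: rho (mode a n%:Z) z) r w.

(* The coefficient of x^j in (-x)^{a(0)} E^+(-a, -x) w; the term indexed by r
   is the product of the (j + r)-th coefficient of the first factor and the
   (-r)-th coefficient of the second one. *)
Definition Dbar (a : h) (j : int) (w : W) : W :=
  \sum_(r \in [set: nat]) (-1 : K) ^ (j + r%:Z) *:
    xpow (rho (mode a 0)) (j + r%:Z) ((-1) ^+ r *: Eplus (- a) r w).

(* The coefficient of x^j in Dbar(a, -x) w. *)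
Definition Dbar_opp (a : h) (j : int) (w : W) : W := (-1 : K) ^ j *: Dbar a j w.

End ExponentialOperators.

Definition condition_C {K : fieldType} {h : lmodType K} (form : h -> h -> K)
    (L : zmodClosed h) (U : lmodType K) (rho : heis h -> U -> U) : Prop :=
  [/\ is_heis_module form rho, restricted rho, has_level rho 1
    & forall a : lattice L,
      [/\ semisimple_op (rho (mode (val a) 0)),
          integer_eigenvalues (rho (mode (val a) 0))
        & forall n : int, 1 <= n -> locally_nilpotent (rho (mode (val a) n))]].

Section VertexAlgebras.
Context {K : fieldType}.

(* [Y v n w] is v_n w, the coefficient of x^{-n-1} in Y(v, x) w. *)

Definition linear_fields (V W : lmodType K) (Y : V -> int -> W -> W) : Prop :=
  (forall v n, linear (Y v n)) /\ (forall n w, linear (fun v => Y v n w)).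

Definition truncated (V W : lmodType K) (Y : V -> int -> W -> W) : Prop :=
  forall v w, exists N : int, forall n, N <= n -> Y v n w = 0.

Definition binz (m : int) (i : nat) : K :=
  (\prod_(j < i) (m - j%:Z)%:~R) / (i`!)%:R.

(* The coefficient of x0^{-l-1} x1^{-m-1} x2^{-n-1} in the Jacobi identity
     x0^-1 delta((x1 - x2) / x0) Y(u, x1) Y(v, x2)
     - x0^-1 delta((x2 - x1) / - x0) Y(v, x2) Y(u, x1)
     = x2^-1 delta((x1 - x0) / x2) Y(Y(u, x0) v, x2)
   applied to w. *)
Definition jacobi (V W : lmodType K) (YV : V -> int -> V -> V)
    (Y : V -> int -> W -> W) : Prop :=
  forall (u v : V) (w : W) (l m n : int),
    \sum_(i \in [set: nat]) ((-1) ^+ i * binz l i) *: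
        (Y u (m + l - i%:Z) (Y v (n + i%:Z) w)
         - (-1 : K) ^ l *: Y v (n + l - i%:Z) (Y u (m + i%:Z) w))
    = \sum_(i \in [set: nat]) binz m i *:
        Y (YV u (l + i%:Z) v) (m + n - i%:Z) w.

Definition is_vertex_algebra (V : lmodType K) (Y : V -> int -> V -> V)
    (vac : V) : Prop :=
  [/\ linear_fields Y, truncated Y,
      forall n v, Y vac n v = if n == -1 then v else 0,
      forall v, Y v (-1) vac = v /\ (forall n, 0 <= n -> Y v n vac = 0)
    & jacobi Y Y].

Definition is_va_module (V : lmodType K) (YV : V -> int -> V -> V) (vac : V)
    (W : lmodType K) (Y : V -> int -> W -> W) : Prop :=
  [/\ linear_fields Y, truncated Y,
      forall n w, Y vac n w = if n == -1 then w else 0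
    & jacobi YV Y].

(* phi identifies (V1, Y1, vac1) with a vertex subalgebra of (V2, Y2, vac2). *)
Definition is_vertex_embedding (V1 V2 : lmodType K)
    (Y1 : V1 -> int -> V1 -> V1) (vac1 : V1)
    (Y2 : V2 -> int -> V2 -> V2) (vac2 : V2) (phi : V1 -> V2) : Prop :=
  [/\ linear phi, injective phi, phi vac1 = vac2
    & forall u n v, phi (Y1 u n v) = Y2 (phi u) n (phi v)].

Definition va_irreducible (V W : lmodType K) (Y : V -> int -> W -> W) : Prop :=
  irreducible_under (fun vn : V * int => Y vn.1 vn.2).

End VertexAlgebras.

Section LatticeConstruction.
Context {K : fieldType} {h : lmodType K} (form : h -> h -> K) (L : zmodClosed h).
Context (eps : lattice L -> lattice L -> K).

(* The integer <a, b>, when the form is integral on L. *)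
Definition pairing (a b : lattice L) : int :=
  xget 0 [set k : int | form (val a) (val b) = k%:~R].

Definition is_cocycle : Prop :=
  [/\ forall a b, eps a b != 0,
      forall a, eps a 0 = 1 /\ eps 0 a = 1,
      forall a b c, eps a (b + c) * eps b c = eps (a + b) c * eps a b
    & forall a b, eps a b * (eps b a)^-1 = (-1) ^ pairing a b].

(* C[L] (x) U, with [<< w *g a >>] standing for e^a (x) w. *)
Definition VL (U : lmodType K) := dsum (lattice L) U.
HB.instance Definition _ U := GRing.Lmodule.on (VL U).

Definition exp_tensor (U : lmodType K) (a : lattice L) (w : U) : VL U :=
  << w *g a >>.

Context (U : lmodType K) (rho : heis h -> U -> U).
Context (YU : M1 form -> int -> U -> U).

(* The coefficient of x^{-n-1} in
     x^<a,b> E^-(-a, x) Y_U(Dbar(b, x) v, x) Dbar(a, -x) w: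
   the indices j, k, r select the coefficients of x^j, x^k and x^r in
   Dbar(b, x) v, Dbar(a, -x) w and E^-(-a, x). *)
Definition YW_coef (a b : lattice L) (v : M1 form) (n : int) (w : U) : U :=
  \sum_(j \in [set: int]) \sum_(k \in [set: int]) \sum_(r \in [set: nat])
    Eminus rho (- (val a)) r
      (YU (Dbar (@M1_act _ _ form) (val b) j v)
          (n + pairing a b + j + k + r%:Z)
          (Dbar_opp rho (val a) k w)).

(* Y_W, extended bilinearly from the elements e^a (x) v and e^b (x) w. *)
Definition YW (x : VL (M1 form)) (n : int) (y : VL U) : VL U :=
  \sum_(a <- msupp x) \sum_(b <- msupp y)
    exp_tensor (a + b) (eps a b *: YW_coef a b x@_a n y@_b).

End LatticeConstruction.

(* Main.v *)
(* All the Jacobi identities are handled through the family [Phi l m n] of their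
   coefficients. It is stable under multiplication by powers of x1, x2 and x1 - x2,
   and if g satisfies the Jacobi identity with everything, then the coefficients for
   an iterate g_k u are combinations of those for u. So the set of states which
   satisfy the Jacobi identity is stable under the modes of g.

   For g = e^0 (x) h(-1)1 the identity with e^a (x) v on e^b (x) w follows from that
   of Y_U and the commutation of h(m) with E^-(-a, x), Dbar(b, x) and Dbar(a, -x),
   which only adds identities of the vacuum with a field. As 1 generates M(1), it
   remains to treat the vertex operators of e^a (x) 1 and e^b (x) 1. Writing
   p = <a, b>, the product of these operators is (x1 - x2)^p times an expression
   which, up to the cocycle, is symmetric. This gives locality, i.e. the vanishing
   of [Phi l] for l >= - p, and [Phi (- p - 1)] = 0 by restricting the symmetric
   expression to the diagonal. For l < - p - 1 one descends: computing [Phi l] for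
   a(-1)e^a, once as an iterate and once as the derivative of e^a, gives
   (p + l) [Phi (l - 1)] = 0.

   For irreducibility, U has countable dimension and C is uncountable, so by Amitsur's
   version of Schur's lemma every h(0) acts on U as a scalar. Since the form is
   nondegenerate, the zero modes separate the summands e^b (x) U. A nonzero submodule
   thus contains some e^b (x) w with w <> 0, hence e^b (x) U, and the leading
   coefficient of the vertex operator of e^(c-b) (x) 1 leads to e^c (x) U. *)

Require Import Defs.
From HB Require Import structures.
From mathcomp Require Import all_boot all_order all_algebra.
From mathcomp Require Import finmap complex.
From mathcomp.multinomials Require Import monalg.
From mathcomp Require Import boolp classical_sets functions cardinality fsbigop reals.
From mathcomp Require Import ssrAC zify ring lra.

Set Implicit Arguments.
Unset Strict Implicit.
Unset Printing Implicit Defensive.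

Import Order.TTheory GRing.Theory Num.Theory.
Local Open Scope classical_set_scope.
Local Open Scope ring_scope.

(** * Finite sums and binomial coefficients *)

(** Condition C_L controls a(0) only for a in L, and the form may be degenerate on L. The zero modes
    coming from L therefore need not separate the summands e^b (x) U, which is why all of h(0), and
    with it a version of Schur's lemma, enters the irreducibility. The fields are described on
    eigenvectors of a(0) only. There (-x)^{a(0)} is a shift of exponents and just E^+ and E^-
    remain; semisimplicity extends the conclusions by linearity. The descent in l avoids the states
    (e^a)_l e^b with l < - p - 1, which are e^(a+b) tensored with the higher coefficients of E^-(-a,
    x) vac; at l = - p - 1 only the constant coefficient occurs. Series are functions of their
    exponents, with a bound in one argument. Such bounds accompany every manipulation, because a sum
    with infinite support has the default value 0; an infinite expansion is replaced by partial sums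
    which are eventually stationary in each coefficient. *)

Section LinearProp.
Context {K : fieldType} {V W : lmodType K} (f : V -> W) (lf : linear f).

Lemma lin0 : f 0 = 0.
Proof. by have := lf (-1) 0 0; rewrite !scaleN1r oppr0 addr0 addNr. Qed.

Lemma linD x y : f (x + y) = f x + f y.
Proof. by rewrite -[x]scale1r lf !scale1r. Qed.

Lemma linZ c x : f (c *: x) = c *: f x.
Proof. by rewrite -[c *: x]addr0 lf lin0 addr0. Qed.

Lemma linN x : f (- x) = - f x.
Proof. by rewrite -scaleN1r linZ scaleN1r. Qed.

Lemma linB x y : f (x - y) = f x - f y.
Proof. by rewrite linD linN. Qed.

Lemma lin_sum (I : Type) (r : seq I) (P : pred I) (F : I -> V) :
  f (\sum_(i <- r | P i) F i) = \sum_(i <- r | P i) f (F i).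
Proof. by apply: (big_morph f linD lin0). Qed.

End LinearProp.

Section FiniteSums.
Context {W : zmodType}.

Lemma sum_nat0 (F : nat -> W) m n : (forall i, (m <= i < n)%N -> F i = 0) ->
  \sum_(m <= i < n) F i = 0.
Proof. by move=> F0; rewrite big_nat big1. Qed.

(** A sum over [[set: nat]] is 0 by default when the support is infinite, so a bound on the support
    is what gives it the intended value. *)
Lemma nsumE (F : nat -> W) N : (forall i, (N <= i)%N -> F i = 0) ->
  \sum_(i \in [set: nat]) F i = \sum_(0 <= i < N) F i.
Proof.
move=> F0; rewrite /index_iota subn0 [RHS]fsbig_seq ?iota_uniq //.
apply/esym; apply: fsbig_widen => //= i [_ iN]; apply: F0.
by rewrite leqNgt; apply/negP => iN'; apply: iN; rewrite /= mem_iota.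
Qed.

Lemma sum_nat_widen (F : nat -> W) N M : (N <= M)%N ->
  (forall i, (N <= i)%N -> F i = 0) ->
  \sum_(0 <= i < M) F i = \sum_(0 <= i < N) F i.
Proof.
move=> NM F0; rewrite (big_cat_nat (n := N)) //= [X in _ + X]sum_nat0 ?addr0 // => i.
by case/andP => /F0.
Qed.

(** Nothing lives outside the triangle i + j < M, so the square can be read along its antidiagonals,
    as in a Cauchy product. *)
Lemma sum_diag (F : nat -> nat -> W) M :
  (forall i j, (M <= i + j)%N -> F i j = 0) ->
  \sum_(0 <= i < M) \sum_(0 <= j < M) F i j
  = \sum_(0 <= t < M) \sum_(0 <= i < t.+1) F i (t - i)%N.
Proof.
move=> F0.
have shift i (G : nat -> W) : (i <= M)%N -> (forall j, (M <= i + j)%N -> G j = 0) ->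
    \sum_(0 <= j < M) G j = \sum_(0 <= t < M) if (i <= t)%N then G (t - i)%N else 0.
  move=> iM G0; rewrite (sum_nat_widen (leq_subr i M)) => [|j ?]; last first.
    by apply: G0; lia.
  rewrite [RHS](big_cat_nat (n := i)) //= (sum_nat0 (n := i)) ?add0r; last first.
    by move=> t /andP[_]; rewrite ltnNge => /negPf ->.
  rewrite [RHS](big_addn 0 M i); apply: eq_bigr => j _.
  by rewrite leq_addl addnK.
rewrite (eq_big_nat _ _ (F2 := fun i => \sum_(0 <= t < M)
    if (i <= t)%N then F i (t - i)%N else 0)); last first.
  by move=> i /andP[_ iM]; apply: shift => [|j]; [lia | apply: F0].
rewrite exchange_big_nat /= big_nat [RHS]big_nat.
apply: eq_bigr => t /andP[_ tM].
rewrite (big_cat_nat (n := t.+1)) //= (sum_nat0 (m := t.+1)) ?addr0.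
  by rewrite big_nat [RHS]big_nat; apply: eq_bigr => i /andP[_]; rewrite ltnS => ->.
by move=> i /andP[]; rewrite ltnNge => /negPf ->.
Qed.

End FiniteSums.

Section Binz.
Context {K : numFieldType}.
Local Notation binz := (@binz K).

Lemma natS_neq0 i : i.+1%:R != 0 :> K. Proof. by rewrite pnatr_eq0. Qed.

Lemma factr_neq0 i : i`!%:R != 0 :> K.
Proof. by rewrite pnatr_eq0 -lt0n fact_gt0. Qed.

Lemma binz0 m : binz m 0 = 1.
Proof. by rewrite /Defs.binz big_ord0 fact0 divr1. Qed.

Lemma binzS m i : i.+1%:R * binz m i.+1 = (m - i%:Z)%:~R * binz m i.
Proof.
rewrite /Defs.binz big_ord_recr /= factS natrM.
by field; rewrite factr_neq0 nat1r natS_neq0.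
Qed.

Lemma binz_absorb m i : i.+1%:R * binz m i.+1 = m%:~R * binz (m - 1) i.
Proof.
rewrite /Defs.binz big_ord_recl /= factS natrM subr0.
rewrite (eq_bigr (fun j : 'I_i => (m - 1 - j%:Z)%:~R)); last first.
  by move=> j _; congr (_ %:~R); rewrite /bump; lia.
by field; rewrite factr_neq0 nat1r natS_neq0.
Qed.

Lemma binz_sub m i : (m - i%:Z)%:~R * binz m i = m%:~R * binz (m - 1) i.
Proof. by rewrite -binzS binz_absorb. Qed.

Lemma binz_pascal m i : binz (m + 1) i.+1 = binz m i.+1 + binz m i.
Proof.
apply: (mulfI (natS_neq0 i)); rewrite binz_absorb addrK mulrDr binzS -mulrDl.
by congr (_ * _); rewrite -[i.+1%:R]/(i.+1%:Z%:~R) -intrD; congr (_%:~R); lia.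
Qed.

Lemma binz_nat_small (n i : nat) : (n < i)%N -> binz n%:Z i = 0.
Proof.
move=> ni; rewrite /Defs.binz (bigD1 (Ordinal ni)) //= subrr mulr0z !mul0r //.
Qed.

Lemma binz_nat (n i : nat) : binz n%:Z i = 'C(n, i)%:R.
Proof.
elim: n i => [|n IHn] [|i]; rewrite ?binz0 ?bin0 //.
  by rewrite binz_nat_small // bin0n.
by rewrite -addn1 PoszD binz_pascal !IHn addn1 binS natrD.
Qed.

Lemma binzN1 i : binz (- 1) i = (-1) ^+ i.
Proof.
elim: i => [|i IHi]; first by rewrite binz0.
apply: (mulfI (natS_neq0 i)); rewrite binzS IHi exprS.
have -> : - 1 - i%:Z = - i.+1%:Z by lia.
by rewrite mulrNz mulN1r mulrN mulNr.
Qed.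

(** Both sides obey Pascal's rule in m and agree for m = 0. The rule propagates the equality
    upwards; downwards it expresses degree s + 1 through degree s, whence the inner induction on
    s. *)
Lemma binz_vandermonde m n s :
  \sum_(0 <= i < s.+1) binz m i * binz n (s - i)%N = binz (m + n) s.
Proof.
pose V m s := \sum_(0 <= i < s.+1) binz m i * binz n (s - i)%N.
have V0 k : V k 0%N = 1 by rewrite /V big_nat1 !binz0 mulr1.
have VS k t : V (k + 1) t.+1 = V k t.+1 + V k t.
  rewrite /V ![\sum_(0 <= i < t.+2) _]big_nat_recl // !binz0 !mul1r -addrA.
  congr (_ + _); rewrite -big_split; apply: eq_bigr => i _ /=.
  by rewrite subSS binz_pascal mulrDl.
rewrite -/(V m s); elim/int_ind: m s => [|m IHm|m IHm] s.
- rewrite /V add0r big_nat_recl // binz0 mul1r subn0 big_nat big1 ?addr0 //.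
  by move=> i _; rewrite binz_nat_small ?mul0r.
- case: s => [|s]; first by rewrite V0 binz0.
  by rewrite intS [1 + _]addrC VS !IHm addrAC binz_pascal.
- elim: s => [|s IHs]; first by rewrite V0 binz0.
  have := VS (- m.+1%:Z) s; have -> : - m.+1%:Z + 1 = - m%:Z by lia.
  move=> E; have -> : V (- m.+1%:Z) s.+1 = V (- m%:Z) s.+1 - V (- m.+1%:Z) s.
    by rewrite E addrK.
  rewrite IHs IHm; have -> : - m%:Z + n = - m.+1%:Z + n + 1 by lia.
  by rewrite binz_pascal addrK.
Qed.

(** The falling factorial of length j + t splits after its first j factors. *)
Lemma binz_trinomial k j t :
  binz k (j + t)%N * binz (j + t)%N%:Z j = binz k j * binz (k - j%:Z) t.
Proof.
rewrite binz_nat /Defs.binz big_split_ord /=.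
rewrite (eq_bigr (fun i : 'I_t => (k - j%:Z - i%:Z)%:~R)); last first.
  by move=> i _; congr (_%:~R); lia.
have E : ('C(j + t, j)%:R * (j`!%:R * t`!%:R) = (j + t)`!%:R :> K).
  by rewrite -!natrM; congr (_%:R); rewrite -(@bin_fact (j + t) j) ?leq_addr // addKn.
rewrite -E; have := factr_neq0 j; have := factr_neq0 t => ? ?.
have := factr_neq0 (j + t); rewrite -E mulf_eq0 negb_or => /andP[? _].
by field; apply/and3P; split.
Qed.

End Binz.

(** * Coefficients of the Jacobi identity *)

Section BinomialTransform.
Context {K : numFieldType} {W : lmodType K}.
Implicit Types (s : K) (p q x y N : int) (f g : int -> int -> W).

(* Multiplication by [(x2 + s x1)^p], expanded in non-negative powers of [x1], of
   the series with coefficient [f x y] at [x1^(-x-1) x2^(-y-1)]. *)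
Definition bt s p f x y : W :=
  \sum_(i \in [set: nat]) (s ^+ i * binz p i) *: f (x + i%:Z) (y + p - i%:Z).

Definition bnd N f := forall x y, N <= x -> f x y = 0.

Lemma btE N f s p x y M : bnd N f -> N <= x + M%:Z ->
  bt s p f x y =
  \sum_(0 <= i < M) (s ^+ i * binz p i) *: f (x + i%:Z) (y + p - i%:Z).
Proof.
by move=> bf NM; apply: nsumE => i Mi; rewrite bf ?scaler0 //; lia.
Qed.

Lemma bt_bnd N f s p : bnd N f -> bnd N (bt s p f).
Proof.
by move=> bf x y Nx; rewrite (btE (M := 0) _ _ _ bf) ?big_nil //; lia.
Qed.

Lemma bt_eq s p f g x y :
  (forall i : nat, f (x + i%:Z) (y + p - i%:Z) = g (x + i%:Z) (y + p - i%:Z)) ->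
  bt s p f x y = bt s p g x y.
Proof. by move=> fg; apply: eq_fsbigr => i _; rewrite fg. Qed.

Lemma bt0 s f x y : bt s 0 f x y = f x y.
Proof.
rewrite /bt (nsumE (N := 1)) ?big_nat1 => [|[|i] // _].
  by rewrite expr0 binz0 mulr1 scale1r; congr (f _ _); lia.
by rewrite (binz_nat_small (n := 0)) ?mulr0 ?scale0r.
Qed.

Lemma bt_shift s p f a b x y :
  bt s p (fun x y => f (x + a) (y + b)) x y = bt s p f (x + a) (y + b).
Proof.
by apply: eq_fsbigr => i _; congr (_ *: f _ _); lia.
Qed.

Lemma bt_sum N s p I (F : nat -> int -> int -> W) x y :
  (forall i, (i < I)%N -> bnd N (F i)) ->
  bt s p (fun x y => \sum_(0 <= i < I) F i x y) x y
  = \sum_(0 <= i < I) bt s p (F i) x y.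
Proof.
move=> bF; have NM : N <= x + `|N - x|%N%:Z by lia.
rewrite (btE (N := N) _ _ _ _ NM) => [|x' y' ?]; last first.
  by rewrite sum_nat0 // => i /andP[_ iI]; rewrite (bF i iI).
under eq_bigr => i _ do rewrite scaler_sumr.
rewrite exchange_big; apply: eq_big_nat => i /andP[_ iI].
by rewrite (btE _ _ _ (bF i iI) NM).
Qed.

Lemma bt_add N s p f g x y : bnd N f -> bnd N g ->
  bt s p (fun x y => f x y + g x y) x y = bt s p f x y + bt s p g x y.
Proof.
move=> bf bg; have NM : N <= x + `|N - x|%N%:Z by lia.
rewrite (btE (N := N) _ _ _ _ NM) => [|x' y' ?]; last by rewrite bf ?bg ?addr0.
rewrite (btE _ _ _ bf NM) (btE _ _ _ bg NM) -big_split.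
by apply: eq_bigr => i _; rewrite scalerDr.
Qed.

(** The exponent law for powers of x2 + s x1: each antidiagonal of the double sum carries a
    Vandermonde sum. *)
Lemma bt_bt N s p q f x y : bnd N f ->
  bt s p (bt s q f) x y = bt s (p + q) f x y.
Proof.
move=> bf; set M := `|N - x|%N; have NM : N <= x + M%:Z by lia.
rewrite (btE _ _ _ bf NM) (btE _ _ _ (bt_bnd _ _ bf) NM).
pose F i j := (s ^+ (i + j) * (binz p i * binz q j)) *:
  f (x + (i + j)%N%:Z) (y + (p + q) - (i + j)%N%:Z).
transitivity (\sum_(0 <= i < M) \sum_(0 <= j < M) F i j).
  apply: eq_bigr => i _; rewrite (btE _ _ _ bf (M := M)) ?scaler_sumr; last lia.
  apply: eq_bigr => j _; rewrite scalerA /F exprD mulrACA.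
  by congr (_ *: f _ _); lia.
rewrite sum_diag => [|i j ?]; last by rewrite /F bf ?scaler0 //; lia.
apply: eq_bigr => t _; rewrite -binz_vandermonde mulr_sumr scaler_suml.
by apply: eq_big_nat => i /andP[_ it]; rewrite /F subnKC.
Qed.

(** A value of the transform involves finitely many values of f, so it inherits their stabilisation.
    This is how infinite sums of fields are reduced to partial sums. *)
Lemma bt_eq_fin N s p f x y (g : int -> int -> nat -> W) :
  bnd N f ->
  (forall x y, exists I0, forall I, (I0 <= I)%N -> f x y = g x y I) ->
  (forall I x y, N <= x -> g x y I = 0) ->
  exists I0, forall I, (I0 <= I)%N ->
    bt s p f x y = bt s p (fun x y => g x y I) x y.
Proof.
move=> bf fg bg; have NM : N <= x + `|N - x|%N%:Z by lia.
set M := `|N - x|%N in NM.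
have [I0 I0P] : exists I0, forall I, (I0 <= I)%N -> forall i, (i < M)%N ->
    f (x + i%:Z) (y + p - i%:Z) = g (x + i%:Z) (y + p - i%:Z) I.
  elim: M {NM} => [|M [I0 IH]]; first by exists 0%N.
  have [I1 I1P] := fg (x + M%:Z) (y + p - M%:Z).
  exists (maxn I0 I1) => I; rewrite geq_max => /andP[I0I I1I] i.
  by rewrite ltnS leq_eqVlt => /predU1P[->|]; [apply: I1P|apply: IH].
exists I0 => I I0I.
rewrite (btE _ _ _ bf NM) (btE (N := N) _ _ _ _ NM) => [|? ? ?]; last exact: bg.
by apply: eq_big_nat => i /andP[_ iM]; rewrite (I0P I).
Qed.

End BinomialTransform.

Lemma bt_op (K : numFieldType) (W W' : lmodType K) N s p (f : int -> int -> W) x y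
    (G : W -> W') : bnd N f -> linear G ->
  bt s p (fun x y => G (f x y)) x y = G (bt s p f x y).
Proof.
move=> bf lG; have NM : N <= x + `|N - x|%N%:Z by lia.
rewrite (btE _ _ _ bf NM) (btE (N := N) _ _ _ _ NM) => [|x' y' ?]; last first.
  by rewrite bf // (lin0 lG).
by rewrite (lin_sum lG); apply: eq_bigr => i _; rewrite (linZ lG).
Qed.

Section Triples.
Context {K : numFieldType} {W : lmodType K}.
Implicit Types (l m n p N : int).

(* The modes of the three sides of a Jacobi identity:
   [ta n m = u_m v_n w], [tb m n = v_n u_m w] and [tc l n = (u_l v)_n w]; the
   first argument is the one for which the modes vanish when it is large. *)
Record trip := Trip {
  ta : int -> int -> W; tb : int -> int -> W; tc : int -> int -> W }.

Definition tbnd N (T : trip) := [/\ bnd N (ta T), bnd N (tb T) & bnd N (tc T)].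

Definition Phi (T : trip) l m n : W :=
  bt (-1) l (ta T) n m - (-1 : K) ^ l *: bt (-1) l (tb T) m n
  - bt 1 m (tc T) l n.

Definition tsum I (F : nat -> trip) := Trip
  (fun x y => \sum_(0 <= i < I) ta (F i) x y)
  (fun x y => \sum_(0 <= i < I) tb (F i) x y)
  (fun x y => \sum_(0 <= i < I) tc (F i) x y).

Definition tadd T1 T2 := Trip
  (fun x y => ta T1 x y + ta T2 x y) (fun x y => tb T1 x y + tb T2 x y)
  (fun x y => tc T1 x y + tc T2 x y).

(* Multiplication by [x1^p], by [x2^p] and by [(x1 - x2)^p]. *)
Definition tx1 p T := Trip
  (fun x y => ta T x (y + p)) (fun x y => tb T (x + p) y) (bt 1 p (tc T)).

Definition tx2 p T := Trip
  (fun x y => ta T (x + p) y) (fun x y => tb T x (y + p))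
  (fun x y => tc T x (y + p)).

Definition tdiff p T := Trip
  (bt (-1) p (ta T)) (fun x y => (-1 : K) ^ p *: bt (-1) p (tb T) x y)
  (fun x y => tc T (x + p) y).

Lemma tbnd_le N N' T : N <= N' -> tbnd N T -> tbnd N' T.
Proof.
by move=> NN [ba bb bc]; split=> x y ?; [apply: ba|apply: bb|apply: bc]; lia.
Qed.

Lemma tbnd_sum N I F : (forall i, (i < I)%N -> tbnd N (F i)) ->
  tbnd N (tsum I F).
Proof.
by move=> bF; split=> x y Nx; rewrite /= sum_nat0 // => i /andP[_ /bF[]];
  move=> ba bb bc; rewrite ?ba ?bb ?bc.
Qed.

Lemma tbnd_add N T1 T2 : tbnd N T1 -> tbnd N T2 -> tbnd N (tadd T1 T2).
Proof.
by move=> [a b c] [a' b' c']; split=> x y Nx;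
  rewrite /= ?a ?b ?c ?a' ?b' ?c' ?addr0.
Qed.

Lemma tbnd_x1 N p T : tbnd N T -> tbnd (N + `|p|) (tx1 p T).
Proof.
move=> [a b c]; split=> x y Nx /=; first by rewrite a //; lia.
  by rewrite b //; lia.
by rewrite (bt_bnd _ _ c) //; lia.
Qed.

(** A non-negative power keeps the bound N itself. An iterate expands into unboundedly many such
    terms, and these need one common bound. *)
Lemma tbnd_x1n N (i : nat) T : tbnd N T -> tbnd N (tx1 i T).
Proof.
move=> [a b c]; split=> x y Nx /=; first by rewrite a.
  by rewrite b //; lia.
exact: (bt_bnd _ _ c).
Qed.

Lemma tbnd_x2n N (i : nat) T : tbnd N T -> tbnd N (tx2 i T).
Proof.
by move=> [a b c]; split=> x y Nx /=; [rewrite a|rewrite b|rewrite c] => //; lia.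
Qed.

Lemma tbnd_common I F : (forall i, exists N, tbnd N (F i)) ->
  exists N, forall i : nat, (i < I)%N -> tbnd N (F i).
Proof.
move=> bF; elim: I => [|I [N IH]]; first by exists 0.
have [N' bN'] := bF I; exists (N + `|N' - N|) => i.
rewrite ltnS leq_eqVlt => /predU1P[->|/IH b]; first apply: tbnd_le bN'; first lia.
by apply: tbnd_le b; lia.
Qed.

Lemma tbnd_x2 N p T : tbnd N T -> tbnd (N + `|p|) (tx2 p T).
Proof.
by move=> [a b c]; split=> x y Nx /=; [rewrite a|rewrite b|rewrite c] => //; lia.
Qed.

Lemma tbnd_diff N p T : tbnd N T -> tbnd (N + `|p|) (tdiff p T).
Proof.
move=> [a b c]; split=> x y Nx /=; first by rewrite (bt_bnd _ _ a) //; lia.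
  by rewrite (bt_bnd _ _ b) ?scaler0 //; lia.
by rewrite c //; lia.
Qed.

(** On the iterate side x1 means x2 + x0, and the exponent law applies; on the two product sides the
    factor is a plain shift. In [Phi_diff] it is the other way round, because x1 - x2 is x0. *)
Lemma Phi_x1 N p T l m n : tbnd N T -> Phi (tx1 p T) l m n = Phi T l (m + p) n.
Proof.
move=> [a b c]; rewrite /Phi /= (bt_bt _ _ _ _ _ c); congr (_ - _ *: _ - _).
  rewrite -[n in RHS]addr0 -bt_shift; apply: bt_eq => i; congr (ta T _ _); lia.
rewrite -[n in RHS]addr0 -bt_shift; apply: bt_eq => i; congr (tb T _ _); lia.
Qed.

Lemma Phi_x2 p T l m n : Phi (tx2 p T) l m n = Phi T l m (n + p).
Proof.
rewrite /Phi /=; congr (_ - _ *: _ - _).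
- rewrite -[m in RHS]addr0 -bt_shift; apply: bt_eq => i; congr (ta T _ _); lia.
- rewrite -[m in RHS]addr0 -bt_shift; apply: bt_eq => i; congr (tb T _ _); lia.
- rewrite -[l in RHS]addr0 -bt_shift; apply: bt_eq => i; congr (tc T _ _); lia.
Qed.

Lemma N1_neq0 : (-1 : K) != 0. Proof. by rewrite oppr_eq0 oner_eq0. Qed.

Lemma linear_scale (c : K) : linear (fun w : W => c *: w).
Proof. by move=> d x y; rewrite scalerDr !scalerA mulrC. Qed.

Lemma Phi_diff N p T l m n : tbnd N T -> Phi (tdiff p T) l m n = Phi T (l + p) m n.
Proof.
move=> [a b c]; rewrite /Phi /= (bt_bt _ _ _ _ _ a).
rewrite (bt_op _ _ _ _ (bt_bnd _ _ b) (@linear_scale _)) (bt_bt _ _ _ _ _ b).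
rewrite scalerA -expfzDr ?N1_neq0 //; congr (_ - _ *: _ - _).
rewrite -[n in RHS]addr0 -bt_shift; apply: bt_eq => i; congr (tc T _ _); lia.
Qed.

Lemma Phi_sum N I F l m n : (forall i, (i < I)%N -> tbnd N (F i)) ->
  Phi (tsum I F) l m n = \sum_(0 <= i < I) Phi (F i) l m n.
Proof.
move=> bF; rewrite /Phi /= !(bt_sum (N := N));
  try by move=> i /bF[].
by rewrite scaler_sumr -!sumrB.
Qed.

Lemma Phi_add N T1 T2 l m n : tbnd N T1 -> tbnd N T2 ->
  Phi (tadd T1 T2) l m n = Phi T1 l m n + Phi T2 l m n.
Proof.
move=> [a b c] [a' b' c']; rewrite /Phi /= !(bt_add (N := N)) //.
by rewrite scalerDr !opprD [X in X + _ = _]addrACA [LHS]addrACA.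
Qed.

Lemma Phi_lim N T (F : nat -> trip) l m n : tbnd N T -> (forall I, tbnd N (F I)) ->
  (forall x y, exists I0, forall I, (I0 <= I)%N -> ta T x y = ta (F I) x y) ->
  (forall x y, exists I0, forall I, (I0 <= I)%N -> tb T x y = tb (F I) x y) ->
  (forall x y, exists I0, forall I, (I0 <= I)%N -> tc T x y = tc (F I) x y) ->
  exists I0, forall I, (I0 <= I)%N -> Phi T l m n = Phi (F I) l m n.
Proof.
move=> [a b c] bF ea eb ec.
have [||I1 I1P] := @bt_eq_fin _ _ _ (-1) l _ n m (fun x y I => ta (F I) x y) a.
  exact: ea.
  by move=> I; have [] := bF I.
have [||I2 I2P] := @bt_eq_fin _ _ _ (-1) l _ m n (fun x y I => tb (F I) x y) b.
  exact: eb.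
  by move=> I; have [] := bF I.
have [||I3 I3P] := @bt_eq_fin _ _ _ 1 m _ l n (fun x y I => tc (F I) x y) c.
  exact: ec.
  by move=> I; have [] := bF I.
exists (maxn I1 (maxn I2 I3)) => I; rewrite !geq_max => /and3P[? ? ?].
by rewrite /Phi (I1P I) ?(I2P I) ?(I3P I).
Qed.

Lemma Phi_eq T1 T2 l m n : ta T1 =2 ta T2 -> tb T1 =2 tb T2 -> tc T1 =2 tc T2 ->
  Phi T1 l m n = Phi T2 l m n.
Proof.
move=> ea eb ec; rewrite /Phi; congr (_ - _ *: _ - _); apply: bt_eq => i //.
Qed.

End Triples.

Section TripleMap.
Context {K : numFieldType} {W W' : lmodType K}.
Implicit Types (l m n N : int) (T : @trip K W).

Definition top (G : W -> W') T := Trip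
  (fun x y => G (ta T x y)) (fun x y => G (tb T x y)) (fun x y => G (tc T x y)).

Lemma tbnd_op N G T : linear G -> tbnd N T -> tbnd N (top G T).
Proof.
by move=> lG [a b c]; split=> x y Nx; rewrite /= ?a ?b ?c ?(lin0 lG).
Qed.

Lemma Phi_op N G T l m n : tbnd N T -> linear G ->
  Phi (top G T) l m n = G (Phi T l m n).
Proof.
move=> [a b c] lG; rewrite /Phi /= !(bt_op (N := N)) //.
by rewrite !(linB lG) (linZ lG).
Qed.

End TripleMap.

Section BinomialIdentities.
Context {K : numFieldType} {W : lmodType K}.

Lemma binz_trinomialC k i j :
  binz k i * binz (k - i%:Z) j = binz k j * binz (k - j%:Z) i :> K.
Proof.
rewrite -binz_trinomial -[RHS]binz_trinomial [(j + i)%N]addnC !binz_nat.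
by rewrite -(@bin_sub (i + j) j) ?leq_addl // addnK.
Qed.

Lemma N1_sqr (k : int) : (-1 : K) ^ k * (-1) ^ k = 1.
Proof. by rewrite -exprzMl ?unitrN1 // mulrNN mulr1 exp1rz. Qed.

Lemma N1_subz (k : int) (i : nat) : (-1 : K) ^ (k - i%:Z) = (-1) ^ k * (-1) ^+ i.
Proof.
rewrite expfzDr ?N1_neq0 //; congr (_ * _).
by rewrite -invr_expz -exprnP -exprVn invrN invr1.
Qed.

(* [sum_i (-1)^i C(k,i) C(i,j) x1^(k-i) x2^(i-j) = (-1)^j C(k,j) (x1 - x2)^(k-j)] *)
Lemma sum_binz_trinomial N k (f : int -> int -> W) I j n m : bnd N f ->
  (j <= I)%N -> N <= n + (I - j)%N%:Z ->
  \sum_(0 <= i < I) ((-1) ^+ i * binz k i * binz i%:Z j) *: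
    f (n + i%:Z - j%:Z) (m + k - i%:Z)
  = ((-1) ^+ j * binz k j) *: bt (-1) (k - j%:Z) f n m.
Proof.
move=> bf jI NI; rewrite (btE _ _ _ bf NI) scaler_sumr.
rewrite (big_cat_nat (n := j)) //= sum_nat0 ?add0r => [|i /andP[_ ij]]; last first.
  by rewrite binz_nat_small ?mulr0 ?scale0r.
rewrite [LHS](big_addn 0 I j); apply: eq_bigr => i _.
rewrite scalerA [X in _ = X *: _]mulrACA -binz_trinomial -exprD (addnC j i).
by congr (_ *: f _ _); [rewrite -[LHS]mulrA | lia | lia].
Qed.

End BinomialIdentities.

(** * Commutator and iterate formulas *)

Section Iterates.
Context {K : numFieldType} {V W : lmodType K}.
Context (YV : V -> int -> V -> V) (Y : V -> int -> W -> W).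

Definition tr u v w := Trip (fun n m => Y u m (Y v n w))
  (fun m n => Y v n (Y u m w)) (fun l n => Y (YV u l v) n w).

Context (lV : linear_fields YV) (lY : linear_fields Y).
Context (tV : truncated YV) (tY : truncated Y).

Lemma tr_bnd u v w : exists N, tbnd N (tr u v w).
Proof.
have [Nu uN] := tY u w; have [Nv vN] := tY v w; have [N uvN] := tV u v.
have l0 := lin0 (lY.1 _ _); have l0' := lin0 (lY.2 _ _).
exists (`|Nu| + `|Nv| + `|N|); split=> x y Nx /=.
- by rewrite vN ?l0 //; lia.
- by rewrite uN ?l0 //; lia.
- by rewrite uvN ?l0' //; lia.
Qed.

(** Truncation makes both halves of the left side finite separately, so that the sum of differences
    can be split. *)
Lemma jacobi_coefE u v w l m n :
  (\sum_(i \in [set: nat]) ((-1) ^+ i * binz l i) *: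
        (Y u (m + l - i%:Z) (Y v (n + i%:Z) w)
         - (-1 : K) ^ l *: Y v (n + l - i%:Z) (Y u (m + i%:Z) w))
    = \sum_(i \in [set: nat]) binz m i *:
        Y (YV u (l + i%:Z) v) (m + n - i%:Z) w) <->
  Phi (tr u v w) l m n = 0.
Proof.
have [N [ba bb bc]] := tr_bnd u v w.
have -> : \sum_(i \in [set: nat]) ((-1) ^+ i * binz l i) *:
        (Y u (m + l - i%:Z) (Y v (n + i%:Z) w)
         - (-1 : K) ^ l *: Y v (n + l - i%:Z) (Y u (m + i%:Z) w)) =
   bt (-1) l (ta (tr u v w)) n m - (-1 : K) ^ l *: bt (-1) l (tb (tr u v w)) m n.
  pose M := (`|N - n| + `|N - m|)%N.
  rewrite (btE (M := M) _ _ _ ba) ?(btE (M := M) _ _ _ bb); try lia.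
  rewrite (nsumE (N := M)) => [|i Mi]; last first.
    have /= -> := ba (n + i%:Z) (m + l - i%:Z); last lia.
    have /= -> := bb (m + i%:Z) (n + l - i%:Z); last lia.
    by rewrite scaler0 subrr scaler0.
  rewrite scaler_sumr -sumrB; apply: eq_bigr => i _.
  by rewrite scalerBr !scalerA [_ * (-1) ^ l]mulrC.
have -> : \sum_(i \in [set: nat]) binz m i *:
        Y (YV u (l + i%:Z) v) (m + n - i%:Z) w = bt 1 m (tc (tr u v w)) l n.
  by apply: eq_fsbigr => i _; rewrite expr1n mul1r /= [n + m]addrC.
by rewrite /Phi; split=> [->|/eqP]; rewrite ?subrr // subr_eq0 => /eqP.
Qed.

Lemma vanish_nat (v : V) w n : exists S : nat, forall s : nat, (S <= s)%N ->
  forall i, i = n + s%:Z -> Y v i w = 0.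
Proof.
have [N vN] := tY v w; exists `|N - n|%N => s ? i ->; apply: vN; lia.
Qed.

Context (g : V) (jg : forall v w l m n, Phi (tr g v w) l m n = 0).

(** The case l = 0 of the Jacobi identity, where the transforms on the product sides are trivial. *)
Lemma commutator (J : nat) v w m n :
  (forall j : nat, (J <= j)%N -> YV g j%:Z v = 0) ->
  Y g m (Y v n w) = Y v n (Y g m w)
    + \sum_(0 <= j < J) binz m j *: Y (YV g j%:Z v) (m + n - j%:Z) w.
Proof.
move=> gv; have := jg v w 0 m n; rewrite /Phi !bt0 expr0z scale1r /=.
rewrite /bt (nsumE (N := J)) => [|j Jj]; last first.
  by rewrite add0r gv // (lin0 (lY.2 _ _)) scaler0.
move/eqP; rewrite subr_eq0 subr_eq => /eqP ->; rewrite addrC; congr (_ + _).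
by apply: eq_bigr => j _; rewrite expr1n mul1r add0r [n + m]addrC.
Qed.

(** The case m = 0 of the Jacobi identity. The first sum is infinite and may be cut at any large I,
    which is the form required by [Phi_lim]. *)
Lemma iterate (G : nat) v w k n :
  (forall i : nat, (G <= i)%N -> Y g i%:Z w = 0) ->
  exists I0, forall I, (I0 <= I)%N ->
  Y (YV g k v) n w = \sum_(0 <= i < I) ((-1) ^+ i * binz k i) *:
      Y g (k - i%:Z) (Y v (n + i%:Z) w)
    - (-1 : K) ^ k *: \sum_(0 <= i < G) ((-1) ^+ i * binz k i) *:
      Y v (n + k - i%:Z) (Y g i%:Z w).
Proof.
move=> gw; have [S vS] := vanish_nat v w n; exists S => I SI.
have := jg v w k 0 n; rewrite /Phi bt0 /= /bt (nsumE (N := I)) => [|i Ii]; last first.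
  by rewrite (vS i) ?(lin0 (lY.1 _ _)) ?scaler0 //; lia.
rewrite (nsumE (N := G)) => [|i Gi]; last first.
  by rewrite add0r gw // (lin0 (lY.1 _ _)) scaler0.
move/eqP; rewrite subr_eq0 => /eqP <-.
by congr (_ - _ *: _); apply: eq_bigr => i _; rewrite add0r.
Qed.

(** After the iterate formula, the modes g_i with i >= 0 are moved past v_n. The commutators carry
    C(k,i) C(i,j), and the sum over i turns them into an expansion of (x1 - x2)^(k-j). *)
Lemma iterate_left (G J : nat) u v w k m n :
  (forall i : nat, (G <= i)%N -> Y g i%:Z w = 0) ->
  (forall j : nat, (J <= j)%N -> YV g j%:Z v = 0) ->
  exists I0, forall I, (I0 <= I)%N ->
  Y (YV g k u) m (Y v n w) =
    \sum_(0 <= i < I) ((-1) ^+ i * binz k i) *: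
       Y g (k - i%:Z) (Y u (m + i%:Z) (Y v n w))
    - (-1 : K) ^ k *: \sum_(0 <= i < G) ((-1) ^+ i * binz k i) *:
       Y u (m + (k - i%:Z)) (Y v n (Y g i%:Z w))
    - (-1 : K) ^ k *: \sum_(0 <= j < J) ((-1) ^+ j * binz k j) *:
       bt (-1) (k - j%:Z) (fun n m => Y u m (Y (YV g j%:Z v) n w)) n m.
Proof.
move=> gw gv.
have [G' gvw] : exists G', forall i : nat, (G' <= i)%N -> Y g i%:Z (Y v n w) = 0.
  have [S gS] := vanish_nat g (Y v n w) 0; exists S => i Si.
  by apply: (gS i Si); rewrite add0r.
have [M bM] : exists M, forall j : nat, (j < J)%N ->
    bnd M (fun n m => Y u m (Y (YV g j%:Z v) n w)).
  have [i|M bM] := @tbnd_common _ _ J (fun j => tr u (YV g j%:Z v) w).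
    exact: tr_bnd.
  by exists M => j /bM[].
(* The cut-off has to kill g_i on w and on v_n w, and to leave after index j enough terms for a
   transform bounded by M. *)
pose G1 := maxn (maxn G G') (J + `|M - n|)%N.
have gvw1 i : (G1 <= i)%N -> Y g i%:Z (Y v n w) = 0 by move=> ?; apply: gvw; lia.
have [I0 I0P] := iterate u k m gvw1.
exists I0 => I I0I; rewrite (I0P I I0I) -addrA; congr (_ + _).
rewrite -opprD -scalerDr; congr (- (_ *: _)).
rewrite -(sum_nat_widen (N := G) (M := G1)); first last.
- by move=> i Gi; rewrite gw // !(lin0 (lY.1 _ _)) scaler0.
- lia.
rewrite [X in _ = _ + X](_ : _ = \sum_(0 <= i < G1) \sum_(0 <= j < J)
  ((-1) ^+ i * binz k i * binz i%:Z j) *: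
    Y u (m + k - i%:Z) (Y (YV g j%:Z v) (n + i%:Z - j%:Z) w)); last first.
  rewrite exchange_big; apply: eq_big_nat => j /andP[_ jJ].
  have jG : (j <= G1)%N by lia.
  have MG : M <= n + (G1 - j)%N%:Z by lia.
  by rewrite -(sum_binz_trinomial k m (bM j jJ) jG MG).
rewrite -big_split; apply: eq_bigr => i _.
rewrite (commutator (J := J)) // (linD (lY.1 _ _)) scalerDr (lin_sum (lY.1 _ _)).
rewrite scaler_sumr; congr (_ *: _ + _); first by congr (Y u _ _); lia.
apply: eq_bigr => j _; rewrite (linZ (lY.1 _ _)) scalerA [i%:Z + n]addrC.
by [].
Qed.

(** Now it is g_(k-i) which is pulled out to the left of v_n. The identity C(k,i) C(k-i,j) = C(k,j)
    C(k-j,i) gives an expansion of (x2 - x1)^(k-j). *)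
Lemma iterate_right (G J : nat) u v w k m n :
  (forall i : nat, (G <= i)%N -> Y g i%:Z w = 0) ->
  (forall j : nat, (J <= j)%N -> YV g j%:Z v = 0) ->
  exists I0, forall I, (I0 <= I)%N ->
  Y v n (Y (YV g k u) m w) =
    \sum_(0 <= i < I) ((-1) ^+ i * binz k i) *:
       Y g (k - i%:Z) (Y v n (Y u (m + i%:Z) w))
    - (-1 : K) ^ k *: \sum_(0 <= i < G) ((-1) ^+ i * binz k i) *:
       Y v n (Y u (m + (k - i%:Z)) (Y g i%:Z w))
    - \sum_(0 <= j < J) binz k j *:
       bt (-1) (k - j%:Z) (fun m n => Y (YV g j%:Z v) n (Y u m w)) m n.
Proof.
move=> gw gv; have [I0 I0P] := iterate u k m gw.
have [M bM] : exists M, forall j : nat, (j < J)%N ->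
    bnd M (fun m n => Y (YV g j%:Z v) n (Y u m w)).
  have [i|M bM] := @tbnd_common _ _ J (fun j => tr u (YV g j%:Z v) w).
    exact: tr_bnd.
  by exists M => j /bM[].
exists (I0 + `|M - m|)%N => I I0I; rewrite (I0P I); last lia.
rewrite (linB (lY.1 _ _)) (linZ (lY.1 _ _)) !(lin_sum (lY.1 _ _)).
rewrite addrAC; congr (_ - _ *: _); last first.
  by apply: eq_bigr => i _; rewrite (linZ (lY.1 _ _)); congr (_ *: Y v n (Y u _ _)); lia.
rewrite [X in _ = _ - X](_ : _ = \sum_(0 <= i < I) \sum_(0 <= j < J)
  ((-1) ^+ i * binz k i * binz (k - i%:Z) j) *:
    Y (YV g j%:Z v) (n + (k - j%:Z) - i%:Z) (Y u (m + i%:Z) w)); last first.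
  rewrite exchange_big; apply: eq_big_nat => j /andP[_ jJ].
  rewrite (btE _ _ _ (bM _ jJ) (M := I)); last lia.
  rewrite scaler_sumr; apply: eq_bigr => i _; rewrite scalerA.
  by congr (_ *: _); rewrite -mulrA binz_trinomialC mulrCA mulrA.
rewrite -sumrB; apply: eq_bigr => i _; rewrite (linZ (lY.1 _ _)).
rewrite (commutator (J := J) (v := v)) // scalerDr scaler_sumr.
rewrite [X in _ = _ + _ - X](eq_bigr (fun j => ((-1) ^+ i * binz k i) *: (binz (k - i%:Z) j *: Y (YV g j%:Z v) (k - i%:Z + n - j%:Z) (Y u (m + i%:Z) w)))).
  by rewrite addrK.
by move=> j _; rewrite scalerA; congr (_ *: Y _ _ _); lia.
Qed.

End Iterates.

(** * Jacobi coefficients of iterates *)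

Section Closure.
Context {K : numFieldType} {V W : lmodType K}.
Context (YV : V -> int -> V -> V) (Y : V -> int -> W -> W).
Context (lV : linear_fields YV) (lY : linear_fields Y).
Context (tV : truncated YV) (tY : truncated Y).
Context (g : V) (jV : forall v w l m n, Phi (tr YV YV g v w) l m n = 0).
Context (jY : forall v w l m n, Phi (tr YV Y g v w) l m n = 0).

Local Notation T := (tr YV Y).

(** The iterate formula is used twice, first for the fields on V and then for each resulting g_(k-i)
    acting inside a field on W. The factors which arise are powers of x2 + x0, that is, of x1. *)
Lemma iterate_of_iterate (G J : nat) u v w k l n :
  (forall i : nat, (G <= i)%N -> Y g i%:Z w = 0) ->
  (forall j : nat, (J <= j)%N -> YV g j%:Z v = 0) ->
  exists I0, forall I, (I0 <= I)%N ->
  Y (YV (YV g k u) l v) n w =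
    \sum_(0 <= i < I) ((-1) ^+ i * binz k i) *:
       Y g (k - i%:Z) (bt 1 i (fun l n => Y (YV u l v) n w) l n)
    - (-1 : K) ^ k *: \sum_(0 <= i < G) ((-1) ^+ i * binz k i) *:
       bt 1 (k - i%:Z) (fun l n => Y (YV u l v) n (Y g i%:Z w)) l n
    - (-1 : K) ^ k *: \sum_(0 <= j < J) ((-1) ^+ j * binz k j) *:
       Y (YV u (l + (k - j%:Z)) (YV g j%:Z v)) n w.
Proof.
move=> gw gv; have [I0 I0P] := iterate lV tV jV u k l gv.
have [L uvL] := vanish_nat tV u v l.
have l0 := lin0 (lY.1 _ _); have l0' := lin0 (lY.2 _ _).
pose z i := YV u (l + i%:Z) v.
(* One cut-off for all i < L; the states z i vanish from L on. *)
have [S zS] : exists S, forall i, (i < L)%N -> forall I, (S <= I)%N ->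
    (forall s : nat, (S <= s)%N -> Y (z i) (n + s%:Z) w = 0) /\
    Y (YV g (k - i%:Z) (z i)) n w =
      \sum_(0 <= s < I) ((-1) ^+ s * binz (k - i%:Z) s) *:
         Y g (k - i%:Z - s%:Z) (Y (z i) (n + s%:Z) w)
      - (-1 : K) ^ (k - i%:Z) *:
        \sum_(0 <= s < G) ((-1) ^+ s * binz (k - i%:Z) s) *:
           Y (z i) (n + (k - i%:Z) - s%:Z) (Y g s%:Z w).
  elim: {uvL} L => [|L [S IH]]; first by exists 0%N.
  have [S1 S1P] := vanish_nat tY (z L) w n.
  have [S2 S2P] := iterate lY tY jY (z L) (k - L%:Z) n gw.
  exists (maxn S (maxn S1 S2)) => i iL I SI; move: iL.
  rewrite ltnS leq_eqVlt => /predU1P[->|iL]; split.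
  - by move=> s ?; apply: (S1P s) => //; lia.
  - by apply: S2P; lia.
  - by move=> s ?; have [|+ _] := IH i iL I; [lia|apply; lia].
  - by have [|_ ->] := IH i iL I; first lia.
exists (I0 + L + S)%N => I II.
have z0 i : (L <= i)%N -> z i = 0 by move=> Li; apply: (uvL i Li).
rewrite (I0P I); last lia.
rewrite (linB (lY.2 _ _)) (linZ (lY.2 _ _)) !(lin_sum (lY.2 _ _)).
congr (_ - _ *: _); last first.
  apply: eq_bigr => j _; rewrite (linZ (lY.2 _ _)); congr (_ *: Y (YV u _ _) _ _).
  by lia.
transitivity (\sum_(0 <= i < I) ((\sum_(0 <= s < I)
    ((-1) ^+ (i + s) * (binz k i * binz (k - i%:Z) s)) *:
         Y g (k - (i + s)%N%:Z) (Y (z i) (n + s%:Z) w))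
    - (-1 : K) ^ k *: \sum_(0 <= s < G) ((-1) ^+ s * binz k s) *:
      ((1 ^+ i * binz (k - s%:Z) i) *:
           Y (z i) (n + (k - s%:Z) - i%:Z) (Y g s%:Z w)))).
  apply: eq_bigr => i _; rewrite (linZ (lY.2 _ _)).
  have [Li|iL] := leqP L i.
    rewrite -/(z i) z0 // (lin0 (lV.1 _ _)) l0' scaler0.
    rewrite !big1 ?scaler0 ?subrr // => j _; first by rewrite l0' !scaler0.
    by rewrite l0' l0 scaler0.
  have [|_ ->] := zS i iL I; first lia.
  rewrite scalerBr N1_subz; congr (_ - _).
    rewrite scaler_sumr; apply: eq_bigr => s _; rewrite scalerA exprD mulrACA.
    by congr (_ *: Y _ _ _); lia.
  rewrite scalerA (_ : _ * (_ * _) = (-1) ^ k * binz k i); last first.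
    by rewrite mulrC mulrA -[X in X * _]mulrA -expr2 sqrr_sign mulr1.
  rewrite -scalerA; congr (_ *: _); rewrite scaler_sumr; apply: eq_bigr => s _.
  rewrite !scalerA expr1n mul1r mulrCA binz_trinomialC mulrA.
  by congr (_ *: Y _ _ _); lia.
rewrite sumrB -scaler_sumr; congr (_ - _ *: _); last first.
  rewrite exchange_big; apply: eq_bigr => s _; rewrite -scaler_sumr.
  congr (_ *: _); rewrite /bt (nsumE (N := I)) // => i Ii.
  by have := z0 i; rewrite /z => ->; [rewrite l0' scaler0|lia].
(* The mode g_(k-i-s) depends on t = i + s only, and the antidiagonal t collects the expansion of
   (x2 + x0)^t. *)
rewrite sum_diag => [|i s Iis]; last first.
  have [Li|iL] := leqP L i; first by rewrite z0 // l0' l0 scaler0.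
  have [|zs _] := zS i iL S; first lia.
  by rewrite zs ?l0 ?scaler0 //; lia.
apply: eq_bigr => t _; rewrite /bt (nsumE (N := t.+1)) => [|i ti]; last first.
  by rewrite binz_nat_small ?mulr0 ?scale0r.
rewrite (lin_sum (lY.1 _ _)) scaler_sumr; apply: eq_big_nat => i /andP[_ it].
rewrite (linZ (lY.1 _ _)) scalerA subnKC // expr1n mul1r -binz_trinomial.
rewrite subnKC // -mulrA; congr (_ *: Y _ _ (Y _ _ _)).
by lia.
Qed.

(** The expansions of the three sides have one shape: the triple of g_k u combines triples
    multiplied by x1^i, x1^(k-i) and (x1 - x2)^(k-j), and [Phi] turns these factors into shifts of m
    and l. *)
Lemma Phi_iterate_left (G J : nat) u v w k l m n :
  (forall i : nat, (G <= i)%N -> Y g i%:Z w = 0) ->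
  (forall j : nat, (J <= j)%N -> YV g j%:Z v = 0) ->
  exists I0, forall I, (I0 <= I)%N ->
  Phi (T (YV g k u) v w) l m n =
    \sum_(0 <= i < I) ((-1) ^+ i * binz k i) *:
       Y g (k - i%:Z) (Phi (T u v w) l (m + i%:Z) n)
    - (-1 : K) ^ k *: \sum_(0 <= i < G) ((-1) ^+ i * binz k i) *:
       Phi (T u v (Y g i%:Z w)) l (m + (k - i%:Z)) n
    - (-1 : K) ^ k *: \sum_(0 <= j < J) ((-1) ^+ j * binz k j) *:
       Phi (T u (YV g j%:Z v) w) (l + (k - j%:Z)) m n.
Proof.
move=> gw gv.
pose c (i : nat) : K := (-1) ^+ i * binz k i; pose d : K := - (-1) ^ k.
pose F1 (i : nat) := top (fun z => c i *: Y g (k - i%:Z) z) (tx1 i (T u v w)).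
pose F2 (i : nat) := top (fun z => c i *: z) (tx1 (k - i%:Z) (T u v (Y g i%:Z w))).
pose F3 (j : nat) := top (fun z => c j *: z) (tdiff (k - j%:Z) (T u (YV g j%:Z v) w)).
pose TI I := tadd (tadd (tsum I F1) (top (fun z => d *: z) (tsum G F2)))
  (top (fun z => d *: z) (tsum J F3)).
have lc i : linear (fun z => c i *: Y g (k - i%:Z) z).
  by move=> a x y; rewrite (lY.1 _ _) scalerDr !scalerA mulrC.
have bd := tr_bnd lY tV tY.
have [N1 bF1] : exists N, forall i, tbnd N (F1 i).
  have [N bN] := bd u v w; exists N => i; apply: tbnd_op => //.
  exact: tbnd_x1n.
have [N2 bF2] : exists N, forall i, (i < G)%N -> tbnd N (F2 i).
  apply: tbnd_common => i; have [N /(tbnd_x1 (k - i%:Z)) bN] := bd u v (Y g i%:Z w).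
  by eexists; apply: tbnd_op bN; apply: linear_scale.
have [N3 bF3] : exists N, forall j, (j < J)%N -> tbnd N (F3 j).
  apply: tbnd_common => j; have [N /(tbnd_diff (k - j%:Z)) bN] := bd u (YV g j%:Z v) w.
  by eexists; apply: tbnd_op bN; apply: linear_scale.
have [N0 bT] := bd (YV g k u) v w.
pose N : int := `|N0| + `|N1| + `|N2| + `|N3|.
have {}bT : tbnd N (T (YV g k u) v w) by apply: tbnd_le bT; lia.
have {}bF1 i : tbnd N (F1 i) by apply: tbnd_le (bF1 i); lia.
have {}bF2 i : (i < G)%N -> tbnd N (F2 i) by move/bF2; apply: tbnd_le; lia.
have {}bF3 i : (i < J)%N -> tbnd N (F3 i) by move/bF3; apply: tbnd_le; lia.
have ls a := @linear_scale K W a.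
have b1 I : tbnd N (tsum I F1) by apply: tbnd_sum.
have b2 : tbnd N (top (fun z => d *: z) (tsum G F2)).
  by apply: tbnd_op (ls _) _; apply: tbnd_sum.
have b3 : tbnd N (top (fun z => d *: z) (tsum J F3)).
  by apply: tbnd_op (ls _) _; apply: tbnd_sum.
have b12 I := tbnd_add (b1 I) b2.
have [|x y|x y|x y|I0 I0P] := @Phi_lim _ _ N _ TI l m n bT.
- by move=> I; apply: tbnd_add.
- have [I0 I0P] := iterate_left lY tV tY jY u k y x gw gv.
  by exists I0 => I /I0P /= ->; rewrite /d !scaleNr.
- have [I0 I0P] := iterate_right lY tV tY jY u k x y gw gv.
  exists I0 => I /I0P /= ->; rewrite /d !scaleNr; congr (_ - _).
  rewrite scaler_sumr; apply: eq_bigr => j _; rewrite !scalerA /c N1_subz.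
  congr (_ *: _); have := @N1_sqr K k; have := @sqrr_sign K j; rewrite expr2.
  move: ((-1) ^ k) ((-1) ^+ j) => a b bb aa.
  by rewrite -[LHS]mul1r -[in LHS]aa -[LHS]mul1r -[in LHS]bb; ring.
- have [I0 I0P] := iterate_of_iterate u k x y gw gv.
  by exists I0 => I /I0P /= ->; rewrite /d !scaleNr.
exists I0 => I /I0P ->; rewrite /TI (Phi_add _ _ _ (b12 I) b3).
rewrite (Phi_add _ _ _ (b1 I) b2) !(Phi_op (N := N)) //; try exact: tbnd_sum.
rewrite !(Phi_sum (N := N)) // /d !scaleNr.
congr (_ - _ *: _ - _ *: _); apply: eq_big_nat => i /andP[_ iI].
- have [M bM] := bd u v w.
  by rewrite (Phi_op _ _ _ (tbnd_x1n _ bM)) // (Phi_x1 _ _ _ _ bM).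
- have [M bM] := bd u v (Y g i%:Z w).
  by rewrite (Phi_op _ _ _ (tbnd_x1 _ bM)) // (Phi_x1 _ _ _ _ bM).
- have [M bM] := bd u (YV g i%:Z v) w.
  by rewrite (Phi_op _ _ _ (tbnd_diff _ bM)) // (Phi_diff _ _ _ _ bM).
Qed.

Lemma iterate_of_product (G J : nat) u v w k l n :
  (forall i : nat, (G <= i)%N -> Y g i%:Z w = 0) ->
  (forall j : nat, (J <= j)%N -> YV g j%:Z u = 0) ->
  exists I0, forall I, (I0 <= I)%N ->
  Y (YV u l (YV g k v)) n w =
    \sum_(0 <= i < I) ((-1) ^+ i * binz k i) *:
       Y g (k - i%:Z) (Y (YV u l v) (n + i%:Z) w)
    - (-1 : K) ^ k *: \sum_(0 <= i < G) ((-1) ^+ i * binz k i) *: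
       Y (YV u l v) (n + (k - i%:Z)) (Y g i%:Z w)
    - \sum_(0 <= j < J) binz k j *: Y (YV (YV g j%:Z u) (l + (k - j%:Z)) v) n w.
Proof.
move=> gw gu; have [I0 I0P] := iterate lY tY jY (YV u l v) k n gw.
exists I0 => I II; have := commutator lV jV v k l gu => /eqP.
rewrite -subr_eq => /eqP <-; rewrite (linB (lY.2 _ _)) (I0P I II).
rewrite (lin_sum (lY.2 _ _)); congr (_ - _ *: _ - _).
  by apply: eq_bigr => i _; congr (_ *: Y _ _ _); lia.
apply: eq_bigr => j _; rewrite (linZ (lY.2 _ _)).
by congr (_ *: Y (YV _ _ _) _ _); lia.
Qed.

(** The product sides come from [iterate_left] and [iterate_right] with u and v interchanged, so
    that powers of x2 replace those of x1. Only the iterate side, where g_k acts inside, has its own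
    formula. *)
Lemma Phi_iterate_right (G J : nat) u v w k l m n :
  (forall i : nat, (G <= i)%N -> Y g i%:Z w = 0) ->
  (forall j : nat, (J <= j)%N -> YV g j%:Z u = 0) ->
  exists I0, forall I, (I0 <= I)%N ->
  Phi (T u (YV g k v) w) l m n =
    \sum_(0 <= i < I) ((-1) ^+ i * binz k i) *:
       Y g (k - i%:Z) (Phi (T u v w) l m (n + i%:Z))
    - (-1 : K) ^ k *: \sum_(0 <= i < G) ((-1) ^+ i * binz k i) *:
       Phi (T u v (Y g i%:Z w)) l m (n + (k - i%:Z))
    - \sum_(0 <= j < J) binz k j *:
       Phi (T (YV g j%:Z u) v w) (l + (k - j%:Z)) m n.
Proof.
move=> gw gu.
pose c (i : nat) : K := (-1) ^+ i * binz k i; pose d : K := - (-1) ^ k.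
pose F1 (i : nat) := top (fun z => c i *: Y g (k - i%:Z) z) (tx2 i (T u v w)).
pose F2 (i : nat) := top (fun z => c i *: z) (tx2 (k - i%:Z) (T u v (Y g i%:Z w))).
pose F3 (j : nat) := top (fun z => binz k j *: z) (tdiff (k - j%:Z) (T (YV g j%:Z u) v w)).
pose TI I := tadd (tadd (tsum I F1) (top (fun z => d *: z) (tsum G F2)))
  (top (fun z => -1 *: z) (tsum J F3)).
have lc i : linear (fun z => c i *: Y g (k - i%:Z) z).
  by move=> a x y; rewrite (lY.1 _ _) scalerDr !scalerA mulrC.
have bd := tr_bnd lY tV tY.
have [N1 bF1] : exists N, forall i, tbnd N (F1 i).
  have [N bN] := bd u v w; exists N => i; apply: tbnd_op => //.
  exact: tbnd_x2n.
have [N2 bF2] : exists N, forall i, (i < G)%N -> tbnd N (F2 i).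
  apply: tbnd_common => i; have [N /(tbnd_x2 (k - i%:Z)) bN] := bd u v (Y g i%:Z w).
  by eexists; apply: tbnd_op bN; apply: linear_scale.
have [N3 bF3] : exists N, forall j, (j < J)%N -> tbnd N (F3 j).
  apply: tbnd_common => j; have [N /(tbnd_diff (k - j%:Z)) bN] := bd (YV g j%:Z u) v w.
  by eexists; apply: tbnd_op bN; apply: linear_scale.
have [N0 bT] := bd u (YV g k v) w.
pose N : int := `|N0| + `|N1| + `|N2| + `|N3|.
have {}bT : tbnd N (T u (YV g k v) w) by apply: tbnd_le bT; lia.
have {}bF1 i : tbnd N (F1 i) by apply: tbnd_le (bF1 i); lia.
have {}bF2 i : (i < G)%N -> tbnd N (F2 i) by move/bF2; apply: tbnd_le; lia.
have {}bF3 i : (i < J)%N -> tbnd N (F3 i) by move/bF3; apply: tbnd_le; lia.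
have ls a := @linear_scale K W a.
have b1 I : tbnd N (tsum I F1) by apply: tbnd_sum.
have b2 : tbnd N (top (fun z => d *: z) (tsum G F2)).
  by apply: tbnd_op (ls _) _; apply: tbnd_sum.
have b3 : tbnd N (top (fun z => -1 *: z) (tsum J F3)).
  by apply: tbnd_op (ls _) _; apply: tbnd_sum.
have b12 I := tbnd_add (b1 I) b2.
have [|x y|x y|x y|I0 I0P] := @Phi_lim _ _ N _ TI l m n bT.
- by move=> I; apply: tbnd_add.
- have [I0 I0P] := iterate_right lY tV tY jY v k x y gw gu.
  by exists I0 => I /I0P /= ->; rewrite /d !scaleNr scale1r.
- have [I0 I0P] := iterate_left lY tV tY jY v k y x gw gu.
  exists I0 => I /I0P /= ->; rewrite /d !scaleNr scale1r; congr (_ - _).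
  rewrite scaler_sumr; apply: eq_bigr => j _; rewrite !scalerA N1_subz.
  by congr (_ *: _); rewrite mulrA mulrC.
- have [I0 I0P] := iterate_of_product v k x y gw gu.
  by exists I0 => I /I0P /= ->; rewrite /d !scaleNr scale1r.
exists I0 => I /I0P ->; rewrite /TI (Phi_add _ _ _ (b12 I) b3).
rewrite (Phi_add _ _ _ (b1 I) b2) !(Phi_op (N := N)) //; try exact: tbnd_sum.
rewrite !(Phi_sum (N := N)) // /d !scaleNr scale1r.
congr (_ - _ *: _ - _); apply: eq_big_nat => i /andP[_ iI].
- have [M bM] := bd u v w.
  by rewrite (Phi_op _ _ _ (tbnd_x2n _ bM)) // Phi_x2.
- have [M bM] := bd u v (Y g i%:Z w).
  by rewrite (Phi_op _ _ _ (tbnd_x2 _ bM)) // Phi_x2.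
- have [M bM] := bd (YV g i%:Z u) v w.
  by rewrite (Phi_op _ _ _ (tbnd_diff _ bM)) // (Phi_diff _ _ _ _ bM).
Qed.

End Closure.

(** * Exponentials of Heisenberg operators *)

Section SeriesExp.
Context {K : numFieldType} {W : lmodType K}.
Implicit Types (a b : nat -> W -> W).

Lemma series_pow_linear a k r : (forall n, linear (a n)) -> linear (series_pow a k r).
Proof.
move=> la; elim: k r => [|k IHk] r c x y /=.
  by case: eqP => // _; rewrite scaler0 addr0.
rewrite scaler_sumr -big_split; apply: eq_bigr => n _ /=.
by rewrite IHk la.
Qed.

Lemma series_exp_linear a r : (forall n, linear (a n)) -> linear (series_exp a r).
Proof.
move=> la c x y; rewrite /series_exp scaler_sumr -big_split.
apply: eq_bigr => k _ /=.
by rewrite (series_pow_linear _ _ la) scalerDr !scalerA mulrC.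
Qed.

Lemma series_pow_small a k r w : (forall n, linear (a n)) -> (r < k)%N ->
  series_pow a k r w = 0.
Proof.
move=> la; elim: k r => [|k IHk] r //= rk; apply: sum_nat0 => n /andP[n0 nr].
by rewrite IHk ?(lin0 (la _)) //; lia.
Qed.

(* [series_exp], extended by 0 to negative indices. *)
Definition XZ a (r : int) w : W := if 0 <= r then series_exp a `|r|%N w else 0.

Lemma XZ_neg a r w : r < 0 -> XZ a r w = 0.
Proof. by rewrite /XZ leNgt => ->. Qed.

Lemma XZ0 a w : XZ a 0 w = w.
Proof. by rewrite /XZ /series_exp lexx big_ord1 /= invr1 scale1r. Qed.

Lemma XZ_linear a r : (forall n, linear (a n)) -> linear (XZ a r).
Proof.
move=> la c x y; rewrite /XZ; case: ifP => _; last by rewrite scaler0 addr0.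
exact: series_exp_linear.
Qed.

Lemma series_exp_widen a r M w : (forall n, linear (a n)) -> (r < M)%N ->
  series_exp a r w = \sum_(0 <= k < M) (k`!%:R)^-1 *: series_pow a k r w.
Proof.
move=> la rM; rewrite /series_exp -(big_mkord xpredT (fun k => (k`!%:R)^-1 *: series_pow a k r w)).
rewrite (sum_nat_widen (N := r.+1) (M := M)) // => i ri.
by rewrite series_pow_small ?scaler0.
Qed.

Lemma eq_series_pow a b k r w : (forall n z, (0 < n)%N -> a n z = b n z) ->
  series_pow a k r w = series_pow b k r w.
Proof.
move=> ab; elim: k r => [|k IHk] r //=.
by apply: eq_big_nat => n /andP[n0 _]; rewrite IHk ab.
Qed.

Lemma eq_XZ a b r w : (forall n z, (0 < n)%N -> a n z = b n z) ->
  XZ a r w = XZ b r w.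
Proof.
move=> ab; rewrite /XZ; case: ifP => // _; apply: eq_bigr => k _.
by rewrite (eq_series_pow _ _ _ ab).
Qed.

Lemma sum_XZ_nat (F : nat -> nat -> W) r N : (r < N)%N ->
  \sum_(1 <= n < N) (if (n <= r)%N then F n (r - n)%N else 0)
  = \sum_(1 <= n < r.+1) F n (r - n)%N.
Proof.
move=> rN; rewrite (big_cat_nat (n := r.+1)) //= [X in _ + X]sum_nat0 ?addr0.
  by apply: eq_big_nat => n /andP[_]; rewrite ltnS => ->.
by move=> n /andP[]; rewrite ltnNge => /negPf ->.
Qed.

Lemma XZ_sub a (r n : nat) w :
  XZ a (r%:Z - n%:Z) w = if (n <= r)%N then series_exp a (r - n)%N w else 0.
Proof.
rewrite /XZ subr_ge0 lez_nat; case: ifP => // nr; congr series_exp; lia.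
Qed.

(* [[T, a_n] = c_n] implies [[T, exp (sum_n a_n z^n)] = (sum_n c_n z^n) exp (..)]. *)
Lemma series_pow_comm a (T : W -> W) (c : nat -> K) k r w :
  (forall n, linear (a n)) -> linear T ->
  (forall n z, (0 < n)%N -> T (a n z) = a n (T z) + c n *: z) ->
  T (series_pow a k r w) = series_pow a k r (T w)
    + \sum_(1 <= n < r.+1) c n *: (k%:R *: series_pow a k.-1 (r - n)%N w).
Proof.
move=> la lT comm; elim: k r => [|k IHk] r /=.
  rewrite [X in _ = _ + X]big1 ?addr0 => [|n _]; last by rewrite scale0r scaler0.
  by case: eqP => // _; apply: lin0.
rewrite (lin_sum lT).
rewrite (eq_big_nat _ _ (F2 := fun n => a n (series_pow a k (r - n)%N (T w)) +
   (a n (\sum_(1 <= m < (r - n).+1) c m *: (k%:R *: series_pow a k.-1 (r - n - m)%N w))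
   + c n *: series_pow a k (r - n)%N w))); last first.
  by move=> n /andP[n0 nr]; rewrite comm // IHk (linD (la n)) addrA.
rewrite big_split /=; congr (_ + _).
rewrite big_split /=.
transitivity (\sum_(1 <= n < r.+1) c n *: (k%:R *: series_pow a k (r - n)%N w)
  + \sum_(1 <= n < r.+1) c n *: series_pow a k (r - n)%N w); last first.
  rewrite -big_split; apply: eq_bigr => n _ /=.
  by rewrite -scalerDr -{2}[series_pow _ _ _ _]scale1r -scalerDl natr1.
congr (_ + _).
have widen n (F : nat -> nat -> W) : (0 < n)%N -> (n <= r)%N ->
    \sum_(1 <= m < (r - n).+1) F m (r - n - m)%N =
    \sum_(1 <= m < r.+1) if (n + m <= r)%N then F m (r - (n + m))%N else 0.
  move=> n0 nr; rewrite -(@sum_XZ_nat _ (r - n)%N r.+1); last lia.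
  apply: eq_bigr => m _; rewrite subnDA.
  by have -> : (m <= r - n)%N = (n + m <= r)%N by lia.
case: k {IHk} => [|k].
  rewrite [RHS]big1 => [|n _]; last by rewrite mulr0n scale0r scaler0.
  by rewrite big1 // => n _; rewrite big1 ?(lin0 (la _)) // => m _;
    rewrite mulr0n scale0r scaler0.
transitivity (\sum_(1 <= n < r.+1) \sum_(1 <= m < r.+1)
   if (n + m <= r)%N then c m *: (k.+1%:R *: a n (series_pow a k (r - (n + m))%N w)) else 0).
  apply: eq_big_nat => n /andP[n0 nr].
  rewrite (lin_sum (la n)) -(widen n (fun m s => c m *: (k.+1%:R *: a n (series_pow a k s w)))) //.
  by apply: eq_bigr => m _; rewrite !(linZ (la n)).
rewrite exchange_big; apply: eq_big_nat => m /andP[m0 mr] /=.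
rewrite [LHS](eq_bigr (fun n => if (m + n <= r)%N then
    c m *: (k.+1%:R *: a n (series_pow a k (r - (m + n))%N w)) else 0)); last first.
  by move=> n _; rewrite addnC.
by rewrite -(widen m (fun n s => c m *: (k.+1%:R *: a n (series_pow a k s w)))) // !scaler_sumr.
Qed.

Lemma XZ_comm a (T : W -> W) (c : nat -> K) r w N :
  (forall n, linear (a n)) -> linear T ->
  (forall n z, (0 < n)%N -> T (a n z) = a n (T z) + c n *: z) -> r < N%:Z ->
  T (XZ a r w) = XZ a r (T w) + \sum_(1 <= n < N) c n *: XZ a (r - n%:Z) w.
Proof.
move=> la lT comm; have [r0 _|] := ltP r 0.
  rewrite !XZ_neg // (lin0 lT) add0r sum_nat0 // => n /andP[n0 _].
  by rewrite XZ_neg ?scaler0 //; lia.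
case: r => [r _ rN|//]; rewrite [XZ a r w]/XZ [XZ a r (T w)]/XZ lez_nat leq0n /=.
rewrite /series_exp (lin_sum lT).
rewrite (eq_bigr (fun k : 'I_r.+1 => (k`!%:R)^-1 *: series_pow a k r (T w) +
  \sum_(1 <= n < r.+1) c n *: (((k`!%:R)^-1 * k%:R) *: series_pow a k.-1 (r - n)%N w))).
  rewrite big_split /=; congr (_ + _); rewrite exchange_big /=.
  have rN' : (r < N)%N by lia.
  rewrite [RHS](eq_big_nat _ _ (F2 := fun n => if (n <= r)%N then c n *: series_exp a (r - n)%N w else 0)); last first.
    by move=> n _; rewrite XZ_sub; case: ifP; rewrite ?scaler0.
  rewrite (sum_XZ_nat (fun n s => c n *: series_exp a s w)) //.
  apply: eq_big_nat => n /andP[n0 nr]; rewrite -scaler_sumr; congr (_ *: _).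
  rewrite big_ord_recl /= mulr0 scale0r add0r.
  rewrite (@series_exp_widen _ _ r) //; last lia.
  rewrite big_mkord; apply: eq_bigr => k _; rewrite /bump /= add1n factS natrM invfM mulrC mulrA.
  by rewrite divff ?natS_neq0 // mul1r.
move=> k _; rewrite (linZ lT) (series_pow_comm _ _ _ la lT comm) scalerDr scaler_sumr.
congr (_ + _); apply: eq_bigr => n _.
by rewrite !scalerA; congr (_ *: _); ring.
Qed.

Lemma XZ_commute a (T : W -> W) r w :
  (forall n, linear (a n)) -> linear T ->
  (forall n z, (0 < n)%N -> T (a n z) = a n (T z)) -> T (XZ a r w) = XZ a r (T w).
Proof.
move=> la lT comm; rewrite (@XZ_comm _ _ (fun=> 0) _ _ `|r|%N.+1) //.
- by rewrite big1 ?addr0 // => n _; rewrite scale0r.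
- by move=> n z n0; rewrite comm // scale0r addr0.
- by lia.
Qed.

Definition commuting a := forall m n z, a m (a n z) = a n (a m z).

(* The Euler operator: [z d/dz exp (f z) = z f'(z) exp (f z)]. *)
Lemma series_pow_euler a k r w : (forall n, linear (a n)) -> commuting a ->
  r%:R *: series_pow a k.+1 r w
  = \sum_(1 <= n < r.+1) (k.+1%:R * n%:R) *: a n (series_pow a k (r - n)%N w).
Proof.
move=> la ca; elim: k r => [|k IHk] r.
  rewrite /= scaler_sumr; apply: eq_big_nat => n /andP[n0 nr]; rewrite mul1r.
  have [rn|rn] := eqVneq (r - n)%N 0%N; last by rewrite (lin0 (la _)) !scaler0.
  by have -> : r = n by lia.
rewrite -[series_pow a k.+2 r w]/(\sum_(1 <= n < r.+1) a n (series_pow a k.+1 (r - n)%N w)).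
rewrite scaler_sumr.
rewrite (eq_big_nat _ _ (F2 := fun n => n%:R *: a n (series_pow a k.+1 (r - n)%N w) +
   a n (\sum_(1 <= m < (r - n).+1) (k.+1%:R * m%:R) *: a m (series_pow a k (r - n - m)%N w)))); last first.
  move=> n /andP[n0 nr]; rewrite -IHk (linZ (la n)) -scalerDl -natrD.
  by congr (_%:R *: _); lia.
rewrite big_split /= [RHS](eq_bigr (fun n => n%:R *: a n (series_pow a k.+1 (r - n)%N w) +
   (k.+1%:R * n%:R) *: a n (series_pow a k.+1 (r - n)%N w))); last first.
  by move=> n _; rewrite -scalerDl -[k.+2%:R]nat1r mulrDl mul1r.
rewrite [RHS]big_split /=; congr (_ + _).
have widen n (F : nat -> nat -> W) : (0 < n)%N -> (n <= r)%N ->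
    \sum_(1 <= m < (r - n).+1) F m (r - n - m)%N =
    \sum_(1 <= m < r.+1) if (n + m <= r)%N then F m (r - (n + m))%N else 0.
  move=> n0 nr; rewrite -(@sum_XZ_nat _ (r - n)%N r.+1); last lia.
  apply: eq_bigr => m _; rewrite subnDA.
  by have -> : (m <= r - n)%N = (n + m <= r)%N by lia.
transitivity (\sum_(1 <= n < r.+1) \sum_(1 <= m < r.+1)
   if (n + m <= r)%N then (k.+1%:R * m%:R) *: a m (a n (series_pow a k (r - (n + m))%N w)) else 0).
  apply: eq_big_nat => n /andP[n0 nr].
  rewrite (lin_sum (la n)) -(widen n (fun m s => (k.+1%:R * m%:R) *: a m (a n (series_pow a k s w)))) //.
  by apply: eq_bigr => m _; rewrite (linZ (la n)) ca.
rewrite exchange_big; apply: eq_big_nat => m /andP[m0 mr] /=.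
rewrite [LHS](eq_bigr (fun n => if (m + n <= r)%N then
    (k.+1%:R * m%:R) *: a m (a n (series_pow a k (r - (m + n))%N w)) else 0)); last first.
  by move=> n _; rewrite addnC.
rewrite -(widen m (fun n s => (k.+1%:R * m%:R) *: a m (a n (series_pow a k s w)))) //.
by rewrite (lin_sum (la m)) scaler_sumr.
Qed.

(** The Euler operator, summed over the powers. Together with the values for r <= 0 this recursion
    characterises the exponential, see [XZ_unique]. *)
Lemma XZ_rec a r w N : (forall n, linear (a n)) -> commuting a -> r < N%:Z ->
  r%:~R *: XZ a r w = \sum_(1 <= n < N) n%:R *: a n (XZ a (r - n%:Z) w).
Proof.
move=> la ca; have [r0 _|] := ltP r 0.
  rewrite !XZ_neg // scaler0 sum_nat0 // => n /andP[n0 _].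
  by rewrite XZ_neg ?(lin0 (la _)) ?scaler0 //; lia.
case: r => [r _ rN|//]; rewrite [XZ a r w]/XZ lez_nat leq0n /=.
rewrite (eq_big_nat _ _ (F2 := fun n => if (n <= r)%N then n%:R *: a n (series_exp a (r - n)%N w) else 0)); last first.
  by move=> n _; rewrite XZ_sub; case: ifP; rewrite ?(lin0 (la _)) ?scaler0.
rewrite (sum_XZ_nat (fun n s => n%:R *: a n (series_exp a s w))); last by lia.
rewrite /series_exp big_ord_recl /= scalerDr scaler_sumr.
rewrite [X in X + _](_ : _ = 0) ?add0r; last first.
  by case: r {rN} => [|r]; rewrite ?scale0r ?scaler0.
rewrite (eq_bigr (fun k : 'I_r => \sum_(1 <= n < r.+1) n%:R *: a n ((k`!%:R)^-1 *: series_pow a k (r - n)%N w))); last first.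
  move=> k _; rewrite scalerA mulrC -scalerA (series_pow_euler _ _ _ la ca) scaler_sumr.
  apply: eq_bigr => n _; rewrite (linZ (la n)) !scalerA; congr (_ *: _).
  rewrite /bump /= add1n factS natrM.
  by field; rewrite factr_neq0 nat1r natS_neq0.
rewrite exchange_big; apply: eq_big_nat => n /andP[n0 nr] /=.
rewrite -scaler_sumr -(lin_sum (la n)) -/(series_exp a (r - n)%N w).
rewrite (@series_exp_widen _ _ r) ?big_mkord //; lia.
Qed.

Lemma XZ_unique a w (Z : int -> W) : (forall n, linear (a n)) -> commuting a ->
  (forall r, r < 0 -> Z r = 0) -> Z 0 = w ->
  (forall r N, 0 < r -> r < N%:Z ->
    r%:~R *: Z r = \sum_(1 <= n < N) n%:R *: a n (Z (r - n%:Z))) ->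
  forall r, Z r = XZ a r w.
Proof.
move=> la ca Zneg Z0 Zrec r; have [r0|] := ltP r 0; first by rewrite Zneg ?XZ_neg.
case: r => [r _|//]; elim/ltn_ind: r => -[|r] IH; first by rewrite Z0 XZ0.
have rK : r.+1%:Z%:~R != 0 :> K by rewrite intr_eq0.
apply: (scalerI rK); rewrite (Zrec _ r.+2) //; last by lia.
rewrite (@XZ_rec _ _ _ r.+2) //; last by lia.
apply: eq_big_nat => n /andP[n0 nr]; congr (_ *: a n _).
by rewrite -[r.+1%:Z - n%:Z]gez0_abs ?IH //; lia.
Qed.

(** The product of the exponentials satisfies the recursion of the sum, as r = i + (r - i) is the
    Leibniz rule; uniqueness concludes. *)
Lemma XZ_add a b r w N : (forall n, linear (a n)) -> (forall n, linear (b n)) ->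
  commuting a -> commuting b -> (forall m n z, a m (b n z) = b n (a m z)) ->
  r < N%:Z ->
  XZ (fun n z => a n z + b n z) r w = \sum_(0 <= i < N) XZ a i%:Z (XZ b (r - i%:Z) w).
Proof.
move=> la lb ca cb cab rN.
pose Z (r : int) := \sum_(i \in [set: nat]) XZ a i%:Z (XZ b (r - i%:Z) w).
have ZE s M : s < M%:Z -> Z s = \sum_(0 <= i < M) XZ a i%:Z (XZ b (s - i%:Z) w).
  move=> sM; apply: nsumE => i Mi; rewrite [X in XZ a _ X]XZ_neg; last lia.
  exact: (lin0 (XZ_linear _ la)).
rewrite -ZE //; apply/esym; move: r {rN}; apply: XZ_unique => //.
- by move=> n c x y /=; rewrite la lb scalerDr addrACA.
- move=> m n z /=; rewrite !(linD (la _)) !(linD (lb _)) ca cb !cab.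
  by rewrite !addrA; congr (_ + _); rewrite -!addrA; congr (_ + _); rewrite addrC.
- move=> r r0; rewrite (ZE _ 0%N) ?big_geq //.
- by rewrite (ZE _ 1%N) // big_nat1 subr0 XZ0 XZ0.
move=> r M r0 rM; have bX n s z : b n (XZ a s z) = XZ a s (b n z).
  by apply: XZ_commute => // m z' _; rewrite cab.
rewrite (ZE r M) // scaler_sumr.
rewrite (eq_bigr (fun i => (\sum_(1 <= n < M) n%:R *: a n (XZ a (i%:Z - n%:Z) (XZ b (r - i%:Z) w)))
   + \sum_(1 <= n < M) n%:R *: b n (XZ a i%:Z (XZ b (r - n%:Z - i%:Z) w)))); last first.
  move=> i _.
  have [Mi|iM] := leqP M i.
    have E0 s n : XZ a s (XZ b (r - i%:Z - n%:Z) w) = 0.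
      by rewrite [X in XZ a _ X]XZ_neg ?(lin0 (XZ_linear _ la)) //; lia.
    have E1 s : XZ a s (XZ b (r - i%:Z) w) = 0.
      by rewrite [X in XZ a _ X]XZ_neg ?(lin0 (XZ_linear _ la)) //; lia.
    rewrite E1 scaler0 !big1 ?addr0 // => n _; last by rewrite E1 (lin0 (la _)) scaler0.
    by rewrite addrAC E0 (lin0 (lb _)) scaler0.
  have iM' : i%:Z < M%:Z by lia.
  have riM : r - i%:Z < M%:Z by lia.
  rewrite -(XZ_rec _ la ca iM').
  rewrite (eq_bigr (fun n => XZ a i (n%:R *: b n (XZ b (r - i%:Z - n%:Z) w)))); last first.
    by move=> n _; rewrite bX (linZ (XZ_linear _ la)) addrAC.
  rewrite -(lin_sum (XZ_linear _ la)) -(XZ_rec _ lb cb riM).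
  by rewrite (linZ (XZ_linear _ la)) -scalerDl -intrD; congr (_%:~R *: _); lia.
rewrite big_split /= exchange_big /= [X in _ + X]exchange_big -big_split /=.
apply: eq_big_nat => n /andP[n0 nM]; rewrite -!scaler_sumr -scalerDr; congr (_ *: _).
rewrite -(lin_sum (la n)) -(lin_sum (lb n)) -ZE; last lia.
congr (a n _ + _); rewrite (ZE _ (M - n)%N); last lia.
rewrite (big_cat_nat (n := n)) //=; last lia.
rewrite sum_nat0 ?add0r => [|i /andP[_ ni]]; last by rewrite XZ_neg //; lia.
rewrite [LHS](big_addn 0 M n); apply: eq_bigr => i _.
by congr (XZ a _ (XZ b _ _)); lia.
Qed.

End SeriesExp.

(** * Exponentials of locally nilpotent operators *)

Section ExpFinite.
Context {K : numFieldType} {W : lmodType K}.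
Implicit Types (a : nat -> W -> W).

Lemma XZ_eq0 a r w N : (forall n, linear (a n)) -> commuting a -> 0 < r ->
  r < N%:Z -> (forall n, (0 < n)%N -> (n < N)%N -> a n (XZ a (r - n%:Z) w) = 0) ->
  XZ a r w = 0.
Proof.
move=> la ca r0 rN a0; have rK : r%:~R != 0 :> K by rewrite intr_eq0; lia.
apply: (scalerI rK); rewrite scaler0 (XZ_rec _ la ca rN) sum_nat0 // => n /andP[? ?].
by rewrite a0 ?scaler0.
Qed.

Definition only N a n z : W := if n == N then a n z else 0.

Lemma only_linear N a : (forall n, linear (a n)) -> forall n, linear (only N a n).
Proof.
by move=> la n c x y; rewrite /only; case: eqP => _; rewrite ?la // scaler0 addr0.
Qed.

Lemma only_commuting N a : (forall n, linear (a n)) -> commuting a ->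
  commuting (only N a).
Proof.
move=> la ca m n z; rewrite /only; do 2!case: eqP => ? //; rewrite ?(lin0 (la _)) //.
Qed.

(** The recursion has the single term n = N, which trades w for a_N w and thereby lowers M by
    one. *)
Lemma only_nilpotent N M a w (s : int) : (0 < N)%N -> (forall n, linear (a n)) ->
  commuting a -> iter M (a N) w = 0 -> (N * M)%N%:Z <= s -> XZ (only N a) s w = 0.
Proof.
move=> N0 la ca; elim: M w s => [|M IHM] w s /=.
  by move=> -> _; rewrite (lin0 (XZ_linear _ (only_linear _ la))).
rewrite -iterS iterSr => /IHM IH sM.
apply: (@XZ_eq0 _ _ _ `|s|%N.+1); [exact: only_linear|exact: only_commuting|lia|lia|].
move=> n n0 ns; rewrite {1}/only; case: eqP => // ->.
rewrite (@XZ_commute _ _ _ (a N)) ?IH //; first lia.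
  exact: only_linear.
by move=> m z m0; rewrite /only; case: eqP => _; [rewrite ca | rewrite (lin0 (la _))].
Qed.

Definition below N a n z : W := if (n < N)%N then a n z else 0.

Lemma below_linear N a : (forall n, linear (a n)) -> forall n, linear (below N a n).
Proof.
by move=> la n c x y; rewrite /below; case: ifP => _; rewrite ?la // scaler0 addr0.
Qed.

Lemma below_commuting N a : (forall n, linear (a n)) -> commuting a ->
  commuting (below N a).
Proof.
move=> la ca m n z; rewrite /below; do 2!case: ifP => ? //; rewrite ?(lin0 (la _)) //.
Qed.

(** One mode is added at a time: exp(a_N z^N) w has finitely many coefficients, and on each of them
    the exponential of the earlier modes is finite. *)
Lemma below_finite N a : (forall n, linear (a n)) -> commuting a ->
  (forall n w, (0 < n)%N -> exists M, iter M (a n) w = 0) ->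
  forall w, exists Q : nat, forall q : int, Q%:Z <= q -> XZ (below N a) q w = 0.
Proof.
move=> la ca na; elim: N => [|N IHN] w.
  exists 1%N => q q1; apply: (@XZ_eq0 _ _ _ `|q|%N.+1); try lia.
  - exact: below_linear.
  - exact: below_commuting.
  - by [].
(* The series start at n = 1, so the index 0 contributes no mode. *)
have [->|N0] := posnP N.
  exists 1%N => q q1; apply: (@XZ_eq0 _ _ _ `|q|%N.+1); try lia.
  - exact: below_linear.
  - exact: below_commuting.
  - by move=> n n0 _; rewrite {1}/below; case: ifP => //; lia.
have [M aM] := na N w N0.
have [Q QP] : exists Q : nat, forall s, (s < N * M)%N -> forall q : int, Q%:Z <= q ->
    XZ (below N a) q (XZ (only N a) s%:Z w) = 0.
  elim: (N * M)%N => [|S [Q IH]]; first by exists 0%N.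
  have [Q' Q'P] := IHN (XZ (only N a) S%:Z w).
  exists (Q + Q')%N => s; rewrite ltnS leq_eqVlt => /predU1P[->|sS] q qQ.
    by apply: Q'P; lia.
  by apply: IH => //; lia.
exists (Q + N * M)%N => q qQ.
rewrite (@eq_XZ _ _ _ (fun n z => below N a n z + only N a n z)); last first.
  move=> n z _; rewrite /below /only ltnS leq_eqVlt.
  by case: eqP => [->|_]; rewrite ?ltnn ?add0r //= addr0.
rewrite (@XZ_add _ _ _ _ _ _ `|q|%N.+1); try lia; first last.
- move=> m n z; rewrite /below /only; case: ifP; case: eqP => // _ _;
    rewrite ?(lin0 (la _)) //.
- exact: only_commuting.
- exact: below_commuting.
- exact: only_linear.
- exact: below_linear.
apply: sum_nat0 => i /andP[_ iq].
have [NMi|iNM] := leP (N * M)%N%:Z (q - i%:Z).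
  by rewrite (only_nilpotent N0 la ca aM) // (lin0 (XZ_linear _ (below_linear _ la))).
rewrite -[q - i%:Z]gez0_abs ?QP //; lia.
Qed.

(** The modes from N on kill w, so their exponential fixes w and only finitely many modes remain. *)
Lemma XZ_finite a w N : (forall n, linear (a n)) -> commuting a ->
  (forall n w, (0 < n)%N -> exists M, iter M (a n) w = 0) ->
  (forall n, (N <= n)%N -> a n w = 0) ->
  exists Q : nat, forall q : int, Q%:Z <= q -> XZ a q w = 0.
Proof.
move=> la ca na aN; have [Q QP] := below_finite N la ca na w.
exists Q => q qQ; rewrite -[RHS](QP q qQ).
pose above n z : W := if (n < N)%N then 0 else a n z.
have lab n : linear (above n).
  by move=> c x y; rewrite /above; case: ifP => _; rewrite ?la // scaler0 addr0.
have cab : commuting above.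
  by move=> m n z; rewrite /above; do 2!case: ifP => ? //; rewrite ?(lin0 (la _)).
have lbe := below_linear N la.
rewrite (@eq_XZ _ _ _ (fun n z => below N a n z + above n z)); last first.
  by move=> n z _; rewrite /below /above; case: ifP; rewrite ?addr0 ?add0r.
rewrite (@XZ_add _ _ _ _ _ _ `|q|%N.+1) //; try lia; first last.
- by move=> m n z; rewrite /below /above; do 2!case: ifP => ? //; rewrite ?(lin0 (la _)).
- exact: below_commuting.
have ab0 s : 0 < s -> XZ above s w = 0.
  move=> s0; apply: (@XZ_eq0 _ _ _ `|s|%N.+1) => // [|n n0 _]; first lia.
  rewrite (@XZ_commute _ _ _ (above n)) //.
  by rewrite {2}/above; case: ltnP => [_|/aN ->]; rewrite (lin0 (XZ_linear _ lab)).
have [q0|q0] := ltP q 0.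
  rewrite [RHS]XZ_neg // sum_nat0 // => i _.
  by rewrite [XZ above _ _]XZ_neg ?(lin0 (XZ_linear _ lbe)) //; lia.
rewrite big_nat_recr //= gez0_abs // subrr XZ0 sum_nat0 ?add0r // => i /andP[_ iq].
by rewrite ab0 ?(lin0 (XZ_linear _ lbe)) //; lia.
Qed.

End ExpFinite.

Lemma dsumZE (K : fieldType) (I : choiceType) (V : lmodType K) (c : K)
  (x : dsum I V) i : (c *: x)@_i = c *: x@_i.
Proof. exact: dsum_scaleE. Qed.

(** * The series E^+ and E^- and their commutation *)

Section HeisenbergExp.
Context {K : numFieldType} {h : lmodType K} (form : h -> h -> K).
Context (formC : forall x y, form x y = form y x).
Context (formL : forall c x y z, form (c *: x + y) z = c * form x z + form y z).

Lemma form0l z : form 0 z = 0.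
Proof. by have := formL (-1) 0 0 z; rewrite scaler0 addr0 mulN1r addNr. Qed.

Lemma form0r z : form z 0 = 0. Proof. by rewrite formC form0l. Qed.

Lemma formD x y z : form (x + y) z = form x z + form y z.
Proof. by have := formL 1 x y z; rewrite scale1r mul1r. Qed.

Lemma formDr x y z : form z (x + y) = form z x + form z y.
Proof. by rewrite formC formD !(formC _ z). Qed.

Lemma formN x y : form (- x) y = - form x y.
Proof. by have := formL (-1) x 0 y; rewrite scaleN1r addr0 form0l addr0 mulN1r. Qed.

Lemma heis_bracketE (x : heis h) v n :
  heis_bracket form x (mode v n) = ((- n)%:~R * form x.1@_(- n) v) *: central.
Proof.
set c := (X in X *: _); rewrite -[RHS]/(c *: 0 : dsum int h, c * 1) scaler0 mulr1.
congr pair; rewrite /c {c}.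
have [nx|nx] := boolP (- n \in msupp x.1).
  rewrite (big_fsetD1 _ nx) /= opprK mcoeffUU big1_fset ?addr0 // => m.
  rewrite !inE => /andP[mn _] _; rewrite mcoeffU; case: eqP => [E|_].
    by move: mn; rewrite E opprK eqxx.
  by rewrite mulr0n form0r mulr0.
rewrite big1_fset => [|m mx _]; first by rewrite mcoeff_outdom // form0l mulr0.
rewrite mcoeffU; case: eqP => [E|_]; last by rewrite mulr0n form0r mulr0.
by move: nx; rewrite E opprK mx.
Qed.

Lemma mode_linear n : linear (fun u : h => mode u n).
Proof.
move=> c u v; rewrite -[RHS]/(c *: (mode u n).1 + (mode v n).1, c * 0 + 0).
rewrite mulr0 addr0; congr pair; apply/malgP => k.
by rewrite mcoeffD dsumZE !mcoeffU mulrnDl scalerMnr.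
Qed.

Context {U : lmodType K} (rho : heis h -> U -> U).
Context (hm : is_heis_module form rho) (hl : has_level rho 1).

Lemma rho_lin x : linear (rho x). Proof. by case: hm. Qed.

Lemma rho_mode_lin n w : linear (fun u => rho (mode u n) w).
Proof.
have [_ lr _] := hm => c u v; rewrite (mode_linear n); exact: lr.
Qed.

Lemma rho_comm x v n w : rho x (rho (mode v n) w) =
  rho (mode v n) (rho x w) + ((- n)%:~R * form x.1@_(- n) v) *: w.
Proof.
have [_ lr br] := hm; have := br x (mode v n) w; rewrite heis_bracketE.
rewrite (linZ (lr w)) hl scale1r => /eqP.
by rewrite eq_sym subr_eq addrC => /eqP.
Qed.

Lemma mode_comm u v m n w : rho (mode u m) (rho (mode v n) w) =
  rho (mode v n) (rho (mode u m) w)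
  + (if m + n == 0 then m%:~R * form u v else 0) *: w.
Proof.
rewrite rho_comm /= mcoeffU; congr (_ + _ *: _).
have [->|mn] := eqVneq m (- n); first by rewrite addNr eqxx mulr1n.
by rewrite mulr0n form0l mulr0 -[X in _ + X]opprK subr_eq0 (negPf mn).
Qed.

Lemma mode_commN u v m n w : m + n != 0 ->
  rho (mode u m) (rho (mode v n) w) = rho (mode v n) (rho (mode u m) w).
Proof. by move=> mn; rewrite mode_comm (negPf mn) scale0r addr0. Qed.

(* The coefficients of [E^-(-a, x)] and of [E^+(-a, x)]. *)
Definition EMf (a : h) (n : nat) z := (n%:R)^-1 *: rho (mode a (- n%:Z)) z.
Definition EPf (a : h) (n : nat) z := - (n%:R)^-1 *: rho (mode a n%:Z) z.
Definition EM a r w := XZ (EMf a) r w.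
Definition EP a r w := XZ (EPf a) r w.

Lemma EMf_linear a n : linear (EMf a n).
Proof. by move=> c x y; rewrite /EMf rho_lin scalerDr !scalerA mulrC. Qed.

Lemma EPf_linear a n : linear (EPf a n).
Proof. by move=> c x y; rewrite /EPf rho_lin scalerDr !scalerA mulrC. Qed.

Lemma EM_linear a r : linear (EM a r).
Proof. exact: XZ_linear (EMf_linear a). Qed.

Lemma EP_linear a r : linear (EP a r).
Proof. exact: XZ_linear (EPf_linear a). Qed.

Lemma EM_neg a r w : r < 0 -> EM a r w = 0. Proof. exact: XZ_neg. Qed.
Lemma EP_neg a r w : r < 0 -> EP a r w = 0. Proof. exact: XZ_neg. Qed.
Lemma EM0 a w : EM a 0 w = w. Proof. exact: XZ0. Qed.
Lemma EP0 a w : EP a 0 w = w. Proof. exact: XZ0. Qed.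

Lemma EminusE a r w : Eminus rho (- a) r w = EM a r%:Z w.
Proof.
rewrite /EM /XZ lez_nat leq0n /=; apply: eq_bigr => k _; congr (_ *: _).
apply: eq_series_pow => n z n0; rewrite /EMf (linN (rho_mode_lin _ _)).
by rewrite invrN scaleNr scalerN opprK.
Qed.

Lemma EplusE a r w : Eplus rho (- a) r w = EP a r%:Z w.
Proof.
rewrite /EP /XZ lez_nat leq0n /=; apply: eq_bigr => k _; congr (_ *: _).
apply: eq_series_pow => n z n0; rewrite /EPf (linN (rho_mode_lin _ _)).
by rewrite scaleNr scalerN.
Qed.

Lemma mode_EMf u m a n z : (0 < n)%N -> rho (mode u m) (EMf a n z) =
  EMf a n (rho (mode u m) z) + (if m == n%:Z then form u a else 0) *: z.
Proof.
move=> n0; rewrite /EMf (linZ (rho_lin _)) mode_comm scalerDr scalerA.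
congr (_ + _ *: _); rewrite subr_eq0; case: eqP => [->|_]; last by rewrite mulr0.
by rewrite mulrA mulVf ?mul1r // pnatr_eq0 -lt0n.
Qed.

Lemma mode_EPf u m a n z : (0 < n)%N -> rho (mode u m) (EPf a n z) =
  EPf a n (rho (mode u m) z) + (if m == - n%:Z then form u a else 0) *: z.
Proof.
move=> n0; rewrite /EPf (linZ (rho_lin _)) mode_comm scalerDr scalerA.
congr (_ + _ *: _); rewrite -[X in _ + X]opprK subr_eq0; case: eqP => [->|_].
  by rewrite mulrNz mulrA mulrNN mulVf ?mul1r // pnatr_eq0 -lt0n.
by rewrite mulr0.
Qed.

Lemma sum_if_eq (V : zmodType) (F : nat -> V) N (m : int) : m < N%:Z ->
  \sum_(1 <= n < N) (if m == n%:Z then F n else 0)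
  = if 0 < m then F `|m|%N else 0.
Proof.
move=> mN; case: ltP => m0; last first.
  by rewrite sum_nat0 // => n n0; case: eqP => //; lia.
rewrite (bigD1_seq `|m|%N) ?iota_uniq //=; last by rewrite mem_index_iota; lia.
rewrite gez0_abs ?eqxx ?big1 ?addr0 //; last by lia.
by move=> n nm; case: eqP => // E; move: nm; rewrite E absz_nat eqxx.
Qed.

Lemma mode_EM u m a r w : rho (mode u m) (EM a r w) =
  EM a r (rho (mode u m) w) + (if 0 < m then form u a else 0) *: EM a (r - m) w.
Proof.
set N := (`|r| + `|m|).+1%N.
rewrite (@XZ_comm _ _ _ (rho (mode u m)) (fun n => if m == n%:Z then form u a else 0) _ _ N) //; first last.
- by rewrite /N; lia.
- by move=> n z n0; rewrite mode_EMf.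
- exact: rho_lin.
- exact: EMf_linear.
rewrite (eq_bigr (fun n => if m == n%:Z then form u a *: EM a (r - n%:Z) w else 0)).
  rewrite sum_if_eq; last by rewrite /N; lia.
  by case: ifP => m0; rewrite ?scale0r // gtz0_abs.
by move=> n _; case: eqP; rewrite ?scale0r.
Qed.

Lemma mode_EP u m a r w : rho (mode u m) (EP a r w) =
  EP a r (rho (mode u m) w) + (if m < 0 then form u a else 0) *: EP a (r + m) w.
Proof.
set N := (`|r| + `|m|).+1%N.
rewrite (@XZ_comm _ _ _ (rho (mode u m)) (fun n => if - m == n%:Z then form u a else 0) _ _ N) //; first last.
- by rewrite /N; lia.
- by move=> n z n0; rewrite mode_EPf // eqr_oppLR.
- exact: rho_lin.
- exact: EPf_linear.
rewrite (eq_bigr (fun n => if - m == n%:Z then form u a *: EP a (r - n%:Z) w else 0)).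
  rewrite sum_if_eq; last by rewrite /N; lia.
  by rewrite oppr_gt0; case: ifP => m0; rewrite ?scale0r //; congr (_ + _ *: EP _ _ _); lia.
by move=> n _; case: eqP; rewrite ?scale0r.
Qed.

Lemma EMf_comm a b m n z : EMf a m (EMf b n z) = EMf b n (EMf a m z).
Proof.
rewrite /EMf !(linZ (rho_lin _)) !scalerA mulrC; have [->|n0] := posnP n.
  by rewrite invr0 mul0r !scale0r.
congr (_ *: _); rewrite mode_commN //; lia.
Qed.

Lemma EPf_comm a b m n z : EPf a m (EPf b n z) = EPf b n (EPf a m z).
Proof.
rewrite /EPf !(linZ (rho_lin _)) !scalerA mulrC; have [->|n0] := posnP n.
  by rewrite invr0 oppr0 mul0r !scale0r.
congr (_ *: _); rewrite mode_commN //; lia.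
Qed.

Lemma EM_rec a r w N : r < N%:Z ->
  r%:~R *: EM a r w = \sum_(1 <= n < N) rho (mode a (- n%:Z)) (EM a (r - n%:Z) w).
Proof.
move=> rN; rewrite (XZ_rec _ (EMf_linear a) _ rN); last by move=> m n; apply: EMf_comm.
apply: eq_big_nat => n /andP[n0 _]; rewrite /EMf scalerA divff ?scale1r //.
by rewrite pnatr_eq0 -lt0n.
Qed.

Lemma EP_rec a r w N : r < N%:Z ->
  r%:~R *: EP a r w = - \sum_(1 <= n < N) rho (mode a n%:Z) (EP a (r - n%:Z) w).
Proof.
move=> rN; rewrite (XZ_rec _ (EPf_linear a) _ rN); last by move=> m n; apply: EPf_comm.
rewrite -sumrN; apply: eq_big_nat => n /andP[n0 _].
by rewrite /EPf scalerA mulrN divff ?scaleN1r // pnatr_eq0 -lt0n.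
Qed.

Lemma EM_comm a b r s w : EM a r (EM b s w) = EM b s (EM a r w).
Proof.
apply: XZ_commute; [exact: EMf_linear|exact: EM_linear|move=> n z _].
by apply/esym; apply: XZ_commute => [||m z' _];
  [exact: EMf_linear|exact: EMf_linear|exact: EMf_comm].
Qed.

Lemma EP_comm a b r s w : EP a r (EP b s w) = EP b s (EP a r w).
Proof.
apply: XZ_commute; [exact: EPf_linear|exact: EP_linear|move=> n z _].
by apply/esym; apply: XZ_commute => [||m z' _];
  [exact: EPf_linear|exact: EPf_linear|exact: EPf_comm].
Qed.

Lemma EM_add a b r w N : r < N%:Z ->
  EM (a + b) r w = \sum_(0 <= i < N) EM a i%:Z (EM b (r - i%:Z) w).
Proof.
move=> rN; rewrite -(XZ_add _ _ _ _ _ _ rN); try exact: EMf_linear.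
- by apply: eq_XZ => n z _; rewrite /EMf (linD (rho_mode_lin _ _)) scalerDr.
- by move=> m n; apply: EMf_comm.
- by move=> m n; apply: EMf_comm.
- by move=> m n; apply: EMf_comm.
Qed.

Lemma EP_add a b r w N : r < N%:Z ->
  EP (a + b) r w = \sum_(0 <= i < N) EP a i%:Z (EP b (r - i%:Z) w).
Proof.
move=> rN; rewrite -(XZ_add _ _ _ _ _ _ rN); try exact: EPf_linear.
- by apply: eq_XZ => n z _; rewrite /EPf (linD (rho_mode_lin _ _)) scalerDr.
- by move=> m n; apply: EPf_comm.
- by move=> m n; apply: EPf_comm.
- by move=> m n; apply: EPf_comm.
Qed.

(** These partial sums arise in [EP_EM], where every a(n) moved past E^- contributes a factor p. *)
Lemma sum_binz_alt (p : int) s : p%:~R * \sum_(0 <= i < s) ((-1) ^+ i * binz p i)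
  = - (s%:R * ((-1) ^+ s * binz p s)) :> K.
Proof.
elim: s => [|s IHs]; first by rewrite big_geq // mulr0 mul0r oppr0.
rewrite big_nat_recr //= mulrDr IHs [s.+1%:R * _]mulrCA binzS exprS intrB.
by ring.
Qed.

(* [E^+(-a, x1) E^-(-b, x2) = (1 - x2/x1)^<a,b> E^-(-b, x2) E^+(-a, x1)] *)
Lemma EP_EM a b (p : int) q r w N : form a b = p%:~R -> q < N%:Z ->
  EP a q (EM b r w) =
  \sum_(0 <= i < N) ((-1) ^+ i * binz p i) *: EM b (r - i%:Z) (EP a (q - i%:Z) w).
Proof.
move=> ab; have [q0 _|] := ltP q 0.
  rewrite EP_neg // sum_nat0 // => i _.
  by rewrite EP_neg ?(lin0 (EM_linear _ _)) ?scaler0 //; lia.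
case: q => [q _|//]; elim/ltn_ind: q N => q IH N qN.
pose G s := EM b (r - s%:Z) (EP a (q%:Z - s%:Z) w).
pose B i : K := (-1) ^+ i * binz p i.
have G0 s : (q < s)%N -> G s = 0.
  by move=> qs; rewrite /G EP_neg ?(lin0 (EM_linear _ _)) //; lia.
have [qE|q0] := eqVneq q 0%N.
  rewrite qE EP0 (@sum_nat_widen _ _ 1); [|lia|]; last first.
    by move=> i i1; rewrite -/(B i) -qE -/(G i) G0 ?scaler0 //; lia.
  by rewrite big_nat1 !subr0 EP0 binz0 mulr1 scale1r.
have qK : q%:Z%:~R != 0 :> K by rewrite intr_eq0; lia.
apply: (scalerI qK); rewrite (EP_rec _ _ qN).
(* The induction hypothesis treats E^+ at q - n. The mode a(n) then passes E^-(-b) and leaves p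
   times the same term with its index lowered by n. *)
rewrite (eq_big_nat _ _ (F2 := fun n =>
   (\sum_(0 <= i < N) B i *: EM b (r - i%:Z) (rho (mode a n%:Z) (EP a (q%:Z - i%:Z - n%:Z) w)))
   + \sum_(0 <= i < N) (p%:~R * B i) *: G (i + n)%N)); last first.
  move=> n /andP[n0 nN].
  transitivity (rho (mode a n%:Z) (\sum_(0 <= i < N) B i *: EM b (r - i%:Z) (EP a (q%:Z - n%:Z - i%:Z) w))).
    congr (rho _ _); have [nq|qn] := leqP n q.
      have -> : q%:Z - n%:Z = (q - n)%N%:Z by lia.
      by rewrite (IH _ _ N) //; lia.
    rewrite EP_neg; last lia.
    by rewrite sum_nat0 // => i _; rewrite EP_neg ?(lin0 (EM_linear _ _)) ?scaler0 //; lia.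
  rewrite (lin_sum (rho_lin _)) -big_split; apply: eq_bigr => i _ /=.
  rewrite (linZ (rho_lin _)) mode_EM ltz_nat n0 ab scalerDr scalerA [B i * _]mulrC.
  by rewrite addrAC /G PoszD !opprD !addrA.
rewrite big_split /= opprD; rewrite exchange_big /=.
rewrite (eq_bigr (fun i => - ((q%:Z - i%:Z)%:~R * B i) *: G i)); last first.
  move=> i _; rewrite -scaler_sumr -(lin_sum (EM_linear _ _)).
  rewrite -[\sum_(_ <= _ < _) _]opprK -EP_rec; last lia.
  by rewrite (linN (EM_linear _ _)) (linZ (EM_linear _ _)) scalerN scaleNr scalerA mulrC.
(* For i + n = s with n >= 1 the coefficients form the alternating partial sum over i < s. *)
have -> : \sum_(1 <= n < N) \sum_(0 <= i < N) (p%:~R * B i) *: G (i + n)%N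
   = \sum_(0 <= s < N) - (s%:R * B s) *: G s.
  transitivity (\sum_(0 <= i < N) \sum_(0 <= n < N)
      if n == 0%N then 0 else (p%:~R * B i) *: G (i + n)%N).
    rewrite exchange_big; apply: eq_bigr => i _ /=.
    rewrite [RHS]big_ltn /=; last lia.
    by rewrite add0r; apply: eq_big_nat => n; case: n.
  rewrite sum_diag => [|i n Nin]; last by case: eqP => // _; rewrite G0 ?scaler0 //; lia.
  apply: eq_bigr => s _; rewrite big_nat_recr //= subnn eqxx addr0.
  rewrite -sum_binz_alt mulr_sumr scaler_suml; apply: eq_big_nat => i /andP[_ si].
  by rewrite subnKC; [case: eqP => //; lia|lia].
rewrite -!sumrN -big_split scaler_sumr; apply: eq_bigr => s _ /=.
rewrite -!scaleNr -scalerDl scalerA /B /G; congr (_ *: _); rewrite intrB.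
by ring.
Qed.

Lemma EP_finite a w (hr : restricted rho) :
  (forall n : int, 1 <= n -> locally_nilpotent (rho (mode a n))) ->
  exists Q : nat, forall q : int, Q%:Z <= q -> EP a q w = 0.
Proof.
move=> nil; have [N Nw] := hr w.
apply: (@XZ_finite _ _ _ _ `|N|%N).
- exact: EPf_linear.
- by move=> m n; apply: EPf_comm.
- move=> n z n0; have [|M zM] := nil n%:Z _ z; first lia.
  exists M; have -> : iter M (EPf a n) z = (- n%:R^-1) ^+ M *: iter M (rho (mode a n%:Z)) z.
    elim: {zM} M => [|M /= ->]; first by rewrite expr0 scale1r.
    by rewrite /EPf (linZ (rho_lin _)) scalerA -exprS.
  by rewrite zM scaler0.
- by move=> n Nn; rewrite /EPf Nw ?scaler0 //; lia.
Qed.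

End HeisenbergExp.

(** * The Fock module M(1) *)

Section FockModule.
Context {K : numFieldType} {h : lmodType K} (form : h -> h -> K).
Context (formC : forall x y, form x y = form y x).
Context (formL : forall c x y z, form (c *: x + y) z = c * form x z + form y z).

Local Notation M := (M1 form).
Local Notation act := (@M1_act K h form).
Local Notation vac := (M1_vac form).

Lemma M1_module : is_heis_module form act.
Proof. exact: induced_lie_module. Qed.

Lemma M1_act_lin x : linear (act x).
Proof. by case: M1_module. Qed.

Lemma M1_act_vac x : heis_nonneg x -> act x vac = x.2 *: vac.
Proof. exact: induced_act_vec. Qed.

Lemma mode_nonneg (u : h) (n : int) : 0 <= n -> heis_nonneg (mode u n).
Proof.
move=> n0 k k0; rewrite /= mcoeffU; case: eqP => [E|//].
by move: k0; rewrite -E ltNge n0.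
Qed.

Lemma M1_mode_vac (u : h) (n : int) : 0 <= n -> act (mode u n) vac = 0.
Proof. by move=> n0; rewrite M1_act_vac ?scale0r //; apply: mode_nonneg. Qed.

Lemma central_bracket (x : heis h) : heis_bracket form x central = 0.
Proof.
rewrite /heis_bracket big1_fset // => m _ _.
by rewrite mcoeff0 (form0r formC formL) mulr0.
Qed.

Lemma M1_level : has_level act 1.
Proof.
move=> w; rewrite scale1r; move: w.
apply: (induced_ind (S := [set w : M | act central w = w])).
- split=> [|x y /= ex ey|c x /= ex].
  + exact: (lin0 (M1_act_lin _)).
  + by rewrite (linD (M1_act_lin _)) ex ey.
  + by rewrite (linZ (M1_act_lin _)) ex.
- by rewrite /= M1_act_vac ?scale1r // => n _; rewrite mcoeff0.
- move=> x v /= ev; have [_ lr br] := M1_module.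
  have := br x central v; rewrite central_bracket (lin0 (lr v)) ev.
  by move=> /esym/eqP; rewrite subr_eq0 => /eqP <-.
Qed.

Let comm := rho_comm formC formL M1_module M1_level.

Lemma M1_comm x v n w : act (mode v n) (act x w) =
  act x (act (mode v n) w) - ((- n)%:~R * form x.1@_(- n) v) *: w.
Proof. by rewrite comm addrK. Qed.

Lemma M1_restricted : restricted act.
Proof.
apply: (induced_ind (S := [set w : M | exists N : int, forall n, N <= n ->
  forall u, act (mode u n) w = 0])).
- split=> [|x y /= [Nx ex] [Ny ey]|c x /= [N ex]].
  + by exists 0 => n _ u; apply: (lin0 (M1_act_lin _)).
  + exists (`|Nx| + `|Ny|) => n nN u.
    by rewrite (linD (M1_act_lin _)) ex ?ey ?addr0 //; lia.
  + by exists N => n nN u; rewrite (linZ (M1_act_lin _)) ex ?scaler0.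
- by exists 0 => n n0 u; apply: M1_mode_vac.
- move=> x v /= [N vN].
  (* The support of x is finite, and the sum of the absolute values of its degrees bounds each of
     them. *)
  have [B xB] : exists B : int, forall n, B <= n -> x.1@_(- n) = 0.
    exists (\sum_(k <- msupp x.1) `|k| + 1) => n nB.
    apply: mcoeff_outdom; apply/negP => nx.
    have : `|n| <= \sum_(k <- msupp x.1) `|k|.
      rewrite (big_fsetD1 _ nx) /= normrN lerDl.
      by apply: sumr_ge0 => k _.
    by lia.
  exists (`|N| + `|B|) => n nN u; rewrite M1_comm vN ?xB; [|lia|lia].
  by rewrite (lin0 (M1_act_lin _)) (form0l formL) mulr0 scale0r subr0.
Qed.

Lemma M1_mode0 (u : h) v : act (mode u 0) v = 0.
Proof.
move: v; apply: (induced_ind (S := [set w : M | act (mode u 0) w = 0])).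
- split=> [|x y /= ex ey|c x /= ex].
  + exact: (lin0 (M1_act_lin _)).
  + by rewrite (linD (M1_act_lin _)) ex ey addr0.
  + by rewrite (linZ (M1_act_lin _)) ex scaler0.
- exact: M1_mode_vac.
- move=> x v /= ev; rewrite M1_comm ev (lin0 (M1_act_lin _)).
  by rewrite oppr0 mul0r scale0r subr0.
Qed.

Lemma iter_lin0 (W : lmodType K) (f : W -> W) k : linear f -> iter k f 0 = 0.
Proof. by move=> lf; elim: k => //= k ->; rewrite (lin0 lf). Qed.

Lemma iter_linear (W : lmodType K) (f : W -> W) k : linear f -> linear (iter k f).
Proof. by move=> lf; elim: k => [c x y|k IH c x y] //=; rewrite IH lf. Qed.

(** The commutator of u(n) with a generator is a scalar, so a power of u(n) passes the generator at
    the cost of one lower power. Each generator raises the order of nilpotency by at most one. *)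
Lemma M1_nilpotent (u : h) (n : int) : 1 <= n -> locally_nilpotent (act (mode u n)).
Proof.
move=> n1; have lf := M1_act_lin (mode u n).
have fvac : act (mode u n) vac = 0 by apply: M1_mode_vac; lia.
have fcomm x w := M1_comm x u n w.
move: (act (mode u n)) lf fvac fcomm => f lf fvac fcomm.
have f0 N N' w : (N <= N')%N -> iter N f w = 0 -> iter N' f w = 0.
  by move=> /subnK <-; rewrite iterD => ->; apply: iter_lin0.
apply: (induced_ind (S := [set w : M | exists N, iter N f w = 0])).
- split=> [|x y /= [Nx ex] [Ny ey]|c x /= [N ex]].
  + by exists 0%N.
  + exists (Nx + Ny)%N; rewrite (linD (iter_linear _ lf)).
    by rewrite (f0 _ _ _ (leq_addr _ _) ex) (f0 _ _ _ (leq_addl _ _) ey) addr0.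
  + by exists N; rewrite (linZ (iter_linear _ lf)) ex scaler0.
- by exists 1%N.
- move=> x v /= [N vN]; exists N.+1.
  pose d := (- n)%:~R * form x.1@_(- n) u.
  have E k : iter k.+1 f (act x v) = act x (iter k.+1 f v) - (k.+1%:R * d) *: iter k f v.
    elim: k => [|k IH]; first by rewrite mul1r /= fcomm.
    rewrite iterS IH (linB lf) (linZ lf) fcomm -!iterS -addrA -opprD -scalerDl.
    by rewrite -/d -[k.+2%:R]nat1r mulrDl mul1r.
  by rewrite E vN (f0 _ _ _ (leqnSn _) vN) (lin0 (M1_act_lin _)) scaler0 subr0.
Qed.

Lemma M1_condition (L : zmodClosed h) : condition_C form L act.
Proof.
split; [exact: M1_module|exact: M1_restricted|exact: M1_level|move=> a; split].
- apply/seteqP; split=> // w _ S _; apply.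
  by exists 0; rewrite /eigenvec /= M1_mode0 scale0r.
- move=> c w w0; rewrite /eigenvec /= M1_mode0 => /esym/eqP.
  by rewrite scaler_eq0 (negPf w0) orbF => /eqP ->; exists 0.
- by move=> n n1; apply: M1_nilpotent.
Qed.

End FockModule.

(** * Eigenprojections and the twisted fields *)

Section FiniteSupport.
Context {V W : zmodType}.

Definition supp (I : choiceType) (F : I -> W) : set I := [set i | F i != 0].

Lemma fsumTE (I : choiceType) (F : I -> W) (A : set I) : finite_set A ->
  supp F `<=` A -> \sum_(i \in [set: I]) F i = \sum_(i <- fset_set A) F i.
Proof.
move=> fA FA; apply: fsbigTE => i; rewrite in_fset_set // => /negP iA.
by apply/eqP/negPn/negP => Fi; apply: iA; apply/mem_set/FA.
Qed.

Lemma fsum_add (I : choiceType) (F G : I -> W) :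
  finite_set (supp F) -> finite_set (supp G) ->
  \sum_(i \in [set: I]) (F i + G i)
  = \sum_(i \in [set: I]) F i + \sum_(i \in [set: I]) G i.
Proof.
move=> fF fG; have fA : finite_set (supp F `|` supp G) by rewrite finite_setU.
rewrite (fsumTE (F := F) fA) => [|i]; last by left.
rewrite (fsumTE (F := G) fA) => [|i]; last by right.
rewrite (fsumTE (A := supp F `|` supp G)) ?big_split // => i; rewrite /supp /=.
by have [->|] := eqVneq (F i) 0; [rewrite add0r; right|left].
Qed.

Lemma finite_supp_int (F : int -> W) N :
  (forall k, N <= `|k| -> F k = 0) -> finite_set (supp F).
Proof.
move=> F0; pose s := [seq i%:Z | i <- iota 0 `|N|] ++ [seq - i%:Z | i <- iota 0 `|N|].
apply: (@sub_finite_set _ _ [set` s]); last exact: finite_seq.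
move=> k /= Fk; have kN : `|k| < N.
  by rewrite ltNge; apply/negP => /F0 E; rewrite /supp /= E eqxx in Fk.
rewrite /s mem_cat; apply/orP; have [k0|k0] := leP 0 k; [left|right].
  by apply/mapP; exists `|k|%N; rewrite ?mem_iota; lia.
by apply/mapP; exists `|k|%N; rewrite ?mem_iota; lia.
Qed.

Lemma finite_supp_nat (F : nat -> W) N :
  (forall k, (N <= k)%N -> F k = 0) -> finite_set (supp F).
Proof.
move=> F0; apply: (@sub_finite_set _ _ [set` iota 0 N]); last exact: finite_seq.
move=> k /= Fk; rewrite mem_iota /= ltnNge; apply/negP => /F0 E.
by rewrite /supp /= E eqxx in Fk.
Qed.

Lemma fsum_shift (F : int -> W) c :
  \sum_(k \in [set: int]) F (k + c) = \sum_(k \in [set: int]) F k.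
Proof.
rewrite [RHS](reindex_fsbigT (fun k => k + c)) //.
by exists (fun k => k - c) => k; rewrite ?addrK ?subrK.
Qed.

Lemma fsum_opp (F : int -> W) c :
  \sum_(k \in [set: int]) F (c - k) = \sum_(k \in [set: int]) F k.
Proof.
rewrite [RHS](reindex_fsbigT (fun k => c - k)) //.
by exists (fun k => c - k) => k; rewrite subKr.
Qed.

Lemma fsum_nat (F : int -> W) : (forall k, k < 0 -> F k = 0) ->
  \sum_(i \in [set: nat]) F i%:Z = \sum_(k \in [set: int]) F k.
Proof.
move=> F0; rewrite -(fsbig_image [set: nat] Posz F); last by move=> i j _ _ [].
apply: fsbig_widen => // k [_ /= nk]; apply: F0; case: k nk => // k [].
by exists k.
Qed.

Lemma fsum_intE (F : int -> W) N : (forall k, k < 0 -> F k = 0) ->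
  (forall k, N%:Z <= k -> F k = 0) ->
  \sum_(k \in [set: int]) F k = \sum_(0 <= i < N) F i%:Z.
Proof.
by move=> F0 FN; rewrite -fsum_nat // (nsumE (N := N)) // => i iN; apply: FN; lia.
Qed.

Lemma fsum1 (I : choiceType) (F : I -> W) i0 : (forall i, i != i0 -> F i = 0) ->
  \sum_(i \in [set: I]) F i = F i0.
Proof.
move=> F0; rewrite (fsumTE (A := [set i0])) ?fset_set1 ?big_seq_fset1 // => i /= Fi.
by apply/eqP/negPn/negP => /F0 E; rewrite /supp /= E eqxx in Fi.
Qed.

Lemma fsum0 (I : choiceType) (F : I -> W) : (forall i, F i = 0) ->
  \sum_(i \in [set: I]) F i = 0.
Proof. by move=> F0; apply: fsbig1 => i _. Qed.

End FiniteSupport.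

Lemma fsum_linear (K : fieldType) (V W : lmodType K) (I : choiceType)
    (F : I -> V -> W) : (forall i, linear (F i)) ->
  (forall v, finite_set (supp (F^~ v))) ->
  linear (fun v => \sum_(i \in [set: I]) F i v).
Proof.
move=> lF fF c x y; pose A := supp (F^~ x) `|` supp (F^~ y).
have fA : finite_set A by rewrite finite_setU.
rewrite (fsumTE (F := F^~ x) fA) => [|i]; last by left.
rewrite (fsumTE (F := F^~ y) fA) => [|i]; last by right.
rewrite (fsumTE (A := A)) // => [|i].
  by rewrite scaler_sumr -big_split; apply: eq_bigr => i _; rewrite lF.
rewrite /supp /A /= => Fi; have [Fx|] := eqVneq (F i x) 0; last by left.
by right; move: Fi; rewrite lF Fx scaler0 add0r.
Qed.

Section Eigenprojections.
Context {K : numFieldType} {W : lmodType K} (f : W -> W) (lf : linear f).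
Context (ss : semisimple_op f) (ie : integer_eigenvalues f).

Lemma eigen_ind (S : set W) : subspace S ->
  (forall (k : int) w, f w = k%:~R *: w -> S w) -> forall w, S w.
Proof.
move=> sS eS w; have : linspan [set w | exists c, eigenvec f c w] w by rewrite ss.
apply=> // z [c cz]; have [->|z0] := eqVneq z 0; first by case: sS.
by have [k E] := ie z0 cz; apply: (eS k); rewrite -E.
Qed.

(** The product of the operators f - c for c in s, which annihilates sums of eigenvectors whose
    eigenvalues occur in s. *)
Definition shifts (s : seq K) (z : W) := foldr (fun c z => f z - c *: z) z s.

Lemma shifts_linear s : linear (shifts s).
Proof.
elim: s => [|c s IH] a x y //=; rewrite IH lf scalerDr scalerBr !scalerA.
by rewrite [c * a]mulrC opprD addrACA.
Qed.

Lemma shifts_cat s s' z : shifts (s ++ s') z = shifts s (shifts s' z).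
Proof. by rewrite /shifts foldr_cat. Qed.

Lemma shifts_comm s z : shifts s (f z) = f (shifts s z).
Proof. by elim: s => //= c s ->; rewrite (linB lf) (linZ lf). Qed.

Lemma shifts_catC s s' z : shifts s (shifts s' z) = shifts s' (shifts s z).
Proof.
elim: s' z => //= c s' IH z; rewrite (linB (shifts_linear s)) (linZ (shifts_linear s)).
by rewrite shifts_comm !IH.
Qed.

Lemma shifts_eigen s k z : f z = k *: z -> shifts s z = (\prod_(c <- s) (k - c)) *: z.
Proof.
move=> fz; elim: s => [|c s IH]; first by rewrite big_nil scale1r.
by rewrite big_cons /= IH (linZ lf) fz !scalerA -scalerBl; congr (_ *: _); ring.
Qed.

(** Some product of operators f - c with c different from k kills the span of the other
    eigenvectors, but multiplies z by a nonzero scalar. *)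
Lemma eigen_independent k z : f z = k *: z ->
  linspan [set z | exists2 c, c != k & eigenvec f c z] z -> z = 0.
Proof.
move=> fz lz; have [s ks sz] : exists2 s : seq K, k \notin s & shifts s z = 0.
  apply: (lz [set z | exists2 s : seq K, k \notin s & shifts s z = 0]); last first.
    move=> x [c ck fx]; exists [:: c]; first by rewrite inE eq_sym.
    by rewrite /= fx subrr.
  split=> [|x y [s ks sx] [s' ks' sy]|c x [s ks sx]].
  - by exists [::].
  - exists (s ++ s'); first by rewrite mem_cat negb_or ks.
    rewrite (linD (shifts_linear _)) shifts_cat shifts_catC sx shifts_cat sy.
    by rewrite !(lin0 (shifts_linear _)) addr0.
  - by exists s => //; rewrite (linZ (shifts_linear _)) sx scaler0.
move: sz; rewrite (shifts_eigen _ fz) => /eqP; rewrite scaler_eq0 => /orP[|/eqP//].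
rewrite prodf_seq_eq0 => /hasP[c cs]; rewrite /= subr_eq0 => /eqP E.
by rewrite E cs in ks.
Qed.

Definition xpow_spec (k : int) (w u : W) := eigenvec f k%:~R u /\
  linspan [set z | exists2 c, c != k%:~R & eigenvec f c z] (w - u).

Lemma linspan_sub (A : set W) x : A x -> linspan A x.
Proof. by move=> Ax S _; apply. Qed.

Lemma xpow_ex k w : exists u, xpow_spec k w u.
Proof.
have [s0 sD sZ] := linspan_subspace [set z | exists2 c, c != k%:~R & eigenvec f c z].
apply: (eigen_ind (S := [set w | exists u, xpow_spec k w u])) w => [|l w fw] /=.
  split=> [|x y [u [eu lu]] [v [ev lv]]|c x [u [eu lu]]].
  - exists 0; split; rewrite ?subrr //; first by rewrite /eigenvec /= (lin0 lf) scaler0.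
  - exists (u + v); split; first by rewrite /eigenvec /= (linD lf) eu ev scalerDr.
    by rewrite opprD addrACA; apply: sD.
  - exists (c *: u); split; last by rewrite -scalerBr; apply: sZ.
    by rewrite /eigenvec /= (linZ lf) eu !scalerA mulrC.
have [E|lk] := eqVneq l k.
  by exists w; split; [rewrite -E|rewrite subrr].
exists 0; split; first by rewrite /eigenvec /= (lin0 lf) scaler0.
by rewrite subr0; apply: linspan_sub; exists l%:~R => //; rewrite eqr_int.
Qed.

Lemma xpowP k w : xpow_spec k w (xpow f k w).
Proof. by rewrite /xpow; apply: (xgetPex 0); apply: xpow_ex. Qed.

Lemma xpow_eigen k w : f (xpow f k w) = k%:~R *: xpow f k w.
Proof. by have [] := xpowP k w. Qed.

Lemma xpow_unique k w u : xpow_spec k w u -> xpow f k w = u.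
Proof.
move=> [eu lu]; have [ev lv] := xpowP k w; apply/eqP; rewrite -subr_eq0; apply/eqP.
apply: (@eigen_independent k%:~R).
  by rewrite (linB lf) ev eu scalerBr.
have [s0 sD sZ] := linspan_subspace [set z | exists2 c, c != k%:~R & eigenvec f c z].
have -> : xpow f k w - u = (w - u) - (w - xpow f k w).
  by rewrite opprB [RHS]addrC addrA subrK.
by apply: sD => //; rewrite -scaleN1r; apply: sZ.
Qed.

Lemma xpow_linear k : linear (xpow f k).
Proof.
have [s0 sD sZ] := linspan_subspace [set z | exists2 c, c != k%:~R & eigenvec f c z].
move=> c x y; apply: xpow_unique; have [ex lx] := xpowP k x; have [ey ly] := xpowP k y.
split; first by rewrite /eigenvec /= lf ex ey scalerDr !scalerA mulrC.
by rewrite opprD addrACA -scalerBr; apply: sD => //; apply: sZ.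
Qed.

Lemma xpow_eigenvec k l w : f w = l%:~R *: w -> xpow f k w = if k == l then w else 0.
Proof.
move=> fw; apply: xpow_unique; have [s0 _ _] := linspan_subspace
  [set z | exists2 c, c != k%:~R & eigenvec f c z].
case: eqVneq => [->|kl]; first by split=> //; rewrite subrr => S [].
split; first by rewrite /eigenvec /= (lin0 lf) scaler0.
by rewrite subr0; apply: linspan_sub; exists l%:~R => //; rewrite eqr_int eq_sym.
Qed.

Lemma xpow_comm (T : W -> W) k w : linear T -> (forall z, T (f z) = f (T z)) ->
  T (xpow f k w) = xpow f k (T w).
Proof.
move=> lT Tf; have [s0 sD sZ] := linspan_subspace
  [set z | exists2 c, c != k%:~R & eigenvec f c z].
apply/esym/xpow_unique; have [ew lw] := xpowP k w.
split; first by rewrite /eigenvec /= -Tf ew (linZ lT).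
rewrite -(linB lT); apply: (lw [set z | linspan _ (T z)]) => [|z [c ck fz]] /=.
  split=> /= [|x y|c x]; rewrite ?(lin0 lT) ?(linD lT) ?(linZ lT) //.
  - exact: sD.
  - exact: sZ.
by apply: linspan_sub; exists c => //; rewrite /eigenvec /= -Tf fz (linZ lT).
Qed.

End Eigenprojections.

(** The eigenprojections of f commute with g, so they send eigenvectors of g to simultaneous
    eigenvectors. *)
Lemma eigen_ind2 (K : numFieldType) (W : lmodType K) (f g : W -> W) (S : set W) :
  linear f -> linear g -> (forall z, f (g z) = g (f z)) ->
  semisimple_op f -> integer_eigenvalues f ->
  semisimple_op g -> integer_eigenvalues g -> subspace S ->
  (forall (k l : int) w, f w = k%:~R *: w -> g w = l%:~R *: w -> S w) ->
  forall w, S w.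
Proof.
move=> lf lg fg sf if_ sg ig sS eS; apply: (eigen_ind sf if_ sS) => k w fw.
have := xpow_eigenvec lf sf if_ k fw; rewrite eqxx => <-; move: w {fw}.
have [S0 SD SZ] := sS.
apply: (eigen_ind sg ig (S := [set w | S (xpow f k w)])) => [|l w gw] /=.
  split=> /= [|x y|c x]; have lx := xpow_linear lf sf if_ k.
  - by rewrite (lin0 lx).
  - by rewrite (linD lx); apply: SD.
  - by rewrite (linZ lx); apply: SZ.
apply: (eS k l); first exact: xpow_eigen.
by rewrite (xpow_comm lf sf if_ k w lg) // gw (linZ (xpow_linear lf sf if_ k)).
Qed.

Section DbarTheory.
Context {K : numFieldType} {h : lmodType K} (form : h -> h -> K).
Context (formC : forall x y, form x y = form y x).
Context (formL : forall c x y z, form (c *: x + y) z = c * form x z + form y z).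
Context (L : zmodClosed h) {U : lmodType K} (rho : heis h -> U -> U).
Context (UC : condition_C form L rho).
Implicit Types (a b : lattice L) (w : U).

Let hm : is_heis_module form rho. Proof. by case: UC. Qed.
Let hl : has_level rho 1. Proof. by case: UC. Qed.

Lemma C_restricted : restricted rho. Proof. by case: UC. Qed.

Lemma C_semisimple a : semisimple_op (rho (mode (val a) 0)).
Proof. by case: UC => _ _ _ /(_ a) []. Qed.

Lemma C_integer a : integer_eigenvalues (rho (mode (val a) 0)).
Proof. by case: UC => _ _ _ /(_ a) []. Qed.

Lemma C_EP_finite a w : exists Q : nat, forall q : int, Q%:Z <= q -> EP rho (val a) q w = 0.
Proof. by apply: EP_finite hm hl _ _ C_restricted _; case: UC => _ _ _ /(_ a) []. Qed.

Definition eigen a (mu : int) w := rho (mode (val a) 0) w = mu%:~R *: w.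

Lemma C_eigen_ind a (S : set U) : subspace S ->
  (forall mu w, eigen a mu w -> S w) -> forall w, S w.
Proof.
move=> sS eS; apply: (eigen_ind (C_semisimple a) (@C_integer a) sS) => mu w.
exact: eS.
Qed.

Lemma eigen_mode a mu u m w : eigen a mu w -> eigen a mu (rho (mode u m) w).
Proof.
move=> E; rewrite /eigen; have [->|m0] := eqVneq m 0.
  rewrite (mode_comm formC formL hm hl) addr0 eqxx mul0r scale0r addr0 E.
  exact: (linZ (rho_lin hm _)).
by rewrite (mode_commN formC formL hm hl) ?add0r // E (linZ (rho_lin hm _)).
Qed.

Lemma eigen_EP a mu u q w : eigen a mu w -> eigen a mu (EP rho u q w).
Proof.
move=> E; rewrite /eigen (mode_EP formC formL hm hl) ltxx scale0r addr0 E.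
exact: (linZ (EP_linear hm _ _)).
Qed.

Lemma eigen_EM a mu u q w : eigen a mu w -> eigen a mu (EM rho u q w).
Proof.
move=> E; rewrite /eigen (mode_EM formC formL hm hl) ltxx scale0r addr0 E.
exact: (linZ (EM_linear hm _ _)).
Qed.

Lemma Dbar_linear a j : linear (Dbar rho (val a) j).
Proof.
have lx k := xpow_linear (rho_lin hm _) (C_semisimple a) (@C_integer a) k.
apply: fsum_linear => [r c x y|w].
  rewrite !(EplusE hm) (EP_linear hm) scalerDr !(linD (lx _)) !(linZ (lx _)) scalerDr.
  by rewrite !scalerA; congr (_ *: _ + _); ring.
have [Q QP] := C_EP_finite a w; apply: (@finite_supp_nat _ _ Q) => r Qr.
by rewrite (EplusE hm) QP ?scaler0 ?(lin0 (lx _)) ?scaler0 //; lia.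
Qed.

(** Since a(0) commutes with E^+, the factor x^{a(0)} is x^mu on all coefficients of E^+ w. Only r =
    mu - j contributes, with the sign (-1)^(j+r) (-1)^r = (-1)^j. *)
Lemma Dbar_eigen a mu j w : eigen a mu w ->
  Dbar rho (val a) j w = (-1 : K) ^ j *: EP rho (val a) (mu - j) w.
Proof.
move=> E; have xE := xpow_eigenvec (rho_lin hm _) (C_semisimple a) (@C_integer a).
have term (r : nat) : (-1 : K) ^ (j + r%:Z) *: xpow (rho (mode (val a) 0)) (j + r%:Z)
    ((-1) ^+ r *: Eplus rho (- val a) r w)
  = if j + r%:Z == mu then (-1 : K) ^ j *: EP rho (val a) r%:Z w else 0.
  rewrite (EplusE hm) (xE _ mu); last first.
    rewrite (linZ (rho_lin hm _)) (eigen_EP _ _ E) !scalerA.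
    by congr (_ *: _); rewrite mulrC.
  case: eqP => _; rewrite ?scaler0 // scalerA expfzDr ?N1_neq0 // -exprnP -mulrA.
  by rewrite -expr2 sqrr_sign mulr1.
rewrite /Dbar (eq_fsbigr (fun r : nat => if j + r%:Z == mu then
    (-1 : K) ^ j *: EP rho (val a) r%:Z w else 0)) => [|r _]; last exact: term.
have [mj|jm] := ltP mu j.
  by rewrite EP_neg ?scaler0 ?fsum0 // => [r|]; [case: eqP => //; lia|lia].
rewrite (fsum1 (i0 := `|mu - j|%N)) => [|r rj]; last by case: eqP => //; lia.
by case: eqP => [_|]; [congr (_ *: EP _ _ _ _); lia|lia].
Qed.

Lemma Dbar_opp_eigen a mu k w : eigen a mu w ->
  Dbar_opp rho (val a) k w = EP rho (val a) (mu - k) w.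
Proof. by move=> E; rewrite /Dbar_opp (Dbar_eigen _ E) scalerA N1_sqr scale1r. Qed.

Lemma Dbar_opp_linear a k : linear (Dbar_opp rho (val a) k).
Proof. by move=> c x y; rewrite /Dbar_opp Dbar_linear scalerDr !scalerA mulrC. Qed.

Lemma Dbar_bound a w : exists N : int, forall j, N <= `|j| -> Dbar rho (val a) j w = 0.
Proof.
apply: (C_eigen_ind (a := a) (S := [set w | exists N : int, forall j, N <= `|j| ->
  Dbar rho (val a) j w = 0])) w => [|mu w E] /=.
  split=> [|x y [N xN] [N' yN]|c x [N xN]].
  - by exists 0 => j _; apply: (lin0 (Dbar_linear _ _)).
  - exists (`|N| + `|N'|) => j ?; rewrite (linD (Dbar_linear _ _)) xN ?yN ?addr0 //; lia.
  - by exists N => j ?; rewrite (linZ (Dbar_linear _ _)) xN ?scaler0.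
have [Q QP] := C_EP_finite a w; exists (`|mu| + Q%:Z + 1) => j jN.
rewrite (Dbar_eigen _ E); have [mj|jm] := ltP mu j.
  by rewrite EP_neg ?scaler0 //; lia.
by rewrite QP ?scaler0 //; lia.
Qed.

Lemma Dbar_finite a w : finite_set (supp (fun j => Dbar rho (val a) j w)).
Proof. by have [N NP] := Dbar_bound a w; apply: finite_supp_int NP. Qed.

Lemma Dbar_opp_finite a w : finite_set (supp (fun j => Dbar_opp rho (val a) j w)).
Proof.
have [N NP] := Dbar_bound a w; apply: (@finite_supp_int _ _ N) => k kN.
by rewrite /Dbar_opp NP ?scaler0.
Qed.

(* [(-1)^s EP b s v] is the coefficient of [x^-s] in Dbar(b, x) v, when
   [b(0) v = 0]. *)
Definition DM b (s : int) w : U := (-1 : K) ^ s *: EP rho (val b) s w.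

Lemma DM_linear b s : linear (DM b s).
Proof. by move=> c x y; rewrite /DM (EP_linear hm) scalerDr !scalerA mulrC. Qed.

Lemma DM_neg b s w : s < 0 -> DM b s w = 0.
Proof. by move=> s0; rewrite /DM EP_neg ?scaler0. Qed.

Lemma DM_finite b w : exists S : nat, forall s : int, S%:Z <= s -> DM b s w = 0.
Proof.
have [S SP] := C_EP_finite b w.
by exists S => s sS; rewrite /DM SP ?scaler0.
Qed.

Lemma Dbar_DM b s w : eigen b 0 w -> Dbar rho (val b) (0 - s) w = DM b s w.
Proof.
move=> E; rewrite (Dbar_eigen _ E) subKr /DM sub0r; congr (_ *: _).
by rewrite -{1}[-1]invrN1 exprz_inv opprK.
Qed.

End DbarTheory.

Lemma int_common (P : nat -> int -> Prop) :
  (forall i (N N' : int), N <= N' -> P i N -> P i N') ->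
  (forall i, exists N, P i N) -> forall I, exists N, forall i, (i < I)%N -> P i N.
Proof.
move=> mono ex; elim=> [|I [N IH]]; first by exists 0.
have [N' PN'] := ex I; exists (`|N| + `|N'|) => i.
rewrite ltnS leq_eqVlt => /predU1P[->|/IH PN]; first by apply: mono PN'; lia.
by apply: mono PN; lia.
Qed.

(** * The twisted fields as sums over exponents *)

Section TwistedSum.
Context {K : numFieldType} {h : lmodType K} (form : h -> h -> K).
Context (formC : forall x y, form x y = form y x).
Context (formL : forall c x y z, form (c *: x + y) z = c * form x z + form y z).
Context (L : zmodClosed h).
Context {U : lmodType K} (rho : heis h -> U -> U) (UC : condition_C form L rho).
Context {V : lmodType K} (act : heis h -> V -> V) (VC : condition_C form L act).
Context (YU : V -> int -> U -> U) (lY : linear_fields YU) (tY : truncated YU).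
Implicit Types (a b : lattice L) (w : U) (v : V) (n : int).
Implicit Types (g : int -> int -> int -> U) (S Q : nat) (N : int).

Let hm : is_heis_module form rho. Proof. by case: UC. Qed.
Let hl : has_level rho 1. Proof. by case: UC. Qed.

(* For [g s q k] the coefficient of [x^(-k-1)] of a family of fields, the
   coefficient of [x^(-n-1)] of [sum_(s, q) E^-(-a, x) g_(s, q)(x) x^(-s-q)]. *)
Definition ESum a g n : U := \sum_(s \in [set: int]) \sum_(q \in [set: int])
  \sum_(r \in [set: int]) EM rho (val a) r (g s q (n - s - q + r)).

Definition bounded_fam S Q N g := forall s q k,
  [|| s < 0, S%:Z <= s, q < 0, Q%:Z <= q | N <= k] -> g s q k = 0.

Lemma bounded_famW S Q N S' Q' N' g : (S <= S')%N -> (Q <= Q')%N -> N <= N' ->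
  bounded_fam S Q N g -> bounded_fam S' Q' N' g.
Proof. by move=> SS QQ NN bg s q k H; apply: bg; lia. Qed.

Lemma ESumE a g n S Q N R : bounded_fam S Q N g -> N + S%:Z + Q%:Z <= n + R%:Z ->
  ESum a g n = \sum_(0 <= s < S) \sum_(0 <= q < Q) \sum_(0 <= r < R)
    EM rho (val a) r%:Z (g s%:Z q%:Z (n - s%:Z - q%:Z + r%:Z)).
Proof.
move=> bg nR; have lM := lin0 (EM_linear hm _ _); rewrite /ESum (fsum_intE (N := S)); first last.
- by move=> s sS; apply: fsum0 => q; apply: fsum0 => r; rewrite bg ?lM // sS !orbT.
- by move=> s s0; apply: fsum0 => q; apply: fsum0 => r; rewrite bg ?lM // s0.
apply: eq_big_nat => s /andP[_ sS]; rewrite (fsum_intE (N := Q)); first last.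
- by move=> q qQ; apply: fsum0 => r; rewrite bg ?lM // qQ !orbT.
- by move=> q q0; apply: fsum0 => r; rewrite bg ?lM // q0 !orbT.
apply: eq_big_nat => q /andP[_ qQ]; rewrite (fsum_intE (N := R)) //.
- by move=> r r0; rewrite EM_neg.
- by move=> r rR; rewrite bg ?lM //; lia.
Qed.

Lemma ESum_add a g g' n S Q N S' Q' N' :
  bounded_fam S Q N g -> bounded_fam S' Q' N' g' ->
  ESum a (fun s q k => g s q k + g' s q k) n = ESum a g n + ESum a g' n.
Proof.
move=> bg bg'; pose N2 : int := `|N| + `|N'|; pose R := absz (N2 + (S + S')%N%:Z + (Q + Q')%N%:Z - n)%R.
have {}bg : bounded_fam (S + S') (Q + Q') N2 g by apply: bounded_famW bg; rewrite /N2; lia.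
have {}bg' : bounded_fam (S + S') (Q + Q') N2 g' by apply: bounded_famW bg'; rewrite /N2; lia.
have nR : N2 + (S + S')%N%:Z + (Q + Q')%N%:Z <= n + R%:Z by rewrite /R; lia.
rewrite (ESumE a bg nR) (ESumE a bg' nR) (ESumE (N := N2) a _ nR); last first.
  by move=> s q k H; rewrite bg ?bg' ?addr0.
do 3![rewrite -big_split; apply: eq_bigr => ? _].
by rewrite (linD (EM_linear hm _ _)).
Qed.

Lemma ESum_scale a c g n S Q N : bounded_fam S Q N g ->
  ESum a (fun s q k => c *: g s q k) n = c *: ESum a g n.
Proof.
move=> bg; pose R := absz (N + S%:Z + Q%:Z - n)%R.
have nR : N + S%:Z + Q%:Z <= n + R%:Z by rewrite /R; lia.
rewrite (ESumE a bg nR) (ESumE (N := N) a _ nR); last first.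
  by move=> s q k H; rewrite bg ?scaler0.
do 3![rewrite scaler_sumr; apply: eq_bigr => ? _].
by rewrite (linZ (EM_linear hm _ _)).
Qed.

Lemma eq_ESum a g g' n : (forall s q k, g s q k = g' s q k) -> ESum a g n = ESum a g' n.
Proof.
by move=> gg; apply: eq_fsbigr => s _; apply: eq_fsbigr => q _;
  apply: eq_fsbigr => r _; rewrite gg.
Qed.

Lemma ESum_shift_s a g n m : ESum a (fun s q k => g (s + m) q k) n = ESum a g (n + m).
Proof.
rewrite /ESum -[RHS](fsum_shift _ m); apply: eq_fsbigr => s _.
apply: eq_fsbigr => q _; apply: eq_fsbigr => r _; congr (EM _ _ _ (g _ _ _)).
lia.
Qed.

Lemma ESum_shift_q a g n m : ESum a (fun s q k => g s (q + m) k) n = ESum a g (n + m).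
Proof.
apply: eq_fsbigr => s _; rewrite -[RHS](fsum_shift _ m); apply: eq_fsbigr => q _.
apply: eq_fsbigr => r _; congr (EM _ _ _ (g _ _ _)).
lia.
Qed.

(** The mode u(m) commutes with E^-(-a, x) up to <u,a> x^m E^-(-a, x), a correction present for m >
    0 only. *)
Lemma ESum_mode a u m g n S Q N : bounded_fam S Q N g ->
  rho (mode u m) (ESum a g n) = ESum a (fun s q k => rho (mode u m) (g s q k)) n
    + (if 0 < m then form u (val a) else 0) *: ESum a g (n + m).
Proof.
move=> bg; have [m0|m0] := ltP 0 m; last first.
  pose R := absz (N + S%:Z + Q%:Z - n)%R.
  have nR : N + S%:Z + Q%:Z <= n + R%:Z by rewrite /R; lia.
  rewrite scale0r addr0 (ESumE a bg nR) (ESumE (N := N) a _ nR); last first.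
    by move=> s q k H; rewrite bg // (lin0 (rho_lin hm _)).
  do 3![rewrite (lin_sum (rho_lin hm _)); apply: eq_bigr => ? _].
  by rewrite (mode_EM formC formL hm hl) ltNge m0 scale0r addr0.
(* The corrections are indexed by r - m, so the sum on the left runs over [|m|] more terms; the
   first [|m|] corrections vanish. *)
pose R := absz (N + S%:Z + Q%:Z - n)%R.
have nR : N + S%:Z + Q%:Z <= n + (R + `|m|)%N%:Z by rewrite /R; lia.
have nR' : N + S%:Z + Q%:Z <= n + m + R%:Z by rewrite /R; lia.
rewrite (ESumE a bg nR) (ESumE (N := N) a _ nR); last first.
  by move=> s q k H; rewrite bg // (lin0 (rho_lin hm _)).
rewrite (ESumE a bg nR') (lin_sum (rho_lin hm _)) scaler_sumr -big_split.
apply: eq_bigr => s _; rewrite (lin_sum (rho_lin hm _)) scaler_sumr -big_split.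
apply: eq_bigr => q _; rewrite (lin_sum (rho_lin hm _)) scaler_sumr /=.
under eq_bigr do rewrite (mode_EM formC formL hm hl) m0.
rewrite big_split; congr (_ + _); rewrite (big_cat_nat (n := `|m|%N)) //=; last lia.
rewrite sum_nat0 ?add0r => [|r /andP[_ rm]]; last by rewrite EM_neg ?scaler0 //; lia.
rewrite [LHS](big_addn 0 (R + `|m|) `|m|) addnK; apply: eq_bigr => r _.
have -> : (r + `|m|)%N%:Z - m = r%:Z by lia.
by have -> : n - s%:Z - q%:Z + (r + `|m|)%N%:Z = n + m - s%:Z - q%:Z + r%:Z by lia.
Qed.

Definition YWfam a b v w (s q k : int) : U := YU (DM act b s v) k (EP rho (val a) q w).

Lemma YWfam_bounded a b v w : exists S Q N, bounded_fam S Q N (YWfam a b v w).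
Proof.
have [S SP] := DM_finite formC formL VC b v.
have [Q QP] := C_EP_finite formC formL UC a w.
have [||N NP] := @int_common (fun s N => forall q, (q < Q)%N ->
  forall n : int, N <= n -> YU (DM act b s%:Z v) n (EP rho (val a) q%:Z w) = 0) _ _ S.
- by move=> s N N' NN H q qQ n nN; apply: H => //; apply: le_trans nN.
- move=> s; have [||N NP] := @int_common (fun q N =>
    forall n : int, N <= n -> YU (DM act b s%:Z v) n (EP rho (val a) q%:Z w) = 0) _ _ Q.
  + by move=> q N N' NN H n nN; apply: H; apply: le_trans nN.
  + by move=> q; apply: tY.
  + by exists N.
exists S, Q, N => s q k; rewrite /YWfam.
have [s0 _|s0] := ltP s 0; first by rewrite DM_neg ?(lin0 (lY.2 _ _)).
have [sS _|sS] := leP S%:Z s; first by rewrite SP ?(lin0 (lY.2 _ _)).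
have [q0 _|q0] := ltP q 0; first by rewrite EP_neg ?(lin0 (lY.1 _ _)).
have [qQ _|qQ] := leP Q%:Z q; first by rewrite QP ?(lin0 (lY.1 _ _)).
move=> /= Nk; rewrite -[s]gez0_abs // -[q]gez0_abs // NP //; lia.
Qed.

End TwistedSum.

Section TwistedCoef.
Context {K : numFieldType} {h : lmodType K} (form : h -> h -> K).
Context (formC : forall x y, form x y = form y x).
Context (formL : forall c x y z, form (c *: x + y) z = c * form x z + form y z).
Context (L : zmodClosed h).
Context {U : lmodType K} (rho : heis h -> U -> U) (UC : condition_C form L rho).
Context (YU : M1 form -> int -> U -> U) (lY : linear_fields YU) (tY : truncated YU).
Implicit Types (a b : lattice L) (w : U) (v : M1 form) (n : int).

Local Notation act := (@M1_act K h form).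
Let MC : condition_C form L act := M1_condition formC formL L.
Let hm : is_heis_module form rho. Proof. by case: UC. Qed.
Let Mm : is_heis_module form act. Proof. by case: MC. Qed.

Lemma YW_coef_linear_w a b v n : linear (YW_coef rho YU a b v n).
Proof.
have lD k := Dbar_opp_linear formC formL UC a k; have lM := EM_linear hm (val a).
apply: fsum_linear => [j|w]; last first.
  apply: (@sub_finite_set _ _ _ _ (Dbar_finite formC formL MC b v)) => j; apply: contra_neq.
  move=> /= v0; apply: fsum0 => k; apply: fsum0 => r.
  by rewrite v0 (EminusE hm) (lin0 (lY.2 _ _)) (lin0 (lM _)).
apply: fsum_linear => [k|w]; last first.
  apply: (@sub_finite_set _ _ _ _ (Dbar_opp_finite formC formL UC a w)) => k; apply: contra_neq.
  move=> /= w0; apply: fsum0 => r.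
  by rewrite w0 (EminusE hm) (lin0 (lY.1 _ _)) (lin0 (lM _)).
apply: fsum_linear => [r c x y|w]; first by rewrite !(EminusE hm) lD (lY.1 _ _) lM.
have [S SP] := vanish_nat tY (Dbar act (val b) j v) (Dbar_opp rho (val a) k w)
  (n + pairing form a b + j + k).
apply: (@finite_supp_nat _ _ S) => r Sr.
by rewrite (SP r) // (EminusE hm) (lin0 (lM _)).
Qed.

Lemma YW_coef_linear_v a b n w : linear (fun v => YW_coef rho YU a b v n w).
Proof.
have lD k := Dbar_linear formC formL MC b k; have lM := EM_linear hm (val a).
apply: fsum_linear => [j|v]; last first.
  apply: (@sub_finite_set _ _ _ _ (Dbar_finite formC formL MC b v)) => j; apply: contra_neq.
  move=> /= v0; apply: fsum0 => k; apply: fsum0 => r.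
  by rewrite v0 (EminusE hm) (lin0 (lY.2 _ _)) (lin0 (lM _)).
apply: fsum_linear => [k|v]; last first.
  apply: (@sub_finite_set _ _ _ _ (Dbar_opp_finite formC formL UC a w)) => k; apply: contra_neq.
  move=> /= w0; apply: fsum0 => r.
  by rewrite w0 (EminusE hm) (lin0 (lY.1 _ _)) (lin0 (lM _)).
apply: fsum_linear => [r c x y|v]; first by rewrite !(EminusE hm) lD (lY.2 _ _) lM.
have [S SP] := vanish_nat tY (Dbar act (val b) j v) (Dbar_opp rho (val a) k w)
  (n + pairing form a b + j + k).
apply: (@finite_supp_nat _ _ S) => r Sr.
by rewrite (SP r) // (EminusE hm) (lin0 (lM _)).
Qed.

(** As b(0) vanishes on M(1) and a(0) is mu on w, the powers x^<a,b> and x^{a(0)} only shift n; the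
    exponents are j = - s and k = mu - q. *)
Lemma YW_coef_eigen a b mu v w n : eigen rho a mu w ->
  YW_coef rho YU a b v n w = ESum rho a (YWfam rho act YU a b v w) (n + pairing form a b + mu).
Proof.
move=> E; rewrite /YW_coef -(fsum_opp _ 0); apply: eq_fsbigr => s _.
rewrite -(fsum_opp _ mu); apply: eq_fsbigr => q _.
rewrite -fsum_nat; last by move=> k k0; rewrite EM_neg.
apply: eq_fsbigr => r _; rewrite (EminusE hm) /YWfam (Dbar_opp_eigen formC formL UC _ E).
have E0 : eigen act b 0 v by rewrite /eigen (M1_mode0 formC formL) scale0r.
rewrite (Dbar_DM formC formL MC _ E0) subKr.
by have -> : n + pairing form a b + (0 - s) + (mu - q) + r%:Z
  = n + pairing form a b + mu - s - q + r%:Z by lia.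
Qed.

Lemma YW_coef_trunc a b v w : exists N : int, forall n, N <= n ->
  YW_coef rho YU a b v n w = 0.
Proof.
apply: (C_eigen_ind UC (a := a) (S := [set w | exists N : int, forall n, N <= n ->
  YW_coef rho YU a b v n w = 0])) w => [|mu w E] /=.
  have lw n := YW_coef_linear_w a b v n.
  split=> [|x y [N xN] [N' yN]|c x [N xN]].
  - by exists 0 => j _; apply: (lin0 (lw _)).
  - exists (`|N| + `|N'|) => j ?; rewrite (linD (lw _)) xN ?yN ?addr0 //; lia.
  - by exists N => j ?; rewrite (linZ (lw _)) xN ?scaler0.
have [S [Q [N bN]]] := YWfam_bounded formC formL UC MC lY tY a b v w.
exists (N + S%:Z + Q%:Z - pairing form a b - mu) => n nN.
rewrite (YW_coef_eigen _ _ _ E) (ESumE UC a (R := 0) bN); last lia.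
by apply: sum_nat0 => s _; apply: sum_nat0 => q _; rewrite big_geq.
Qed.

End TwistedCoef.

(** * The Jacobi identity of Heisenberg fields *)

Section DeltaTriple.
Context {K : numFieldType} {W : lmodType K}.

Definition binzz (p k : int) : K := if 0 <= k then binz p `|k| else 0.

Lemma binzz_pascal p k : binzz (p + 1) k = binzz p k + binzz p (k - 1).
Proof.
rewrite /binzz; have [k0|k0] := leP 0 k; last first.
  by rewrite ifN ?addr0 // -ltNge; lia.
have [->|k1] := eqVneq k 0; first by rewrite !binz0 addr0.
rewrite ifT; last lia.
have -> : `|k|%N = (`|k - 1|%N).+1 by lia.
exact: binz_pascal.
Qed.

(* The coefficients of the identity
   [x0^-1 delta((x1-x2)/x0) - x0^-1 delta((x2-x1)/-x0) = x2^-1 delta((x1-x0)/x2)] *)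
Lemma delta_identity (l m : int) : (-1) ^ (m + l + 1) * binzz l (m + l + 1)
  - (-1) ^ (m + l + 1) * binzz l (- 1 - m) = binzz m (- 1 - l).
Proof.
pose D (l m : int) : K := (-1) ^ (m + l + 1) * binzz l (m + l + 1)
  - (-1) ^ (m + l + 1) * binzz l (- 1 - m) - binzz m (- 1 - l).
suff D0 : D l m = 0 by apply/eqP; rewrite -subr_eq0; apply/eqP.
(* All three terms are compatible with x0 = x1 - x2. This recursion carries the vanishing from l = 0
   to every l >= 0. *)
have DS k j : D (k + 1) j = D k (j + 1) - D k j.
  rewrite /D; have -> : j + (k + 1) + 1 = j + k + 1 + 1 by lia.
  have -> : j + 1 + k + 1 = j + k + 1 + 1 by lia.
  rewrite binzz_pascal (binzz_pascal k (- 1 - j)) (binzz_pascal j) addrK.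
  have -> : - 1 - (j + 1) = - 1 - j - 1 by lia.
  have -> : - 1 - (k + 1) = - 1 - k - 1 by lia.
  by rewrite expfzDr ?N1_neq0 // expr1z; ring.
have b0 i : binzz 0%:Z i = (i == 0)%:R.
  rewrite /binzz; case: leP => i0; last by case: eqP => //; lia.
  have [->|i1] := eqVneq i 0; first by rewrite binz0.
  by rewrite binz_nat_small //; lia.
have Dnat : forall (k : nat) j, D k%:Z j = 0.
  elim=> [|k IH] j; last by rewrite -addn1 PoszD DS !IH subrr.
  rewrite /D !b0; have -> : j + 0%:Z + 1 = j + 1 by lia.
  have -> : (- 1 - j == 0) = (j + 1 == 0) by lia.
  by rewrite subrr /binzz /= subrr.
have Dneg : forall (k : nat) j, D (- k%:Z) j = 0.
  elim=> [|k IH] j; first by rewrite oppr0 Dnat.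
  (* Going down, the recursion only says that D is constant in m, so one further value, at m = 0, is
     computed. *)
  have DE i : D (- k.+1%:Z) (i + 1) = D (- k.+1%:Z) i.
    have := DS (- k.+1%:Z) i; have -> : - k.+1%:Z + 1 = - k%:Z by lia.
    by rewrite IH => /esym/eqP; rewrite subr_eq0 => /eqP.
  elim/int_ind: j => [|i IHi|i IHi].
  - rewrite /D; have -> : - 1 - - k.+1%:Z = k%:Z by lia.
    have -> : 0 + - k.+1%:Z + 1 = - k%:Z by lia.
    have -> : binzz (- k.+1%:Z) (- 1 - 0) = 0 by [].
    rewrite b0 mulr0 subr0; case: k {IH DE} => [|k].
      by rewrite oppr0 expr0z mul1r /binzz /= binz0 subrr.
    by rewrite /binzz /= mulr0 subrr.
  - by rewrite (_ : i.+1%:Z = i%:Z + 1) ?DE //; lia.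
  - by rewrite -DE (_ : - i.+1%:Z + 1 = - i%:Z) //; lia.
case: l => l; first exact: Dnat.
exact: Dneg l.+1 m.
Qed.

Lemma bt_delta s p (y : int -> W) (x z c : int) :
  bt s p (fun x z => if x == c then y z else 0) x z =
  if 0 <= c - x then (s ^+ `|(c - x)%R|%N * binz p `|(c - x)%R|%N) *: y (z + p - (c - x)) else 0.
Proof.
rewrite /bt; have [cx|cx] := leP 0 (c - x); last first.
  by apply: fsum0 => i; case: eqP => [|_]; [lia|rewrite scaler0].
rewrite (fsum1 (i0 := absz (c - x)%R)) => [|i ic].
  by case: eqP => [_|]; [congr (_ *: y _); lia|lia].
by case: eqP => [|_]; [lia|rewrite scaler0].
Qed.

Lemma bt_delta_r s p (y : int -> W) (x z c : int) :
  bt s p (fun x z => if z == c then y x else 0) x z =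
  if 0 <= z + p - c then (s ^+ absz (z + p - c)%R * binz p (absz (z + p - c)%R)) *: y (x + (z + p - c)) else 0.
Proof.
rewrite /bt; have [cx|cx] := leP 0 (z + p - c); last first.
  by apply: fsum0 => i; case: eqP => [|_]; [lia|rewrite scaler0].
rewrite (fsum1 (i0 := absz (z + p - c)%R)) => [|i ic].
  by case: eqP => [_|]; [congr (_ *: y _); lia|lia].
by case: eqP => [|_]; [lia|rewrite scaler0].
Qed.

Lemma N1_opp (k : int) : (-1 : K) ^ (- k) = (-1) ^ k.
Proof. by rewrite -{1}[-1]invrN1 exprz_inv opprK. Qed.

(* The triple of the vacuum and of a field with modes [y]. *)
Definition tdelta (y : int -> W) := Trip
  (fun n m => if m == - 1 then y n else 0) (fun m n => if m == - 1 then y n else 0)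
  (fun l n => if l == - 1 then y n else 0).

Lemma tdelta_bnd y N : (forall n, N <= n -> y n = 0) -> tbnd `|N| (tdelta y).
Proof.
by move=> yN; split=> x z Nx /=; case: eqP => // E; [apply: yN; lia|lia|lia].
Qed.

Lemma signz_abs (k : int) : 0 <= k -> (-1 : K) ^+ `|k|%N = (-1) ^ k.
Proof. by move=> k0; rewrite exprnP gez0_abs. Qed.

(** Each transform of a delta has at most one nonzero term, and all of them are multiples of the
    same y (n + m + l + 1). *)
Lemma Phi_tdelta y l m n : Phi (tdelta y) l m n = 0.
Proof.
rewrite /Phi /= bt_delta_r !bt_delta.
pose Y := y (n + m + l + 1).
have -> : (if 0 <= m + l - - 1 then ((-1) ^+ absz (m + l - - 1)%R * binz l (absz (m + l - - 1)%R)) *: y (n + (m + l - - 1)) else 0) = ((-1) ^ (m + l + 1) * binzz l (m + l + 1)) *: Y.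
  rewrite /binzz opprK; case: ifP => m0; last by rewrite mulr0 scale0r.
  by rewrite signz_abs // /Y; congr (_ *: y _); lia.
have -> : (-1) ^ l *: (if 0 <= - 1 - m then ((-1) ^+ `|(- 1 - m)%R|%N * binz l `|(- 1 - m)%R|%N) *: y (n + l - (- 1 - m)) else 0) = ((-1) ^ (m + l + 1) * binzz l (- 1 - m)) *: Y.
  rewrite /binzz; case: ifP => m0; last by rewrite mulr0 scaler0 scale0r.
  rewrite signz_abs // /Y scalerA mulrA -expfzDr ?N1_neq0 //.
  have -> : l + (- 1 - m) = m + l + 1 + 2%:Z * (- m - 1) by lia.
  rewrite expfzDr ?N1_neq0 // -exprz_exp -exprnP sqrrN expr1n exp1rz mulr1.
  by congr (_ *: y _); lia.
have -> : (if 0 <= - 1 - l then (1 ^+ `|(- 1 - l)%R|%N * binz m `|(- 1 - l)%R|%N) *: y (n + m - (- 1 - l)) else 0) = binzz m (- 1 - l) *: Y.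
  rewrite /binzz; case: ifP => m0; last by rewrite scale0r.
  by rewrite expr1n mul1r /Y; congr (_ *: y _); lia.
by rewrite -!scalerBl delta_identity subrr scale0r.
Qed.

Lemma tbnd_common3 N1 N2 N3 (T1 T2 T3 : @trip K W) :
  tbnd N1 T1 -> tbnd N2 T2 -> tbnd N3 T3 ->
  exists N, tbnd N T1 /\ tbnd N T2 /\ tbnd N T3.
Proof.
move=> b1 b2 b3; exists (`|N1| + `|N2| + `|N3|); split; [|split].
- by apply: tbnd_le b1; lia.
- by apply: tbnd_le b2; lia.
- by apply: tbnd_le b3; lia.
Qed.

End DeltaTriple.

Section HeisenbergJacobi.
Context {K : numFieldType} {h : lmodType K} (form : h -> h -> K).
Context (formC : forall x y, form x y = form y x).
Context (formL : forall c x y z, form (c *: x + y) z = c * form x z + form y z).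
Context (L : zmodClosed h).
Context {U : lmodType K} (rho : heis h -> U -> U) (UC : condition_C form L rho).
Context {V : lmodType K} (act : heis h -> V -> V) (VC : condition_C form L act).
Context (YU : V -> int -> U -> U) (lY : linear_fields YU) (tY : truncated YU).
Implicit Types (a b : lattice L) (w : U) (v : V) (u : h).

Let hm : is_heis_module form rho. Proof. by case: UC. Qed.
Let hl : has_level rho 1. Proof. by case: UC. Qed.
Let Mm : is_heis_module form act. Proof. by case: VC. Qed.
Let Ml : has_level act 1. Proof. by case: VC. Qed.

(* The Jacobi identity of [u(-1)vac] and [v]. *)
Definition theis u v w := Trip (fun n m => rho (mode u m) (YU v n w))
  (fun m n => YU v n (rho (mode u m) w)) (fun l n => YU (act (mode u l) v) n w).

Context (Phi_theis : forall u v w l m n, Phi (theis u v w) l m n = 0).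

Lemma theis_bnd u v w : exists N, tbnd N (theis u v w).
Proof.
have [Nv vN] := tY v w; have [Nu uN] := C_restricted UC w.
have [Nu' uN'] := C_restricted VC v.
exists (`|Nv| + `|Nu| + `|Nu'|); split=> x y Nx /=.
- by rewrite vN ?(lin0 (rho_lin hm _)) //; lia.
- by rewrite uN ?(lin0 (lY.1 _ _)) //; lia.
- by rewrite uN' ?(lin0 (lY.2 _ _)) //; lia.
Qed.

(* [sum_(s, q) E^-(-a, x2) x2^(-s-q) T_(s, q)] *)
Definition tESum a (T : int -> int -> trip) := Trip
  (fun n m => ESum rho a (fun s q k => ta (T s q) k m) n)
  (fun m n => ESum rho a (fun s q k => tb (T s q) m k) n)
  (fun l n => ESum rho a (fun s q k => tc (T s q) l k) n).

(** Only in the first component is the bounded argument the exponent of x2, which the sum shifts;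
    the other two keep their bound. *)
Lemma tESum_bnd a (T : int -> int -> trip) (S Q : nat) (N : int) :
  (forall s q, tbnd N (T s q)) ->
  (forall m, bounded_fam S Q N (fun s q k => ta (T s q) k m)) ->
  tbnd (`|N| + S%:Z + Q%:Z) (tESum a T).
Proof.
move=> bT bA; have l0 r : EM rho (val a) r 0 = 0 by apply: lin0 (EM_linear hm _ r).
split=> x y Nx /=; first rewrite (ESumE UC a (R := 0) (bA y)).
- by apply: sum_nat0 => s _; apply: sum_nat0 => q _; rewrite big_geq.
- by lia.
- apply: fsum0 => s; apply: fsum0 => q; apply: fsum0 => r.
  by have [_ bb _] := bT s q; rewrite (bb _ _) ?l0 //; lia.
- apply: fsum0 => s; apply: fsum0 => q; apply: fsum0 => r.
  by have [_ _ bc] := bT s q; rewrite (bc _ _) ?l0 //; lia.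
Qed.

(** E^-(-a, x2) and the powers of x2 multiply the three sides alike. The sums over s and q are
    finite, and the one over r is reached as a limit of partial sums. *)
Lemma Phi_ESum a (T : int -> int -> trip) (S Q : nat) (N : int) l m n :
  (forall s q, tbnd N (T s q)) ->
  (forall m, bounded_fam S Q N (fun s q k => ta (T s q) k m)) ->
  (forall m, exists N', bounded_fam S Q N' (fun s q k => tb (T s q) m k)) ->
  (forall l, exists N', bounded_fam S Q N' (fun s q k => tc (T s q) l k)) ->
  (forall s q l m n, Phi (T s q) l m n = 0) ->
  Phi (tESum a T) l m n = 0.
Proof.
move=> bT bA bB bC jT; have lE r := EM_linear hm (val a) r.
pose F r s q := top (EM rho (val a) r%:Z) (tx2 (r%:Z - s%:Z - q%:Z) (T s%:Z q%:Z)).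
pose TI R := tsum S (fun s => tsum Q (fun q => tsum R (fun r => F r s q))).
pose N0 : int := `|N| + S%:Z + Q%:Z.
have bF r s q : (s < S)%N -> (q < Q)%N -> tbnd N0 (F r s q).
  move=> sS qQ; apply: tbnd_op => //; have [ba bb bc] := bT s%:Z q%:Z.
  by split=> x y Nx /=; [rewrite ba|rewrite bb|rewrite bc] => //; lia.
have bTI R : tbnd N0 (TI R).
  by apply: tbnd_sum => s sS; apply: tbnd_sum => q qQ; apply: tbnd_sum => r _; apply: bF.
have l0 r : EM rho (val a) r 0 = 0 by apply: lin0 (lE r).
have bS : tbnd N0 (tESum a T) by apply: tESum_bnd bA.
have [||x y|x y|x y|I0 I0P] := @Phi_lim _ _ N0 (tESum a T) TI l m n.
- exact: bS.
- exact: bTI.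
- exists (absz (N + S%:Z + Q%:Z - x)%R) => I I0I /=.
  rewrite (ESumE UC a (R := I) (bA y)); last lia.
  do 3![apply: eq_bigr => ? _]; congr (EM _ _ _ (ta _ _ _)); lia.
- have [N' bB'] := bB x; exists (absz (N' + S%:Z + Q%:Z - y)%R) => I I0I /=.
  rewrite (ESumE UC a (R := I) bB'); last lia.
  do 3![apply: eq_bigr => ? _]; congr (EM _ _ _ (tb _ _ _)); lia.
- have [N' bC'] := bC x; exists (absz (N' + S%:Z + Q%:Z - y)%R) => I I0I /=.
  rewrite (ESumE UC a (R := I) bC'); last lia.
  do 3![apply: eq_bigr => ? _]; congr (EM _ _ _ (tc _ _ _)); lia.
rewrite (I0P I0) // (Phi_sum (N := N0)) => [|s sS]; last first.
  by apply: tbnd_sum => q qQ; apply: tbnd_sum => r _; apply: bF.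
rewrite sum_nat0 // => s /andP[_ sS]; rewrite (Phi_sum (N := N0)) => [|q qQ]; last first.
  by apply: tbnd_sum => r _; apply: bF.
rewrite sum_nat0 // => q /andP[_ qQ]; rewrite (Phi_sum (N := N0)) => [|r _]; last first.
  exact: bF.
rewrite sum_nat0 // => r _; have bx := tbnd_x2 (r%:Z - s%:Z - q%:Z) (bT s%:Z q%:Z).
by rewrite (Phi_op _ _ _ bx) // Phi_x2 jT l0.
Qed.

Local Notation y a b v w n := (ESum rho a (YWfam rho act YU a b v w) n).

Lemma ESum_linear_v a b n w : linear (fun v => y a b v w n).
Proof.
move=> c v v'; have [S [Q [N bv]]] := YWfam_bounded formC formL UC VC lY tY a b v w.
have [S' [Q' [N' bv']]] := YWfam_bounded formC formL UC VC lY tY a b v' w.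
have bcv : bounded_fam S Q N (fun s q k => c *: YWfam rho act YU a b v w s q k).
  by move=> s q k H; rewrite (bv s q k H) scaler0.
rewrite -(ESum_scale UC a c n bv) -(ESum_add UC a n bcv bv').
by apply: eq_ESum => s q k; rewrite /YWfam (DM_linear VC) lY.2.
Qed.

Lemma ESum_linear_w a b n v : linear (fun w => y a b v w n).
Proof.
move=> c w w'; have [S [Q [N bw]]] := YWfam_bounded formC formL UC VC lY tY a b v w.
have [S' [Q' [N' bw']]] := YWfam_bounded formC formL UC VC lY tY a b v w'.
have bcw : bounded_fam S Q N (fun s q k => c *: YWfam rho act YU a b v w s q k).
  by move=> s q k H; rewrite (bw s q k H) scaler0.
rewrite -(ESum_scale UC a c n bw) -(ESum_add UC a n bcw bw').
by apply: eq_ESum => s q k; rewrite /YWfam (EP_linear hm) lY.1.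
Qed.

(* The modes of [u] and of [e^a (x) v] acting on [e^b (x) w]. *)
Definition tHeis u a b v w := Trip
  (fun n m => rho (mode u m) (y a b v w n)
    + (if m == 0 then form u (val a) + form u (val b) else 0) *: y a b v w n)
  (fun m n => y a b v (rho (mode u m) w + (if m == 0 then form u (val b) else 0) *: w) n)
  (fun l n => y a b (act (mode u l) v + (if l == 0 then form u (val a) else 0) *: v) w n).

Lemma bounded_fam_ex (S Q : nat) (g : int -> int -> int -> U) :
  (forall s q k, [|| s < 0, S%:Z <= s, q < 0 | Q%:Z <= q] -> g s q k = 0) ->
  (forall s q, exists N : int, forall k, N <= k -> g s q k = 0) ->
  exists N, bounded_fam S Q N g.
Proof.
move=> g0 ex; have [||N NP] := @int_common (fun s N => forall q, (q < Q)%N ->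
  forall n : int, N <= n -> g s%:Z q%:Z n = 0) _ _ S.
- by move=> s N N' NN H q qQ n nN; apply: H => //; apply: le_trans nN.
- move=> s; have [||N NP] := @int_common (fun q N =>
    forall n : int, N <= n -> g s%:Z q%:Z n = 0) _ _ Q.
  + by move=> q N N' NN H n nN; apply: H; apply: le_trans nN.
  + by move=> q; apply: ex.
  + by exists N.
exists N => s q k H.
have [H'|H'] := boolP [|| s < 0, S%:Z <= s, q < 0 | Q%:Z <= q]; first exact: g0.
have [s0 q0] : 0 <= s /\ 0 <= q by lia.
rewrite -[s]gez0_abs // -[q]gez0_abs // NP //; lia.
Qed.

Lemma bounded_fam_scale c (S Q : nat) N (g : int -> int -> int -> U) :
  bounded_fam S Q N g -> bounded_fam S Q N (fun s q k => c *: g s q k).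
Proof. by move=> bg s q k /bg ->; rewrite scaler0. Qed.

Lemma bounded_fam_shift_q (S Q : nat) N (m : int) (g : int -> int -> int -> U) : m <= 0 ->
  bounded_fam S Q N g -> bounded_fam S (Q + `|m|) N (fun s q k => g s (q + m) k).
Proof. by move=> m0 bg s q k H; apply: bg; lia. Qed.

Lemma bounded_fam_shift_s (S Q : nat) N (m : int) (g : int -> int -> int -> U) : m <= 0 ->
  bounded_fam S Q N g -> bounded_fam (S + `|m|) Q N (fun s q k => g (s + m) q k).
Proof. by move=> m0 bg s q k H; apply: bg; lia. Qed.

Lemma DM_mode u b s l v : DM act b s (act (mode u l) v) = act (mode u l) (DM act b s v)
  - ((-1) ^ l * (if l < 0 then form u (val b) else 0)) *: DM act b (s + l) v.
Proof.
rewrite /DM (linZ (rho_lin Mm _)) (mode_EP formC formL Mm Ml) scalerDr -addrA.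
rewrite !scalerA expfzDr ?N1_neq0 // -scalerBl.
have -> : (-1) ^ s * (if l < 0 then form u (\val b) else 0)
  - (-1) ^ l * (if l < 0 then form u (\val b) else 0) * ((-1) ^ s * (-1) ^ l) = 0.
  have := @N1_sqr K l; move: (if _ then _ else _) ((-1) ^ l) ((-1) ^ s) => c x z xx.
  by rewrite -[X in X - _]mulr1 -xx; ring.
by rewrite scale0r addr0.
Qed.

Lemma tHeis_bnd u a b v w : exists N, tbnd N (tHeis u a b v w).
Proof.
have yb v' w' : exists N, forall n, N <= n -> y a b v' w' n = 0.
  have [S [Q [N bg]]] := YWfam_bounded formC formL UC VC lY tY a b v' w'.
  exists (`|N| + S%:Z + Q%:Z) => k kN; rewrite (ESumE UC a (R := 0) bg); last lia.
  by apply: sum_nat0 => s _; apply: sum_nat0 => q _; rewrite big_geq.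
have [N yN] := yb v w; have [N1 uN1] := C_restricted UC w.
have [N2 uN2] := C_restricted VC v.
exists (`|N| + `|N1| + `|N2| + 1); split=> x z Nx /=.
- by rewrite yN ?(lin0 (rho_lin hm _)) ?scaler0 ?addr0 //; lia.
- rewrite uN1 ?ifF ?scale0r ?addr0; [|lia|lia].
  exact: (lin0 (ESum_linear_w _ _ _ _)).
- rewrite uN2 ?ifF ?scale0r ?addr0; [|lia|lia].
  exact: (lin0 (ESum_linear_v _ _ _ _)).
Qed.

(** Together with the zero modes, the commutators of u(m) with E^-(-a, x2) and with E^+(-a, x2) are
    the two expansions of <u,a>/(x1 - x2). Those of u(l) with Dbar(b, x2) expand <u,b>/x1, where x1
    is x2 + x0. *)
Lemma Phi_tHeis u a b v w l m n : Phi (tHeis u a b v w) l m n = 0.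
Proof.
have [S [Q [N bg]]] := YWfam_bounded formC formL UC VC lY tY a b v w.
have [S' SP] := DM_finite formC formL VC b v.
have [Q' QP] := C_EP_finite formC formL UC a w.
pose yy := fun n => y a b v w n.
have yN k : `|N| + S%:Z + Q%:Z <= k -> yy k = 0.
  move=> kN; rewrite /yy (ESumE UC a (R := 0) bg); last lia.
  by apply: sum_nat0 => s _; apply: sum_nat0 => q _; rewrite big_geq.
pose T s q := theis u (DM act b s v) (EP rho (val a) q w).
have T0 s q : [|| s < 0, S'%:Z <= s, q < 0 | Q'%:Z <= q] ->
    (forall x z, ta (T s q) x z = 0) /\ (forall x z, tb (T s q) x z = 0) /\
    (forall x z, tc (T s q) x z = 0).
  move=> H; have [E|E] : DM act b s v = 0 \/ EP rho (val a) q w = 0.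
  - case/or4P: H => H; [left; exact: DM_neg|left; exact: SP|right; exact: EP_neg|right; exact: QP].
  - split=> [|]; [|split] => x z; rewrite /T /= E ?(lin0 (rho_lin Mm _))
      (lin0 (lY.2 _ _)) ?(lin0 (rho_lin hm _)) //.
  - split=> [|]; [|split] => x z; rewrite /T /= E ?(lin0 (rho_lin hm _))
      (lin0 (lY.1 _ _)) ?(lin0 (rho_lin hm _)) //.
have [M bM] : exists M, forall s q, tbnd M (T s q).
  have [||M0 M0P] := @int_common (fun s M => forall q, (q < Q')%N -> tbnd M (T s%:Z q%:Z)) _ _ S'.
  - by move=> s M M' MM H q /H; apply: tbnd_le.
  - move=> s; apply: (@tbnd_common _ _ Q' (fun q => T s%:Z q%:Z)) => q.
    exact: theis_bnd.
  exists M0 => s q.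
  have [/T0 [Ea [Eb Ec]]|H] := boolP [|| s < 0, S'%:Z <= s, q < 0 | Q'%:Z <= q].
    by split=> x z _.
  have [s0 q0] : 0 <= s /\ 0 <= q by lia.
  by rewrite -[s]gez0_abs // -[q]gez0_abs //; apply: M0P; lia.
have bA k : bounded_fam S' Q' M (fun s q n => ta (T s q) n k).
  move=> s q x H; have [/T0 [Ea _] //|H'] := boolP [|| s < 0, S'%:Z <= s, q < 0 | Q'%:Z <= q].
  by have [ba _ _] := bM s q; apply: ba; lia.
have bB k : exists N', bounded_fam S' Q' N' (fun s q n => tb (T s q) k n).
  by apply: bounded_fam_ex => [s q x /T0 [_ []] //|s q]; apply: tY.
have bC k : exists N', bounded_fam S' Q' N' (fun s q n => tc (T s q) k n).
  by apply: bounded_fam_ex => [s q x /T0 [_ []] //|s q]; apply: tY.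
have jT s q i j k : Phi (T s q) i j k = 0 by apply: Phi_theis.
have b1 := tESum_bnd a bM bA.
have b2 := tbnd_diff (- 1) (tdelta_bnd yN); have b3 := tbnd_x1 (- 1) (tdelta_bnd yN).
have ls c := @linear_scale K U c.
set fa := form u (val a); set fb := form u (val b).
(* The corrections are <u,a> (x1 - x2)^-1 and <u,b> x1^-1 times the triple of the vacuum and [yy],
   whose coefficients vanish. *)
pose T2 := top (fun z => fa *: z) (tdiff (- 1) (tdelta yy)).
pose T3 := top (fun z => fb *: z) (tx1 (- 1) (tdelta yy)).
have [B [B1 [B2 B3]]] : exists B, tbnd B (tESum a T) /\ tbnd B T2 /\ tbnd B T3.
  exact: (tbnd_common3 b1 (tbnd_op (ls fa) b2) (tbnd_op (ls fb) b3)).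
rewrite (@Phi_eq _ _ _ (tadd (tESum a T) (tadd T2 T3))).
- rewrite (Phi_add _ _ _ B1 (tbnd_add B2 B3)) (Phi_add _ _ _ B2 B3).
  rewrite (Phi_ESum a l m n bM bA bB bC jT) (Phi_op _ _ _ b2) // (Phi_op _ _ _ b3) //.
  rewrite (Phi_diff _ _ _ _ (tdelta_bnd yN)) (Phi_x1 _ _ _ _ (tdelta_bnd yN)).
  by rewrite !Phi_tdelta !scaler0 !addr0.
- move=> n' m'; rewrite /= (ESum_mode formC formL UC a u m' n' bg) -/fa -/fb -!addrA.
  congr (_ + _); rewrite bt_delta_r binzN1 -exprMn mulrNN mulr1 expr1n scale1r.
  rewrite -/(yy _) -/(yy _).
  have -> : m' + - 1 - - 1 = m' by lia.
  have -> : (m' + - 1 == - 1) = (m' == 0) by lia.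
  case: (ltgtP m' 0) => m0; rewrite ?scale0r ?scaler0 ?addr0 ?add0r //.
  by rewrite m0 !addr0 scalerDl.
- move=> m' n'; rewrite /= addrC (ESum_linear_w a b n' v) bt_delta binzN1.
  rewrite -exprMn mulrNN mulr1 expr1n scale1r.
  have [N' bB'] := bB m'.
  have -> : y a b v (rho (mode u m') w) n' = ESum rho a (fun s q k => tb (T s q) m' k) n'
    + (if m' < 0 then - fa else 0) *: yy (n' + m').
    have [m0|m0] := ltP m' 0; last first.
      rewrite scale0r addr0; apply: eq_ESum => s q k.
      by rewrite /YWfam /= (mode_EP formC formL hm hl) ltNge m0 scale0r addr0.
    have bq := bounded_fam_shift_q (ltW m0) bg.
    rewrite /yy -(ESum_shift_q rho a _ n' m') -(ESum_scale UC a (- fa) n' bq).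
    have bqs := bounded_fam_scale (- fa) bq.
    rewrite -(ESum_add UC a n' bB' bqs).
    apply: eq_ESum => s q k; rewrite /YWfam /= (mode_EP formC formL hm hl) m0.
    by rewrite (linD (lY.1 _ _)) (linZ (lY.1 _ _)) scaleNr addrK.
  rewrite addrC -!addrA; congr (_ + _); rewrite -/(yy _) -/(yy _).
  have -> : (m' + - 1 == - 1) = (m' == 0) by lia.
  have -> : n' + (- 1 - (- 1 - m')) = n' + m' by lia.
  case: (ltgtP m' 0) => m0.
  - rewrite ifT; last lia.
    by rewrite scale0r !scaler0 !addr0 scaleNr -exprnN expr1 invrN1 scaleN1r scalerN.
  - by rewrite ifF ?scaler0 ?scale0r ?addr0 //; lia.
  - by rewrite ifF ?m0 ?scaler0 ?scale0r ?add0r //; lia.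
- move=> l' n'; rewrite /= addrC (ESum_linear_v a b n' w) bt_delta binzN1.
  have [N' bC'] := bC l'.
  have -> : y a b (act (mode u l') v) w n' = ESum rho a (fun s q k => tc (T s q) l' k) n'
    + (if l' < 0 then - ((-1) ^ l' * fb) else 0) *: yy (n' + l').
    have [m0|m0] := ltP l' 0; last first.
      rewrite scale0r addr0; apply: eq_ESum => s q k.
      by rewrite /YWfam /= DM_mode ltNge m0 mulr0 scale0r subr0.
    have bq := bounded_fam_shift_s (ltW m0) bg.
    rewrite /yy -(ESum_shift_s rho a _ n' l') -(ESum_scale UC a _ n' bq).
    have bqs := bounded_fam_scale (- ((-1) ^ l' * fb)) bq.
    rewrite -(ESum_add UC a n' bC' bqs).
    apply: eq_ESum => s q k; rewrite /YWfam /= DM_mode m0.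
    by rewrite (linB (lY.2 _ _)) (linZ (lY.2 _ _)) scaleNr.
  rewrite addrC -!addrA; congr (_ + _); rewrite -/(yy _) -/(yy _).
  have -> : (l' + - 1 == - 1) = (l' == 0) by lia.
  have -> : n' + (- 1 - (- 1 - l')) = n' + l' by lia.
  case: (ltgtP l' 0) => m0.
  - rewrite ifT; last lia.
    rewrite scale0r !scaler0 !addr0 ?add0r expr1n mul1r scalerA; congr (_ *: _).
    rewrite signz_abs; last lia.
    have -> : - 1 - l' = - (l' + 1) by lia.
    by rewrite N1_opp expfzDr ?N1_neq0 // expr1z mulrN1 mulrN mulrC.
  - by rewrite ifF ?scaler0 ?scale0r ?addr0 //; lia.
  - by rewrite m0 /= ?scaler0 ?scale0r ?add0r ?addr0.
Qed.

End HeisenbergJacobi.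

Section IntSums.
Context {W : zmodType}.

Lemma sum_shiftZ (H : int -> W) (Q i N : nat) : (forall k, k < 0 -> H k = 0) ->
  (forall k, Q%:Z <= k -> H k = 0) -> (Q + i <= N)%N ->
  \sum_(0 <= q < N) H (q%:Z - i%:Z) = \sum_(0 <= q < Q) H q%:Z.
Proof.
move=> H0 HQ QN; rewrite -(fsum_intE H0 HQ).
rewrite -(@fsum_intE _ (fun k => H (k - i%:Z)) N) ?fsum_shift //.
- by move=> k k0; apply: H0; lia.
- by move=> k k0; apply: HQ; lia.
Qed.

Lemma fsum_split (f : int -> W) N : (forall k, N <= `|k| -> f k = 0) ->
  \sum_(k \in [set: int]) f k = \sum_(i \in [set: nat]) f i%:Z
    + \sum_(i \in [set: nat]) f (- 1 - i%:Z).
Proof.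
move=> fN; pose f1 (k : int) := if 0 <= k then f k else 0; pose f2 (k : int) := if 0 <= k then f (- 1 - k) else 0.
have -> : \sum_(i \in [set: nat]) f i%:Z = \sum_(i \in [set: nat]) f1 i%:Z.
  by apply: eq_fsbigr => i _; rewrite /f1.
have -> : \sum_(i \in [set: nat]) f (- 1 - i%:Z) = \sum_(i \in [set: nat]) f2 i%:Z.
  by apply: eq_fsbigr => i _; rewrite /f2.
rewrite (fsum_nat (F := f1)) => [|k k0]; last by rewrite /f1 ifN // -ltNge.
rewrite (fsum_nat (F := f2)) => [|k k0]; last by rewrite /f2 ifN // -ltNge.
rewrite -(fsum_opp f2 (- 1)) -fsum_add.
- apply: eq_fsbigr => k _; rewrite /f1 /f2; have -> : - 1 - (- 1 - k) = k by lia.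
  by case: ifP => k0; [rewrite ifF ?addr0 //; lia|rewrite ifT ?add0r //; lia].
- by apply: (@finite_supp_int _ _ N) => k kN; rewrite /f1 fN ?if_same.
- apply: (@finite_supp_int _ _ (`|N| + 1)) => k kN; rewrite /f2; case: ifP => // k0.
  by rewrite fN //; lia.
Qed.

End IntSums.

(** Finiteness is not assumed: for an infinite support and c nonzero both sides take the default
    value 0. *)
Lemma fsum_scale (K : fieldType) (W : lmodType K) (I : choiceType) (c : K) (F : I -> W) :
  c *: (\sum_(i \in [set: I]) F i) = \sum_(i \in [set: I]) (c *: F i).
Proof.
have [->|c0] := eqVneq c 0; first by rewrite scale0r fsum0 // => i; rewrite scale0r.
have sE : supp (fun i => c *: F i) = supp F.
  by apply/seteqP; split=> i; rewrite /supp /= scaler_eq0 (negPf c0).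
have [fF|iF] := pselect (finite_set (supp F)).
  by rewrite !(fsumTE fF) ?sE // scaler_sumr.
have dflt (G : I -> W) : supp G = supp F -> \sum_(i \in [set: I]) G i = 0.
  move=> E; apply: fsbig_dflt => fG; apply: iF; rewrite -E; apply: sub_finite_set fG.
  by move=> i /= /eqP.
by rewrite !dflt ?scaler0.
Qed.

(** * Vertex operators of the vectors e^a *)

Section ZeroExponent.
Context {K : numFieldType} {h : lmodType K} (form : h -> h -> K).
Context (formC : forall x y, form x y = form y x).
Context (formL : forall c x y z, form (c *: x + y) z = c * form x z + form y z).
Context (L : zmodClosed h).
Context {U : lmodType K} (rho : heis h -> U -> U) (UC : condition_C form L rho).

Let hm : is_heis_module form rho. Proof. by case: UC. Qed.
Let hl : has_level rho 1. Proof. by case: UC. Qed.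

Let m0 k z : rho (mode (val (0 : lattice L)) k) z = 0.
Proof. by rewrite raddf0; apply: (lin0 (rho_mode_lin hm _ _)). Qed.

Lemma EM_zero r z : EM rho (val (0 : lattice L)) r z = if r == 0 then z else 0.
Proof.
case: (ltgtP r 0) => [r0|r0|->]; [exact: EM_neg| |exact: EM0].
apply: (@XZ_eq0 _ _ _ _ _ (absz r).+1) => //; try by lia.
- exact: (EMf_linear hm).
- by move=> i j; apply: (EMf_comm formC formL hm hl).
- by move=> i i0 _; rewrite /EMf m0 scaler0.
Qed.

Lemma EP_zero r z : EP rho (val (0 : lattice L)) r z = if r == 0 then z else 0.
Proof.
case: (ltgtP r 0) => [r0|r0|->]; [exact: EP_neg| |exact: EP0].
apply: (@XZ_eq0 _ _ _ _ _ (absz r).+1) => //; try by lia.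
- exact: (EPf_linear hm).
- by move=> i j; apply: (EPf_comm formC formL hm hl).
- by move=> i i0 _; rewrite /EPf m0 scaler0.
Qed.

End ZeroExponent.

Section VacuumFields.
Context {K : numFieldType} {h : lmodType K} (form : h -> h -> K).
Context (formC : forall x y, form x y = form y x).
Context (formL : forall c x y z, form (c *: x + y) z = c * form x z + form y z).
Context (L : zmodClosed h).
Context {U : lmodType K} (rho : heis h -> U -> U) (UC : condition_C form L rho).
Context {V : lmodType K} (act : heis h -> V -> V) (VC : condition_C form L act).
Context (YU : V -> int -> U -> U) (lY : linear_fields YU) (tY : truncated YU).
Context (vac : V) (act_vac : forall u n, 0 <= n -> act (mode u n) vac = 0).
Context (YU_vac : forall n w, YU vac n w = if n == - 1 then w else 0).
Context (YU_gen : forall u n w, YU (act (mode u (- 1)) vac) n w = rho (mode u n) w).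
Implicit Types (a b : lattice L) (w : U) (v : V) (u : h) (n m : int).

Let hm : is_heis_module form rho. Proof. by case: UC. Qed.
Let hl : has_level rho 1. Proof. by case: UC. Qed.
Let Mm : is_heis_module form act. Proof. by case: VC. Qed.
Let Ml : has_level act 1. Proof. by case: VC. Qed.

Lemma EP_vac u s : EP act u s vac = if s == 0 then vac else 0.
Proof.
case: (ltgtP s 0) => [s0|s0|->]; [exact: EP_neg| |exact: EP0].
apply: (@XZ_eq0 _ _ _ _ _ (absz s).+1) => //; try by lia.
- exact: (EPf_linear Mm).
- by move=> i j; apply: (EPf_comm formC formL Mm Ml).
move=> i i0 _; rewrite /EPf -/(EP act u (s - i%:Z) vac) (mode_EP formC formL Mm Ml).
by rewrite act_vac // (lin0 (EP_linear Mm _ _)) scale0r addr0 scaler0.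
Qed.

Lemma DM_vac b s : DM act b s vac = if s == 0 then vac else 0.
Proof. by rewrite /DM EP_vac; case: eqP => [->|_]; rewrite ?scaler0 ?scale1r. Qed.

(* The coefficient of [x^(-n-1)] in [E^-(-a, x) E^+(-a, x) w]. *)
Definition X (a : h) n w := \sum_(q \in [set: int]) EM rho a (q - 1 - n) (EP rho a q w).

Lemma XE (a : h) n w (Q : nat) : (forall q : int, Q%:Z <= q -> EP rho a q w = 0) ->
  X a n w = \sum_(0 <= q < Q) EM rho a (q%:Z - 1 - n) (EP rho a q%:Z w).
Proof.
move=> QP; rewrite /X (fsum_intE (N := Q)) // => q q0.
  by rewrite EP_neg ?(lin0 (EM_linear hm _ _)).
by rewrite QP ?(lin0 (EM_linear hm _ _)).
Qed.

Lemma X_fam a b w n : X (val a) n w = \sum_(q \in [set: int]) \sum_(r \in [set: int])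
  EM rho (val a) r (YU vac (n - q + r) (EP rho (val a) q w)).
Proof.
apply: eq_fsbigr => q _; rewrite (fsum1 (i0 := q - 1 - n)) => [|r rq].
  by rewrite YU_vac ifT //; lia.
by rewrite YU_vac ifF ?(lin0 (EM_linear hm _ _)) //; lia.
Qed.

Lemma ESum_vac a b w n : ESum rho a (YWfam rho act YU a b vac w) n = X (val a) n w.
Proof.
rewrite /ESum (fsum1 (i0 := 0)) => [|s s0]; last first.
  do 2![apply: fsum0 => ?]; rewrite /YWfam DM_vac (negPf s0).
  by rewrite (lin0 (lY.2 _ _)) (lin0 (EM_linear hm _ _)).
rewrite (X_fam a b); apply: eq_fsbigr => q _; apply: eq_fsbigr => r _.
by rewrite /YWfam DM_vac eqxx subr0.
Qed.

Lemma DM_gen u b s : DM act b s (act (mode u (- 1)) vac) =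
  if s == 0 then act (mode u (- 1)) vac else if s == 1 then form u (val b) *: vac else 0.
Proof.
rewrite (DM_mode formC formL VC) !DM_vac ltrN10 N1_opp expr1z mulN1r scaleNr opprK.
have -> : (s + - 1 == 0) = (s == 1) by lia.
case: eqP => [->|_]; first by rewrite scaler0 addr0.
by rewrite (lin0 (rho_lin Mm _)) add0r; case: eqP => // _; rewrite scaler0.
Qed.

(** The two terms reflect Dbar(b, x) u(-1)vac = u(-1)vac + <u,b> x^-1 vac. *)
Lemma ESum_gen_split a b u w n :
  ESum rho a (YWfam rho act YU a b (act (mode u (- 1)) vac) w) n =
  \sum_(q \in [set: int]) \sum_(r \in [set: int])
    EM rho (val a) r (rho (mode u (n - q + r)) (EP rho (val a) q w))
  + form u (val b) *: X (val a) (n - 1) w.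
Proof.
have l0 r := lin0 (EM_linear hm (val a) r).
pose f s := \sum_(q \in [set: int]) \sum_(r \in [set: int])
  EM rho (val a) r (YWfam rho act YU a b (act (mode u (- 1)) vac) w s q (n - s - q + r)).
rewrite -[LHS]/(\sum_(s \in [set: int]) f s) (@fsum_intE _ f 2) => [|s s0|s s2].
- rewrite big_nat_recr // big_nat1 /=; congr (_ + _).
    apply: eq_fsbigr => q _; apply: eq_fsbigr => r _.
    by rewrite /YWfam DM_gen eqxx YU_gen subr0.
  rewrite (X_fam a b); rewrite /f /YWfam DM_gen /=.
  rewrite fsum_scale; apply: eq_fsbigr => q _; rewrite fsum_scale.
  apply: eq_fsbigr => r _; rewrite (linZ (lY.2 _ _)) (linZ (EM_linear hm _ _)).
  by congr (_ *: EM _ _ _ (YU _ _ _)); lia.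
- do 2![apply: fsum0 => ?]; rewrite /YWfam DM_gen; do 2?[rewrite ifF; last lia].
  by rewrite (lin0 (lY.2 _ _)) l0.
- do 2![apply: fsum0 => ?]; rewrite /YWfam DM_gen; do 2?[rewrite ifF; last lia].
  by rewrite (lin0 (lY.2 _ _)) l0.
Qed.

Lemma ESum_gen0 b u w n :
  ESum rho (0 : lattice L) (YWfam rho act YU 0 b (act (mode u (- 1)) vac) w) n
  = rho (mode u n) w + (if n == 0 then form u (val b) else 0) *: w.
Proof.
have E0 := EM_zero formC formL UC; have P0 := EP_zero formC formL UC.
rewrite ESum_gen_split (fsum1 (i0 := 0)) => [|q q0]; last first.
  apply: fsum0 => r; rewrite P0 (negPf q0) (lin0 (rho_lin hm _)).
  exact: (lin0 (EM_linear hm _ _)).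
rewrite (fsum1 (i0 := 0)) => [|r r0]; last by rewrite E0 (negPf r0).
rewrite E0 P0 !eqxx subr0 addr0; congr (_ + _).
rewrite /X (fsum1 (i0 := 0)) => [|q q0]; last first.
  by rewrite P0 (negPf q0) (lin0 (EM_linear hm _ _)).
rewrite P0 eqxx E0; have -> : (0 - 1 - (n - 1) == 0) = (n == 0) by lia.
by case: eqP => _; rewrite ?scaler0 ?scale0r.
Qed.

Lemma X_zero n w : X (val (0 : lattice L)) n w = if n == - 1 then w else 0.
Proof.
have E0 := EM_zero formC formL UC; have P0 := EP_zero formC formL UC.
rewrite /X (fsum1 (i0 := 0)) => [|q q0].
  by rewrite P0 eqxx E0; have -> : (0 - 1 - n == 0) = (n == - 1) by lia.
by rewrite P0 (negPf q0) (lin0 (EM_linear hm _ _)).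
Qed.

Lemma ESum_zero v w n :
  ESum rho (0 : lattice L) (YWfam rho act YU 0 (0 : lattice L) v w) n = YU v n w.
Proof.
have E0 := EM_zero formC formL UC; have P0 := EP_zero formC formL UC.
have P0' := EP_zero formC formL VC; have l0 r := lin0 (EM_linear hm (val (0 : lattice L)) r).
rewrite /ESum (fsum1 (i0 := 0)) => [|s s0]; last first.
  do 2![apply: fsum0 => ?]; rewrite /YWfam /DM P0' (negPf s0) scaler0.
  by rewrite (lin0 (lY.2 _ _)) l0.
rewrite (fsum1 (i0 := 0)) => [|q q0]; last first.
  apply: fsum0 => ?; rewrite /YWfam P0 (negPf q0).
  by rewrite (lin0 (lY.1 _ _)) l0.
rewrite (fsum1 (i0 := 0)) => [|r r0]; last by rewrite E0 (negPf r0).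
by rewrite E0 eqxx /YWfam /DM P0 P0' eqxx scale1r !subr0 ?addr0.
Qed.

(** This is the derivative of E^-(-a, x) E^+(-a, x) x^{a(0)}: at a given q, the negative modes of a
    contribute q - n by [EM_rec], the zero mode mu, and the positive modes - q by [EP_rec]. *)
Lemma X_derivative a mu w n : eigen rho a mu w ->
  \sum_(q \in [set: int]) \sum_(r \in [set: int])
    EM rho (val a) r (rho (mode (val a) (n - q + r)) (EP rho (val a) q w))
  = (mu - n)%:~R *: X (val a) (n - 1) w.
Proof.
move=> Ew; have lM r := EM_linear hm (val a) r; have lR k := rho_lin hm (mode (val a) k).
have [Q QP] := C_EP_finite formC formL UC a w.
pose A k z := rho (mode (val a) k) z.
have [B0 B0P] : exists B : int, forall q : nat, (q < Q)%N -> forall k, B <= k ->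
    A k (EP rho (val a) q%:Z w) = 0.
  have [||B BP] := @int_common (fun q B => forall k, B <= k -> A k (EP rho (val a) q%:Z w) = 0) _ _ Q.
  - by move=> q N N' NN H k kN; apply: H; apply: le_trans kN.
  - move=> q; have [B BP] := C_restricted UC (EP rho (val a) q%:Z w).
    by exists B => k kB; apply: BP.
  - by exists B.
pose B := (absz B0 + Q + absz n).+1.
have EPQ (q : nat) : (Q <= q)%N -> EP rho (val a) q%:Z w = 0 by move=> ?; apply: QP; lia.
have AB (q : int) k : B%:Z <= k -> A k (EP rho (val a) q w) = 0.
  move=> Bk; have [q0|q0] := ltP q 0; first by rewrite /A EP_neg // (lin0 (lR _)).
  have [qQ|qQ] := leP Q%:Z q; first by rewrite /A QP // (lin0 (lR _)).
  by rewrite -[q]gez0_abs // B0P //; lia.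
pose Z q := EM rho (val a) (q - n) (EP rho (val a) q w).
have XZ : X (val a) (n - 1) w = \sum_(0 <= q < Q) Z q%:Z.
  by rewrite (XE _ QP); apply: eq_bigr => q _; rewrite /Z; congr (EM _ _ _ _); lia.
rewrite (@fsum_intE _ _ Q) => [|q q0|q qQ]; last 2 first.
- by apply: fsum0 => r; rewrite EP_neg // (lin0 (lR _)) (lin0 (lM _)).
- by apply: fsum0 => r; rewrite QP // (lin0 (lR _)) (lin0 (lM _)).
- transitivity (\sum_(0 <= q < Q) (mu - n + q%:Z - q%:Z)%:~R *: Z q%:Z); last first.
    by rewrite XZ scaler_sumr; apply: eq_bigr => q _; rewrite addrK.
  pose G q k := EM rho (val a) (q - n + k) (A k (EP rho (val a) q w)).
  have inner (q : nat) : (q < Q)%N -> \sum_(r \in [set: int])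
      EM rho (val a) r (A (n - q%:Z + r) (EP rho (val a) q%:Z w))
      = (mu + q%:Z - n)%:~R *: Z q%:Z + \sum_(1 <= j < B) G q%:Z j%:Z.
    move=> qQ; rewrite -(fsum_shift _ (q%:Z - n)).
    rewrite (eq_fsbigr (fun k => G q%:Z k)) => [|k _]; last first.
      by rewrite /G; congr (EM _ _ _ (A _ _)); lia.
    rewrite (@fsum_split _ _ B%:Z) => [|k kB]; last first.
      have [k0|k0] := leP 0 k; first by rewrite /G AB ?(lin0 (lM _)) //; lia.
      by rewrite /G EM_neg //; lia.
    rewrite (nsumE (N := B)) => [|i iB]; last by rewrite /G AB ?(lin0 (lM _)) //; lia.
    rewrite (nsumE (N := B.-1)) => [|i iB]; last by rewrite /G EM_neg //; lia.
    rewrite big_ltn // addrAC; congr (_ + _).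
    rewrite /G addr0 /A (eigen_EP formC formL UC _ _ Ew) (linZ (lM _)) -/(Z _).
    have -> : (mu + q%:Z - n) = mu + (q%:Z - n) by lia.
    rewrite intrD scalerDl; congr (_ + _).
    have qB : q%:Z - n < B%:Z by lia.
    rewrite /Z (EM_rec formC formL hm hl _ _ qB).
    rewrite [RHS](big_addn 0 B 1) subn1; apply: eq_bigr => i _.
    rewrite (mode_EM formC formL hm hl) ifF; last lia.
    rewrite scale0r addr0; have -> : - (i + 1)%N%:Z = - 1 - i%:Z by lia.
    by congr (EM _ _ _ _); lia.
  rewrite (eq_big_nat _ _ (F2 := fun q => (mu + q%:Z - n)%:~R *: Z q%:Z + \sum_(1 <= j < B) G q%:Z j%:Z)).
    rewrite big_split /=.
    have Z0 q : (Q <= q)%N -> Z q%:Z = 0 by move=> /EPQ E; rewrite /Z E (lin0 (lM _)).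
    (* For the positive modes, replacing q by q - j makes the index of [EM] independent of j, so
       that the sum over j is that of [EP_rec]. *)
    have -> : \sum_(0 <= q < Q) \sum_(1 <= j < B) G q%:Z j%:Z
        = \sum_(0 <= q < Q) (- q%:Z)%:~R *: Z q%:Z.
      rewrite exchange_big /= -(@sum_nat_widen _ (fun q => (- q%:Z)%:~R *: Z q%:Z) Q (Q + B)) ?leq_addr //; last first.
        by move=> q /Z0 ->; rewrite scaler0.
      rewrite (eq_big_nat _ _ (F2 := fun j => \sum_(0 <= q < Q + B) G (q%:Z - j%:Z) j%:Z)); last first.
        move=> j /andP[_ jB]; rewrite (@sum_shiftZ _ (fun k => G k j%:Z) Q) // => [k k0|k kQ|].
        - by rewrite /G /A EP_neg // (lin0 (lR _)) (lin0 (lM _)).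
        - by rewrite /G /A QP // (lin0 (lR _)) (lin0 (lM _)).
        - by lia.
      rewrite exchange_big /=; apply: eq_big_nat => q /andP[_ qB].
      transitivity (EM rho (val a) (q%:Z - n) (\sum_(1 <= j < Q + B) A j%:Z (EP rho (val a) (q%:Z - j%:Z) w))).
        have -> : \sum_(1 <= j < Q + B) A j%:Z (EP rho (val a) (q%:Z - j%:Z) w)
            = \sum_(1 <= j < B) A j%:Z (EP rho (val a) (q%:Z - j%:Z) w).
          rewrite (big_cat_nat (n := B)) ?leq_addl //= [X in _ + X]sum_nat0 ?addr0 //.
          by move=> j /andP[Bj _]; apply: AB; lia.
        rewrite (lin_sum (lM _)); apply: eq_bigr => j _; rewrite /G.
        by have -> : q%:Z - j%:Z - n + j%:Z = q%:Z - n by lia.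
      have qQB : q%:Z < (Q + B)%N%:Z by lia.
      rewrite -[\sum_(_ <= _ < _) _]opprK -(EP_rec formC formL hm hl _ _ qQB).
      by rewrite (linN (lM _)) (linZ (lM _)) -/(Z _) mulrNz scaleNr.
    rewrite -big_split; apply: eq_bigr => q _ /=; rewrite -scalerDl -intrD.
    by congr (_%:~R *: _); lia.
  by move=> q /andP[_ qQ]; apply: inner.
Qed.

(* The coefficients of [E^-(-a, x1) E^-(-b, x2) E^+(-a, x1) E^+(-b, x2) w]. *)
Definition XX (a b : h) w (n m : int) := \sum_(q1 \in [set: int]) \sum_(q2 \in [set: int])
  EM rho a (q1 - 1 - m) (EM rho b (q2 - 1 - n) (EP rho a q1 (EP rho b q2 w))).

Lemma XXE (a b : h) w n m (Q1 Q2 : nat) :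
  (forall q : int, Q1%:Z <= q -> EP rho a q w = 0) ->
  (forall q : int, Q2%:Z <= q -> EP rho b q w = 0) ->
  XX a b w n m = \sum_(0 <= q1 < Q1) \sum_(0 <= q2 < Q2)
    EM rho a (q1%:Z - 1 - m) (EM rho b (q2%:Z - 1 - n) (EP rho a q1%:Z (EP rho b q2%:Z w))).
Proof.
move=> P1 P2; have lM u r := EM_linear hm u r; have lP u r := EP_linear hm u r.
have ePP := EP_comm formC formL hm hl.
rewrite /XX (@fsum_intE _ _ Q1) => [|q q0|q qQ].
- apply: eq_big_nat => q1 _; rewrite (@fsum_intE _ _ Q2) => [|q q0|q qQ] //.
    by rewrite (EP_neg _ _ w) // (lin0 (lP _ _)) !(lin0 (lM _ _)).
  by rewrite P2 // (lin0 (lP _ _)) !(lin0 (lM _ _)).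
- by apply: fsum0 => q2; rewrite EP_neg // !(lin0 (lM _ _)).
- by apply: fsum0 => q2; rewrite ePP P1 // (lin0 (lP _ _)) !(lin0 (lM _ _)).
Qed.

Lemma XX_sym a b w n m : XX (val a) (val b) w n m = XX (val b) (val a) w m n.
Proof.
have [Q1 P1] := C_EP_finite formC formL UC a w.
have [Q2 P2] := C_EP_finite formC formL UC b w.
rewrite (XXE _ _ P1 P2) (XXE _ _ P2 P1) exchange_big /=.
apply: eq_bigr => q2 _; apply: eq_bigr => q1 _.
by rewrite (EM_comm formC formL hm hl) (EP_comm formC formL hm hl (val a)).
Qed.

Lemma XX_bnd a b w : exists N, bnd N (XX (val a) (val b) w).
Proof.
have [Q1 P1] := C_EP_finite formC formL UC a w.
have [Q2 P2] := C_EP_finite formC formL UC b w.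
exists Q2%:Z => n m nQ; rewrite (XXE _ _ P1 P2).
apply: sum_nat0 => q1 _; apply: sum_nat0 => q2 /andP[_ q2Q].
by rewrite (@EM_neg _ _ _ _ (val b)) ?(lin0 (EM_linear hm _ _)) //; lia.
Qed.

(** Moving E^+(-a, x1) past E^-(-b, x2) costs (1 - x2/x1)^p, and the shift by p is the factor x1^p;
    together they are (x1 - x2)^p. *)
Lemma X_X a b (p : int) w n m : form (val a) (val b) = p%:~R ->
  X (val a) (m + p) (X (val b) n w) = bt (-1) p (XX (val a) (val b) w) n m.
Proof.
move=> ab; have lM u r := EM_linear hm u r; have lP u r := EP_linear hm u r.
have ePP := EP_comm formC formL hm hl.
have [Q1 P1] := C_EP_finite formC formL UC a w.
have [Q2 P2] := C_EP_finite formC formL UC b w.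
have bXX : bnd Q2%:Z (XX (val a) (val b) w).
  move=> n' m' nQ; rewrite (XXE _ _ P1 P2).
  apply: sum_nat0 => q1 _; apply: sum_nat0 => q2 /andP[_ q2Q].
  by rewrite (@EM_neg _ _ _ _ (val b)) ?(lin0 (lM _ _)) //; lia.
pose I := absz (Q2%:Z - n)%R.
have nI : Q2%:Z <= n + I%:Z by rewrite /I; lia.
rewrite (btE _ _ _ bXX nI) (XE _ P2).
have [Q3 P3] := C_EP_finite formC formL UC a
  (\sum_(0 <= q < Q2) EM rho (val b) (q%:Z - 1 - n) (EP rho (val b) q%:Z w)).
pose N := (Q1 + Q3 + I)%N.
have P3N q : N%:Z <= q -> EP rho (val a) q
  (\sum_(0 <= q < Q2) EM rho (val b) (q%:Z - 1 - n) (EP rho (val b) q%:Z w)) = 0.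
  by move=> qN; apply: P3; rewrite /N in qN; lia.
rewrite (XE _ P3N).
pose H i q2 q1 := EM rho (val a) (q1 + i%:Z - 1 - m - p) (EM rho (val b) (q2%:Z - 1 - n - i%:Z)
  (EP rho (val a) q1 (EP rho (val b) q2%:Z w))).
transitivity (\sum_(0 <= q1 < N) \sum_(0 <= q2 < Q2) \sum_(0 <= i < I)
    ((-1) ^+ i * binz p i) *: H i q2 (q1%:Z - i%:Z)).
  apply: eq_big_nat => q1 /andP[_ q1N]; rewrite (lin_sum (lP _ _)) (lin_sum (lM _ _)).
  apply: eq_big_nat => q2 /andP[_ q2Q].
  have q1NI : q1%:Z < (N + I)%N%:Z by lia.
  rewrite (EP_EM formC formL hm hl _ _ ab q1NI) (lin_sum (lM _ _)).
  rewrite (@sum_nat_widen _ _ I) ?leq_addl // => [|i Ii]; last first.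
    by rewrite [X in EM _ _ _ (_ *: X)]EM_neg ?scaler0 ?(lin0 (lM _ _)) //; lia.
  apply: eq_bigr => i _; rewrite (linZ (lM _ _)) /H.
  have -> : q1%:Z - i%:Z + i%:Z - 1 - m - p = q1%:Z - 1 - (m + p) by lia.
  by [].
under eq_bigr do rewrite exchange_big.
rewrite exchange_big; apply: eq_big_nat => i /andP[_ iI] /=.
rewrite (XXE _ _ P1 P2) exchange_big /= [X in _ = _ *: X]exchange_big /= scaler_sumr.
apply: eq_big_nat => q2 _; rewrite -scaler_sumr; congr (_ *: _).
rewrite (@sum_shiftZ _ (H i q2) Q1) => [|k k0|k kQ|].
- apply: eq_bigr => q1 _; rewrite /H.
  have -> : q1%:Z + i%:Z - 1 - m - p = q1%:Z - 1 - (m + p - i%:Z) by lia.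
  by have -> : q2%:Z - 1 - n - i%:Z = q2%:Z - 1 - (n + i%:Z) by lia.
- by rewrite /H EP_neg // !(lin0 (lM _ _)).
- by rewrite /H ePP P1 // (lin0 (lP _ _)) !(lin0 (lM _ _)).
- by rewrite /N; lia.
Qed.

(** 1/(x1 - x2) and 1/(x2 - x1), expanded in x2 and in x1, have all coefficients 1 and add up to a
    delta function. The resulting bilateral sum evaluates at x1 = x2, where the exponentials of a
    and b combine into those of a + b. *)
Lemma XX_diagonal a b w n m :
  bt (-1) (- 1) (XX (val a) (val b) w) n m + bt (-1) (- 1) (XX (val b) (val a) w) m n
  = X (val a + val b) (n + m) w.
Proof.
have lM u r := EM_linear hm u r; have lP u r := EP_linear hm u r.
have [Q1 P1] := C_EP_finite formC formL UC a w.
have [Q2 P2] := C_EP_finite formC formL UC b w.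
pose F k := XX (val a) (val b) w (n + k) (m - 1 - k).
have sgn i : (-1) ^+ i * binz (- 1) i = 1 :> K.
  by rewrite binzN1 -expr2 sqrr_sign.
have e1 : bt (-1) (- 1) (XX (val a) (val b) w) n m = \sum_(i \in [set: nat]) F i%:Z.
  by apply: eq_fsbigr => i _; rewrite sgn scale1r.
have e2 : bt (-1) (- 1) (XX (val b) (val a) w) m n = \sum_(i \in [set: nat]) F (- 1 - i%:Z).
  apply: eq_fsbigr => i _; rewrite sgn scale1r XX_sym /F.
  have -> : n + (- 1 - i%:Z) = n + - 1 - i%:Z by lia.
  by have -> : m - 1 - (- 1 - i%:Z) = m + i%:Z by lia.
etransitivity; first exact: (congr2 +%R e1 e2).
have Fk k : F k = \sum_(0 <= q1 < Q1) \sum_(0 <= q2 < Q2)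
    EM rho (val a) (q1%:Z - m + k) (EM rho (val b) (q2%:Z - 1 - n - k)
      (EP rho (val a) q1%:Z (EP rho (val b) q2%:Z w))).
  rewrite /F (XXE _ _ P1 P2); apply: eq_bigr => q1 _; apply: eq_bigr => q2 _.
  have -> : q1%:Z - 1 - (m - 1 - k) = q1%:Z - m + k by lia.
  by have -> : q2%:Z - 1 - (n + k) = q2%:Z - 1 - n - k by lia.
(* For [|k|] >= B one of the two indices of [EM] is negative; a shift by B then turns the bilateral
   sum into one over natural numbers. *)
pose B := (absz n + absz m + Q1 + Q2).+1.
rewrite -(@fsum_split _ F B%:Z) => [|k kB]; last first.
  rewrite Fk; apply: sum_nat0 => q1 /andP[_ q1Q]; apply: sum_nat0 => q2 /andP[_ q2Q].
  have [k0|k0] := leP 0 k; last by rewrite EM_neg //; lia.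
  by rewrite [X in EM _ _ _ X]EM_neg ?(lin0 (lM _ _)) //; lia.
rewrite (eq_fsbigr (fun k => \sum_(0 <= q1 < Q1) \sum_(0 <= q2 < Q2)
    EM rho (val a) (q1%:Z - m + k) (EM rho (val b) (q2%:Z - 1 - n - k)
      (EP rho (val a) q1%:Z (EP rho (val b) q2%:Z w))))) => [|k _]; last exact: Fk.
rewrite -(fsum_shift _ (- B%:Z)) (@fsum_intE _ _ (B + B).+1); first last.
- move=> k kB; apply: sum_nat0 => q1 /andP[_ q1Q]; apply: sum_nat0 => q2 /andP[_ q2Q].
  by rewrite [X in EM _ _ _ X]EM_neg ?(lin0 (lM _ _)) //; lia.
- move=> k kB; apply: sum_nat0 => q1 /andP[_ q1Q]; apply: sum_nat0 => q2 /andP[_ q2Q].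
  by rewrite EM_neg //; lia.
rewrite exchange_big /=.
transitivity (\sum_(0 <= q1 < Q1) \sum_(0 <= q2 < Q2)
   EM rho (val a + val b) (q1%:Z + q2%:Z - 1 - (n + m)) (EP rho (val a) q1%:Z (EP rho (val b) q2%:Z w))).
  apply: eq_big_nat => q1 /andP[_ q1Q]; rewrite exchange_big /=.
  apply: eq_big_nat => q2 /andP[_ q2Q].
  set z := EP rho _ _ _; set t := q1%:Z + q2%:Z - 1 - (n + m).
  have tB : t < (B + B + B)%N%:Z by rewrite /t; lia.
  rewrite (EM_add formC formL hm hl _ _ _ tB).
  pose G k := EM rho (val a) k (EM rho (val b) (t - k) z).
  have G0 k : k < 0 -> G k = 0 by move=> k0; rewrite /G EM_neg.
  have GB k : (B + B + B)%N%:Z <= k -> G k = 0.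
    by move=> k0; rewrite /G [X in EM _ _ _ X]EM_neg ?(lin0 (lM _ _)) //; lia.
  rewrite -(fsum_intE G0 GB) -(fsum_shift G (q1%:Z - m - B%:Z)).
  rewrite (@fsum_intE _ _ (B + B).+1) => [|k k0|k kB].
  - apply: eq_bigr => i _; rewrite /G /t.
    have -> : q1%:Z + q2%:Z - 1 - (n + m) - (i%:Z + (q1%:Z - m - B%:Z))
      = q2%:Z - 1 - n - (i%:Z - B%:Z) by lia.
    by have -> : i%:Z + (q1%:Z - m - B%:Z) = q1%:Z - m + (i%:Z - B%:Z) by lia.
  - by apply: G0; lia.
  - by rewrite /G [X in EM _ _ _ X]EM_neg ?(lin0 (lM _ _)) //; lia.
pose N := (Q1 + Q2)%N.
have PN (q : int) : N%:Z <= q -> EP rho (val a + val b) q w = 0.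
  move=> qN; have qq : q < (absz q).+1%:Z by lia.
  rewrite (EP_add formC formL hm hl _ _ _ qq) sum_nat0 // => i /andP[_ iq].
  have [Qi|iQ] := leP Q1%:Z i%:Z.
    by rewrite (EP_comm formC formL hm hl) P1 // (lin0 (lP _ _)).
  by rewrite P2 ?(lin0 (lP _ _)) //; rewrite /N in qN; lia.
rewrite (XE _ PN).
pose H i j := EM rho (val a + val b) (i%:Z + j%:Z - 1 - (n + m))
   (EP rho (val a) i%:Z (EP rho (val b) j%:Z w)).
have H1 i j : (Q1 <= i)%N -> H i j = 0.
  move=> Qi; rewrite /H (EP_comm formC formL hm hl) P1 ?(lin0 (lP _ _)) ?(lin0 (lM _ _)) //; lia.
have H2 i j : (Q2 <= j)%N -> H i j = 0.
  by move=> Qi; rewrite /H P2 ?(lin0 (lP _ _)) ?(lin0 (lM _ _)) //; lia.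
transitivity (\sum_(0 <= i < N) \sum_(0 <= j < N) H i j).
  rewrite (@sum_nat_widen _ _ Q1 N) ?leq_addr // => [|i Qi]; last first.
    by apply: sum_nat0 => j _; apply: H1.
  apply: eq_bigr => i _; rewrite (@sum_nat_widen _ _ Q2 N) ?leq_addl // => j Qj.
  exact: H2.
rewrite sum_diag => [|i j Nij]; last first.
  have [Qi|iQ] := leqP Q1 i; first exact: H1.
  by apply: H2; rewrite /N in Nij; lia.
apply: eq_bigr => q _.
have qq : q%:Z < q.+1%:Z by lia.
rewrite (EP_add formC formL hm hl _ _ _ qq) (lin_sum (lM _ _)).
apply: eq_big_nat => i /andP[_ iq]; rewrite /H.
have -> : (q - i)%N%:Z = q%:Z - i%:Z by lia.
by congr (EM _ _ _ _); lia.
Qed.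

End VacuumFields.

(** * Trilinearity, locality and differentiation of Jacobi coefficients *)

Section TripleLinear.
Context {K : numFieldType} {V W : lmodType K}.
Context (YV : V -> int -> V -> V) (Y : V -> int -> W -> W).
Context (lV : linear_fields YV) (lY : linear_fields Y).
Context (tV : truncated YV) (tY : truncated Y).

Lemma Phi_lincomb N c (T T1 T2 : @trip K W) l m n : tbnd N T1 -> tbnd N T2 ->
  (forall x y, ta T x y = c *: ta T1 x y + ta T2 x y) ->
  (forall x y, tb T x y = c *: tb T1 x y + tb T2 x y) ->
  (forall x y, tc T x y = c *: tc T1 x y + tc T2 x y) ->
  Phi T l m n = c *: Phi T1 l m n + Phi T2 l m n.
Proof.
move=> b1 b2 ea eb ec; rewrite -(Phi_op _ _ _ b1 (@linear_scale K W c)).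
by rewrite -(Phi_add _ _ _ (tbnd_op (@linear_scale K W c) b1) b2); apply: Phi_eq.
Qed.

Lemma tr_bnd2 u v w u' v' w' : exists N, tbnd N (tr YV Y u v w) /\ tbnd N (tr YV Y u' v' w').
Proof.
have [N bN] := tr_bnd lY tV tY u v w; have [N' bN'] := tr_bnd lY tV tY u' v' w'.
by exists (`|N| + `|N'|); split; [apply: tbnd_le bN|apply: tbnd_le bN']; lia.
Qed.

Lemma Phi_tr_linear1 v w l m n : linear (fun u => Phi (tr YV Y u v w) l m n).
Proof.
move=> c u u'; have [N [b b']] := tr_bnd2 u v w u' v w.
by apply: (Phi_lincomb l m n b b') => x y /=; rewrite ?lY.2 ?lV.2 ?lY.1 ?lY.2.
Qed.

Lemma Phi_tr_linear2 u w l m n : linear (fun v => Phi (tr YV Y u v w) l m n).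
Proof.
move=> c v v'; have [N [b b']] := tr_bnd2 u v w u v' w.
apply: (Phi_lincomb l m n b b') => x y /=; first by rewrite lY.2 lY.1.
  by rewrite lY.2.
by rewrite lV.1 lY.2.
Qed.

Lemma Phi_tr_linear3 u v l m n : linear (fun w => Phi (tr YV Y u v w) l m n).
Proof.
move=> c w w'; have [N [b b']] := tr_bnd2 u v w u v w'.
apply: (Phi_lincomb l m n b b') => x y /=; first by rewrite !lY.1.
  by rewrite !lY.1.
by rewrite lY.1.
Qed.

Lemma subspace_ker (f : V -> W) : linear f -> subspace [set v | f v = 0].
Proof.
move=> lf; split=> [|x y /= ex ey|c x /= ex]; first exact: (lin0 lf).
  by rewrite (linD lf) ex ey addr0.
by rewrite (linZ lf) ex scaler0.
Qed.

(* Locality: both expansions of [(x1 - x2)^N F(x1, x2)] agree for [N >= 0]. *)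
Lemma bt_locality (N : nat) (F : int -> int -> W) n m :
  bt (-1) N F n m = (-1) ^ N%:Z *: bt (-1) N (fun x y => F y x) m n.
Proof.
have E (G : int -> int -> W) x y : bt (-1) N%:Z G x y = \sum_(0 <= i < N.+1)
    ((-1) ^+ i * binz N%:Z i) *: G (x + i%:Z) (y + N%:Z - i%:Z).
  by apply: nsumE => i iN; rewrite binz_nat_small ?mulr0 ?scale0r.
rewrite !E scaler_sumr [RHS]big_nat_rev /= add0n; apply: eq_big_nat => i /andP[_ iN].
rewrite subSS scalerA !binz_nat bin_sub //.
have -> : m + (N - i)%N%:Z = m + N%:Z - i%:Z by lia.
have -> : n + N%:Z - (N - i)%N%:Z = n + i%:Z by lia.
congr (_ *: _); rewrite mulrA; congr (_ * _).
rewrite -exprnP -exprD; have -> : (N + (N - i) = i + 2 * (N - i))%N by lia.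
by rewrite exprD exprM sqrrN expr1n expr1n mulr1.
Qed.

(** The Leibniz rule for the derivative in x2 of (x2 + s x1)^p f; [bt_dx] is the one in x1. *)
Lemma bt_dy N s p (f : int -> int -> W) x y : bnd N f ->
  bt s p (fun x y => (- y)%:~R *: f x (y - 1)) x y
  = (- y)%:~R *: bt s p f x (y - 1) + (- p)%:~R *: bt s (p - 1) f x y.
Proof.
move=> bf; have NM : N <= x + (absz (N - x)%R)%:Z by lia.
rewrite (btE _ _ _ bf NM) (btE _ _ _ bf NM) (btE (N := N) _ _ _ _ NM); last first.
  by move=> x' y' ?; rewrite bf ?scaler0.
rewrite !scaler_sumr -big_split; apply: eq_bigr => i _ /=.
have -> : y + p - i%:Z - 1 = y - 1 + p - i%:Z by lia.
have -> : y + (p - 1) - i%:Z = y - 1 + p - i%:Z by lia.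
rewrite !scalerA -scalerDl; congr (_ *: _).
have -> : (- (y + p - i%:Z))%:~R = (- y)%:~R - (p - i%:Z)%:~R :> K.
  by rewrite -intrB; congr (_%:~R); lia.
transitivity ((- y)%:~R * (s ^+ i * binz p i) - s ^+ i * ((p - i%:Z)%:~R * binz p i)).
  by ring.
by rewrite binz_sub mulrNz; ring.
Qed.

Lemma bt_dx N s p (f : int -> int -> W) x y : bnd N f ->
  bt s p (fun x y => (- x)%:~R *: f (x - 1) y) x y
  = (- x)%:~R *: bt s p f (x - 1) y - (s * p%:~R) *: bt s (p - 1) f x y.
Proof.
move=> bf; pose M := absz (N - x)%R; have NM : N <= x + M%:Z by lia.
have NM1 : N <= x - 1 + M.+1%:Z by lia.
have bf' : bnd (N + 1) (fun x y => (- x)%:~R *: f (x - 1) y).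
  by move=> x' y' ?; rewrite bf ?scaler0 //; lia.
have NM' : N + 1 <= x + M.+1%:Z by lia.
rewrite (btE _ _ _ bf NM1) (btE _ _ _ bf NM) (btE _ _ _ bf' NM').
rewrite [X in _ - X](_ : _ = \sum_(0 <= i < M.+1) (s ^+ i * (i%:R * binz p i)) *:
    f (x - 1 + i%:Z) (y + p - i%:Z)).
  rewrite scaler_sumr -sumrB; apply: eq_bigr => i _.
  have -> : x + i%:Z - 1 = x - 1 + i%:Z by lia.
  rewrite !scalerA -scalerBl; congr (_ *: _); rewrite !mulrNz intrD.
  by rewrite -[i%:R]/(i%:Z%:~R); ring.
rewrite scaler_sumr [RHS]big_ltn //= mul0r mulr0 scale0r add0r big_add1 /=.
symmetry; apply: eq_bigr => i _; rewrite scalerA binz_absorb.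
have -> : x - 1 + i.+1%:Z = x + i%:Z by lia.
have -> : y + p - i.+1%:Z = y + (p - 1) - i%:Z by lia.
by congr (_ *: _); rewrite exprS; ring.
Qed.

(** T' belongs to the derivative of the first field, hence to d/dx1 on products and d/dx0 on
    iterates. By the Leibniz rule both become d/dx0 + d/dx1 of the Jacobi coefficients. *)
Lemma Phi_derivative N (T T' : @trip K W) l m n : tbnd N T ->
  (forall x y, ta T' x y = (- y)%:~R *: ta T x (y - 1)) ->
  (forall x y, tb T' x y = (- x)%:~R *: tb T (x - 1) y) ->
  (forall x y, tc T' x y = (- x)%:~R *: tc T (x - 1) y) ->
  Phi T' l m n = (- m)%:~R *: Phi T l (m - 1) n + (- l)%:~R *: Phi T (l - 1) m n.
Proof.
move=> [ba bb bc] ea eb ec; pose T'' := Trip (fun x y => (- y)%:~R *: ta T x (y - 1))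
  (fun x y => (- x)%:~R *: tb T (x - 1) y) (fun x y => (- x)%:~R *: tc T (x - 1) y).
rewrite (Phi_eq (T2 := T'')) // /Phi /= (bt_dy _ _ _ _ ba) (bt_dx _ _ _ _ bb) (bt_dx _ _ _ _ bc).
have -> : (-1 : K) ^ (l - 1) = - (-1) ^ l.
  by rewrite expfzDr ?N1_neq0 // N1_opp expr1z mulrN1.
move: (bt (-1) l (ta T) n (m - 1)) (bt (-1) (l - 1) (ta T) n m) => A1 A2.
move: (bt (-1) l (tb T) (m - 1) n) (bt (-1) (l - 1) (tb T) m n) => B1 B2.
move: (bt 1 m (tc T) (l - 1) n) (bt 1 (m - 1) (tc T) l n) => C1 C2.
rewrite !scalerBr !scalerA !opprB.
have -> : (-1) ^ l * (-1 * l%:~R) = - ((- l)%:~R * - (-1) ^ l) :> K by rewrite mulrNz; ring.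
have -> : 1 * m%:~R = - (- m)%:~R :> K by rewrite mulrNz; ring.
by rewrite [(-1) ^ l * _]mulrC !scaleNr [LHS](AC (2*2*2) ((1*4*5)*(2*3*6))).
Qed.

End TripleLinear.

Lemma dsumU_linear (K : fieldType) (I : choiceType) (V : lmodType K) (i : I) :
  linear (fun x : V => << x *g i >> : dsum I V).
Proof.
move=> c x y; apply/malgP => k; rewrite mcoeffD dsumZE !mcoeffU.
by rewrite mulrnDl scalerMnr.
Qed.

Lemma linear_subZ (K : fieldType) (V W : lmodType K) (f g : V -> W) (d : K) :
  linear f -> linear g -> linear (fun z => f z - d *: g z).
Proof.
move=> lf lg c x y; rewrite lf lg scalerDr scalerBr !scalerA [c * d]mulrC.
by rewrite opprD addrACA.
Qed.

Lemma linear_comp (K : fieldType) (U V W : lmodType K) (f : V -> W) (g : U -> V) :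
  linear f -> linear g -> linear (fun z => f (g z)).
Proof. by move=> lf lg c x y; rewrite lg lf. Qed.

(** * The Jacobi identity on C[L] (x) U *)

Section DirectSumVL.
Context {K : numFieldType} {h : lmodType K} (L : zmodClosed h) {U : lmodType K}.

Lemma exp_tensor_linear (a : lattice L) : linear (@exp_tensor K h L U a).
Proof.
exact: (@dsumU_linear K (lattice L) U a).
Qed.

Lemma VL_ind (S : set (VL L U)) : subspace S -> (forall a w, S (exp_tensor a w)) ->
  forall x, S x.
Proof.
move=> [S0 SD SZ] Se x; rewrite [x]monalgE.
by elim/big_ind: _ => // a _; apply: Se.
Qed.

End DirectSumVL.

Section LatticeFields.
Context {K : numFieldType} {h : lmodType K} (form : h -> h -> K).
Context (formC : forall x y, form x y = form y x).
Context (formL : forall c x y z, form (c *: x + y) z = c * form x z + form y z).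
Context (L : zmodClosed h) (eps : lattice L -> lattice L -> K).
Local Notation pr := (@pairing K h form L).
Context (prE : forall a b, form (val a) (val b) = (pr a b)%:~R).
Context (EC : is_cocycle form eps).
Context {V : lmodType K} (act : heis h -> V -> V) (VC : condition_C form L act).
Context (vac : V) (act_vac : forall u n, 0 <= n -> act (mode u n) vac = 0).
Context (act0 : forall u v, act (mode u 0) v = 0).
Context (V_ind : forall S : set V, subspace S -> S vac ->
  (forall u n v, S v -> S (act (mode u n) v)) -> forall v, S v).
Implicit Types (a b c : lattice L) (u : h).

(* [VV] and [UU] stand for C[L] (x) V and C[L] (x) U. *)
Context {VV : lmodType K} (eV : lattice L -> V -> VV).

(** The Jacobi identity involves the fields on C[L] (x) M(1) and those on C[L] (x) U; both are
    instances of this record. [lf_YL] prescribes the fields on eigenvectors of a(0), which suffices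
    by [lf_ind] and semisimplicity. *)
Record lattice_fields (U : lmodType K) (rho : heis h -> U -> U)
    (YU : V -> int -> U -> U) (UU : lmodType K) (eU : lattice L -> U -> UU)
    (YL : VV -> int -> UU -> UU) : Prop := {
  lf_C : condition_C form L rho;
  lf_lY : linear_fields YU;
  lf_tY : truncated YU;
  lf_vac : forall n w, YU vac n w = if n == - 1 then w else 0;
  lf_gen : forall u n w, YU (act (mode u (- 1)) vac) n w = rho (mode u n) w;
  lf_theis : forall u v w l m n, Phi (theis rho act YU u v w) l m n = 0;
  lf_le : forall a, linear (eU a);
  lf_ind : forall S : set UU, subspace S -> (forall a w, S (eU a w)) -> forall x, S x;
  lf_lL : linear_fields YL;
  lf_tL : truncated YL;
  lf_YL : forall a b v mu w n, eigen rho a mu w ->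
    YL (eV a v) n (eU b w) = eU (a + b) (eps a b *:
      ESum rho a (YWfam rho act YU a b v w) (n + pr a b + mu)) }.

Lemma prD a b c : pr (a + b) c = pr a c + pr b c.
Proof. by apply: (@intr_inj K); rewrite intrD -!prE raddfD (formD formL). Qed.

Lemma prC a b : pr a b = pr b a.
Proof. by apply: (@intr_inj K); rewrite -!prE formC. Qed.

Lemma prDr a b c : pr a (b + c) = pr a b + pr a c.
Proof. by rewrite prC prD !(prC a). Qed.

Lemma pr0 b : pr 0 b = 0.
Proof. by apply: (@intr_inj K); rewrite -prE raddf0 (form0l formL). Qed.

Lemma eps0l a : eps 0 a = 1. Proof. by case: EC => _ /(_ a) []. Qed.

Lemma eps_swap a b : eps a b = (-1) ^ pr a b * eps b a.
Proof.
case: EC => e0 _ _ /(_ a b) <-; rewrite -mulrA mulVf ?mulr1 //; exact: e0.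
Qed.

Lemma eps_assoc a b c : eps a (b + c) * eps b c = eps (a + b) c * eps a b.
Proof. by case: EC. Qed.

Definition gen u := eV 0 (act (mode u (- 1)) vac).
Definition evac a := eV a vac.

Section OneModule.
Context {U : lmodType K} {rho : heis h -> U -> U} {YU : V -> int -> U -> U}.
Context {UU : lmodType K} {eU : lattice L -> U -> UU} {YL : VV -> int -> UU -> UU}.
Context (LF : lattice_fields rho YU eU YL).

Let UC := lf_C LF.
Let hm : is_heis_module form rho. Proof. by case: UC. Qed.
Let hl : has_level rho 1. Proof. by case: UC. Qed.
Let le := lf_le LF.

Lemma eigen0 w : eigen rho (0 : lattice L) 0 w.
Proof. by rewrite /eigen raddf0 (lin0 (rho_mode_lin hm _ _)) scale0r. Qed.

Lemma YL_gen u b m w : YL (gen u) m (eU b w) =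
  eU b (rho (mode u m) w + (if m == 0 then form u (val b) else 0) *: w).
Proof.
rewrite (lf_YL LF _ _ _ (eigen0 w)) add0r eps0l scale1r pr0 !addr0.
by rewrite (ESum_gen0 formC formL UC VC (lf_lY LF) act_vac (lf_vac LF) (lf_gen LF)).
Qed.

Lemma YL_evac a b n mu w : eigen rho a mu w -> YL (evac a) n (eU b w) =
  eU (a + b) (eps a b *: X rho (val a) (n + pr a b + mu) w).
Proof.
move=> Ew; rewrite (lf_YL LF _ _ _ Ew).
by rewrite (ESum_vac formC formL UC VC (lf_lY LF) act_vac (lf_vac LF)).
Qed.

(** With n' = n + p + mu, [X_derivative] gives mu - n' and the vacuum term of Dbar(b, x) a(-1)vac
    gives p = <a,b>; these add up to - n. *)
Lemma YL_derivative a n z :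
  YL (eV a (act (mode (val a) (- 1)) vac)) n z = (- n)%:~R *: YL (evac a) (n - 1) z.
Proof.
have lL := lf_lL LF; pose D z := YL (eV a (act (mode (val a) (- 1)) vac)) n z
  - (- n)%:~R *: YL (evac a) (n - 1) z.
have lD : linear D by apply: linear_subZ; apply: lL.1.
suff D0 : D z = 0 by apply/eqP; rewrite -subr_eq0; apply/eqP.
apply: (lf_ind LF (S := [set z | D z = 0])) z; first exact: (subspace_ker lD).
move=> b; apply: (C_eigen_ind UC (a := a)) => [|mu w Ew] /=.
  exact: (subspace_ker (linear_comp lD (le b))).
rewrite /D (YL_evac _ _ Ew) (lf_YL LF _ _ _ Ew).
rewrite (ESum_gen_split formC formL UC VC (lf_lY LF) act_vac (lf_vac LF) (lf_gen LF)).
rewrite (X_derivative formC formL UC (n + pr a b + mu) Ew) prE -scalerDl -intrD.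
have -> : n + pr a b + mu - 1 = n - 1 + pr a b + mu by lia.
have -> : mu - (n + pr a b + mu) + pr a b = - n by lia.
by rewrite -(linZ (le _)) !scalerA [_%:~R * _]mulrC subrr.
Qed.

End OneModule.

Section Jacobi.
Context {YM : V -> int -> V -> V} {YV : VV -> int -> VV -> VV}.
Context (LV : lattice_fields act YM eV YV).
Context {U : lmodType K} {rho : heis h -> U -> U} {YU : V -> int -> U -> U}.
Context {UU : lmodType K} {eU : lattice L -> U -> UU} {YL : VV -> int -> UU -> UU}.
Context (LF : lattice_fields rho YU eU YL).

Let UC := lf_C LF.
Let hm : is_heis_module form rho. Proof. by case: UC. Qed.
Let hl : has_level rho 1. Proof. by case: UC. Qed.
Let lV := lf_lL LV.
Let lU := lf_lL LF.
Let tV := lf_tL LV.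
Let tU := lf_tL LF.

Lemma eigenV a v : eigen act a 0 v.
Proof. by rewrite /eigen act0 scale0r. Qed.

Lemma eigen_lincomb a mu (d : K) w w' : eigen rho a mu w -> eigen rho a mu w' ->
  eigen rho a mu (w + d *: w').
Proof.
move=> E E'; rewrite /eigen (linD (rho_lin hm _)) (linZ (rho_lin hm _)) E E'.
by rewrite scalerDr !scalerA mulrC.
Qed.

Lemma Phi_gen u x z l m n : Phi (tr YV YL (gen u) x z) l m n = 0.
Proof.
apply: (lf_ind LV (S := [set x | Phi (tr YV YL (gen u) x z) l m n = 0])) x.
  exact: (subspace_ker (Phi_tr_linear2 lV lU tV tU (gen u) z l m n)).
move=> a v; apply: (lf_ind LF (S := [set z | Phi (tr YV YL (gen u) (eV a v) z) l m n = 0])) z.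
  exact: (subspace_ker (Phi_tr_linear3 lU tV tU (gen u) (eV a v) l m n)).
move=> b; apply: (C_eigen_ind UC (a := a)) => [|mu w Ew] /=.
  exact: (subspace_ker (linear_comp (Phi_tr_linear3 lU tV tU (gen u) (eV a v) l m n) (lf_le LF b))).
set d := pr a b + mu; pose G z := eU (a + b) (eps a b *: z).
have lG : linear G by apply: (linear_comp (lf_le LF _)); apply: linear_scale.
pose T := tHeis form rho act YU u a b v w.
have jT : forall l m n, Phi T l m n = 0.
  move=> l' m' n'; exact: (Phi_tHeis formC formL UC VC (lf_lY LF) (lf_tY LF) (lf_theis LF)).
(* The powers x2^<a,b> and x2^mu together are the factor x2^d, and the cocycle and e^(a+b) are
   absorbed in G. *)
rewrite (@Phi_eq _ _ _ (top G (tx2 d T))).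
- have [N bT] := tHeis_bnd formC formL UC VC (lf_lY LF) (lf_tY LF) u a b v w.
  by rewrite (Phi_op _ _ _ (tbnd_x2 d bT) lG) Phi_x2 jT (lin0 lG).
- move=> n' m' /=; rewrite (lf_YL LF _ _ _ Ew) (YL_gen LF) (linZ (rho_lin hm _)).
  rewrite -addrA -/d raddfD (formDr formC formL) scalerA mulrC -scalerA -scalerDr.
  reflexivity.
- move=> m' n' /=; rewrite (YL_gen LF) (lf_YL LF _ _ _ (mu := mu)); first by rewrite -addrA.
  by apply: eigen_lincomb => //; apply: (eigen_mode formC formL UC).
- move=> l' n' /=; rewrite (YL_gen LV) (lf_YL LF _ _ _ Ew) -addrA.
  reflexivity.
Qed.

End Jacobi.

Section JacobiVacuum.
Context {YM : V -> int -> V -> V} {YV : VV -> int -> VV -> VV}.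
Context (LV : lattice_fields act YM eV YV).
Context {U : lmodType K} {rho : heis h -> U -> U} {YU : V -> int -> U -> U}.
Context {UU : lmodType K} {eU : lattice L -> U -> UU} {YL : VV -> int -> UU -> UU}.
Context (LF : lattice_fields rho YU eU YL).

Let UC := lf_C LF.
Let hm : is_heis_module form rho. Proof. by case: UC. Qed.
Let hl : has_level rho 1. Proof. by case: UC. Qed.
Let lV := lf_lL LV.
Let lU := lf_lL LF.
Let tV := lf_tL LV.
Let tU := lf_tL LF.

Lemma YV_gen_evac u (j : nat) b : YV (gen u) j%:Z (evac b) =
  (if j == 0%N then form u (val b) else 0) *: evac b.
Proof. by rewrite /evac (YL_gen LV) act_vac // add0r (linZ (lf_le LV _)). Qed.

Lemma eigen_X a mu b n w : eigen rho a mu w -> eigen rho a mu (X rho (val b) n w).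
Proof.
move=> Ew; have [Q QP] := C_EP_finite formC formL UC b w.
rewrite /eigen (XE UC _ QP) (lin_sum (rho_lin hm _)) scaler_sumr.
apply: eq_bigr => q _.
exact: (eigen_EM formC formL UC _ _ (eigen_EP formC formL UC _ _ Ew)).
Qed.

Lemma X_linear a n : linear (X rho (val a) n).
Proof.
move=> d x y; have [Q QP] := C_EP_finite formC formL UC a x.
have [Q' QP'] := C_EP_finite formC formL UC a y.
have P1 (q : int) : (Q + Q')%N%:Z <= q -> EP rho (val a) q x = 0 by move=> ?; apply: QP; lia.
have P2 (q : int) : (Q + Q')%N%:Z <= q -> EP rho (val a) q y = 0 by move=> ?; apply: QP'; lia.
have P3 (q : int) : (Q + Q')%N%:Z <= q -> EP rho (val a) q (d *: x + y) = 0.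
  by move=> qQ; rewrite (EP_linear hm) P1 ?P2 // scaler0 addr0.
rewrite (XE UC _ P1) (XE UC _ P2) (XE UC _ P3) scaler_sumr -big_split.
by apply: eq_bigr => q _ /=; rewrite (EP_linear hm) (EM_linear hm).
Qed.

Let Mm : is_heis_module form act. Proof. by case: VC. Qed.
Let Ml : has_level act 1. Proof. by case: VC. Qed.

Lemma X_vac a n : X act (val a) n vac = EM act (val a) (- 1 - n) vac.
Proof.
rewrite /X (fsum1 (i0 := 0)) => [|q q0].
  by rewrite EP0 sub0r.
rewrite (EP_vac formC formL VC act_vac) (negPf q0).
exact: (lin0 (EM_linear Mm _ _)).
Qed.

(** The iterate side vanishes for l >= - p and has a single term for l = - p - 1, since (e^a)_x e^b
    begins at x = - p - 1 with a multiple of e^(a+b). *)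
Lemma Phi_evac_eigen a b c ma mb w l m n : eigen rho a ma w -> eigen rho b mb w ->
  - pr a b - 1 <= l -> Phi (tr YV YL (evac a) (evac b) (eU c w)) l m n = 0.
Proof.
move=> Ea Eb pl; set T := tr _ _ _ _ _; set p := pr a b in pl.
pose ka := pr a c + ma; pose kb := pr b c + mb.
pose F n m := XX rho (val a) (val b) w (n + kb) (m + ka).
pose e := eps a (b + c) * eps b c.
pose G z := eU (a + (b + c)) (e *: z).
have lG : linear G by apply: (linear_comp (lf_le LF _)); apply: linear_scale.
have [N bX] := XX_bnd formC formL UC a b w.
have [N' bX'] := XX_bnd formC formL UC b a w.
have XXs := XX_sym formC formL UC a b w.
(* Only the product sides are of the form (x1 - x2)^p F; the third entry is a placeholder, and the
   iterate side is treated separately. *)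
pose T1 := Trip F (fun x y => F y x) (fun _ _ => 0).
have bT1 : tbnd (`|N| + `|N'| + `|ka| + `|kb|) T1.
  split=> x y Nx //=; rewrite /F; first by rewrite bX //; lia.
  by rewrite XXs bX' //; lia.
have bT2 := tbnd_diff p bT1.
have eps2 : eps b a = (-1) ^ p * eps a b by rewrite eps_swap prC.
have Ta x y : ta T x y = G (bt (-1) p F x y).
  rewrite /T /= (YL_evac LF _ _ Eb).
  rewrite (YL_evac LF _ _ (_ : eigen rho a ma _)); last first.
    by rewrite -[_ *: _]add0r; apply: (eigen_lincomb LF); [rewrite /eigen (lin0 (rho_lin hm _)) scaler0|exact: eigen_X].
  rewrite (linZ (X_linear _ _)) scalerA -/e /G; congr (eU _ (_ *: _)).
  rewrite prDr; have -> : y + (p + pr a c) + ma = y + ka + p by rewrite /ka; lia.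
  have -> : x + pr b c + mb = x + kb by rewrite /kb; lia.
  rewrite (X_X formC formL UC _ _ _ (prE a b)) -bt_shift //.
have Tb x y : tb T x y = G ((-1) ^ p *: bt (-1) p (fun x y => F y x) x y).
  rewrite /T /= (YL_evac LF _ _ Ea).
  rewrite (YL_evac LF _ _ (_ : eigen rho b mb _)); last first.
    by rewrite -[_ *: _]add0r; apply: (eigen_lincomb LF); [rewrite /eigen (lin0 (rho_lin hm _)) scaler0|exact: eigen_X].
  rewrite (linZ (X_linear _ _)) !scalerA /G scalerA.
  have -> : b + (a + c) = a + (b + c) by rewrite addrCA.
  (* The cocycle identity brings both products to the factor eps (a + b) c; the sign is the one
     between (x1 - x2)^p and (x2 - x1)^p. *)
  have -> : eps b (a + c) * eps a c = e * (-1) ^ p.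
    by rewrite /e !eps_assoc eps2 [b + a]addrC; ring.
  congr (eU _ (_ *: _)); rewrite prDr [pr b a]prC.
  have -> : y + (pr a b + pr b c) + mb = y + kb + p by rewrite /kb /p; lia.
  have -> : x + pr a c + ma = x + ka by rewrite /ka; lia.
  have pE : form (val b) (val a) = p%:~R by rewrite formC prE.
  rewrite (X_X formC formL UC _ _ _ pE) -bt_shift; apply: bt_eq => i.
  by rewrite /F XXs.
have T12 : Phi T l m n = G (Phi T1 (l + p) m n) - bt 1 m (tc T) l n.
  rewrite -(Phi_diff _ _ _ _ bT1) -(Phi_op _ _ _ bT2 lG) /Phi /=.
  have -> : bt 1 m (fun _ _ : int => G 0) l n = 0.
    by apply: fsum0 => i; rewrite (lin0 lG) scaler0.
  rewrite subr0; congr (_ - _ *: _ - _); apply: bt_eq => i; [exact: Ta|exact: Tb].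
have Tc x y : tc T x y = YL (eV (a + b) (eps a b *: EM act (val a) (- 1 - (x + p)) vac)) y (eU c w).
  by rewrite /T /= (YL_evac LV _ _ (eigenV a vac)) addr0 X_vac.
have Tc0 x y : - p <= x -> tc T x y = 0.
  by move=> xp; rewrite Tc EM_neg ?scaler0 ?(lin0 (lf_le LV _)) ?(lin0 (lU.2 _ _)) //; lia.
rewrite T12; have [lp|lp] := leP 0 (l + p).
  have -> : bt 1 m (tc T) l n = 0.
    by apply: fsum0 => i; rewrite Tc0 ?scaler0 //; lia.
  rewrite subr0 /Phi /= -[l + p]gez0_abs // bt_locality subrr sub0r.
  have -> : bt 1 m (fun _ _ : int => 0 : U) (absz (l + p)) n = 0.
    by apply: fsum0 => i; rewrite scaler0.
  by rewrite oppr0 (lin0 lG).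
have lE : l = - 1 - p by lia.
have -> : bt 1 m (tc T) l n = tc T (- 1 - p) (n + m).
  rewrite /bt (fsum1 (i0 := 0%N)) => [|i i0].
    by rewrite expr0 binz0 mul1r scale1r; congr (tc T _ _); lia.
  by rewrite Tc0 ?scaler0 // lE; lia.
have -> : Phi T1 (l + p) m n = X rho (val a + val b) (n + kb + (m + ka)) w.
  rewrite lE; have -> : - 1 - p + p = - 1 by lia.
  rewrite /Phi /= N1_opp expr1z scaleN1r opprK.
  have -> : bt 1 m (fun _ _ : int => 0 : U) (- 1) n = 0.
    by apply: fsum0 => i; rewrite scaler0.
  rewrite subr0 -(XX_diagonal formC formL UC a b w (n + kb) (m + ka)) -!bt_shift.
  congr (_ + _); apply: bt_eq => i; rewrite /F XXs; congr (XX _ _ _ _ _ _); lia.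
rewrite Tc; have -> : - 1 - (- 1 - p + p) = 0 by lia.
rewrite EM0 (linZ (lf_le LV _)) (linZ (lU.2 _ _)).
have Eab : eigen rho (a + b) (ma + mb) w.
  by rewrite /eigen raddfD (linD (rho_mode_lin hm _ _)) Ea Eb intrD scalerDl.
rewrite (YL_evac LF _ _ Eab) -(linZ (lf_le LF _)) scalerA /G raddfD prD -addrA.
have -> : n + m + (pr a c + pr b c) + (ma + mb) = n + kb + (m + ka) by rewrite /ka /kb; lia.
have -> : a + (b + c) = a + b + c by rewrite addrA.
rewrite /e eps_assoc [eps a b * _]mulrC [n + (kb + _)]addrA; exact: subrr.
Qed.

Lemma Phi_evac_high a b z l m n : - pr a b - 1 <= l ->
  Phi (tr YV YL (evac a) (evac b) z) l m n = 0.
Proof.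
move=> pl; have lT := Phi_tr_linear3 lU tV tU (evac a) (evac b) l m n.
apply: (lf_ind LF (S := [set z | Phi (tr YV YL (evac a) (evac b) z) l m n = 0])) z.
  exact: (subspace_ker lT).
move=> c; apply: (eigen_ind2 (rho_lin hm (mode (val a) 0)) (rho_lin hm (mode (val b) 0))).
- by move=> z; rewrite (mode_comm formC formL hm hl) addr0 eqxx mul0r scale0r addr0.
- exact: (C_semisimple UC).
- exact: (C_integer UC).
- exact: (C_semisimple UC).
- exact: (C_integer UC).
- exact: (subspace_ker (linear_comp lT (lf_le LF c))).
- by move=> ma mb w Ea Eb; apply: Phi_evac_eigen Ea Eb pl.
Qed.

Lemma Phi_evac a b z l m n : Phi (tr YV YL (evac a) (evac b) z) l m n = 0.
Proof.
have [pl|pl] := leP (- pr a b - 1) l; first exact: Phi_evac_high.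
suff {l pl m n z} H (k : nat) m n z :
    Phi (tr YV YL (evac a) (evac b) z) (- pr a b - 1 - k%:Z) m n = 0.
  have -> : l = - pr a b - 1 - (absz (- pr a b - 1 - l)%R)%:Z by lia.
  exact: H.
elim: k m n z => [|k IHk] m n z; first by apply: Phi_evac_high; lia.
set l := - pr a b - 1 - k%:Z in IHk.
have -> : - pr a b - 1 - k.+1%:Z = l - 1 by rewrite /l; lia.
have [G PG'] := vanish_nat tU (gen (val a)) z 0.
have PG (i : nat) : (G <= i)%N -> YL (gen (val a)) i%:Z z = 0.
  by move=> Gi; apply: PG' Gi _ _; rewrite add0r.
(* Only j = 0 survives, with a(0) e^b = p e^b, and its term involves l + (- 1 - 0) = l - 1. All
   other terms are at l and vanish by induction. *)
have PJ (j : nat) : (1 <= j)%N -> YV (gen (val a)) j%:Z (evac b) = 0.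
  by move=> j1; rewrite YV_gen_evac; case: eqP j1 => [->|_ _] //; rewrite scale0r.
have jV v w l' m' n' : Phi (tr YV YV (gen (val a)) v w) l' m' n' = 0.
  exact: (Phi_gen LV LV).
have [I0 PI] := Phi_iterate_left lV lU tV tU jV (Phi_gen LV LF (val a)) (evac a) (-1) l m n PG PJ.
move: {PI}(PI I0 (leqnn _)).
rewrite big_nat1 binz0 expr0 mul1r scale1r YV_gen_evac eqxx prE.
rewrite (linZ (Phi_tr_linear2 lV lU tV tU _ _ _ _ _)).
rewrite (sum_nat0 (m := 0) (n := I0)) => [|i _]; last first.
  by rewrite IHk (lin0 (lU.1 _ _)) scaler0.
rewrite (sum_nat0 (m := 0) (n := G)) => [|i _]; last by rewrite IHk scaler0.
rewrite scaler0 subr0 add0r -[(-1) ^ (-1)]/((-1)^-1) invrN1 scaleN1r opprK subr0.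
have -> : YV (gen (val a)) (- 1) (evac a) = eV a (act (mode (val a) (- 1)) vac).
  by rewrite /evac (YL_gen LV) scale0r addr0.
have [N bT] := tr_bnd lU tV tU (evac a) (evac b) z.
rewrite (Phi_derivative l m n bT) /=.
(* The coefficient is - l - p = 1 + k, which is nonzero. *)
- rewrite IHk scaler0 add0r => /eqP; rewrite -subr_eq0 -scalerBl -intrB scaler_eq0.
  by case/orP => [|/eqP //]; rewrite intr_eq0 /l => /eqP; lia.
- by move=> x y; rewrite (YL_derivative LF).
- by move=> x y; rewrite (YL_derivative LF) (linZ (lU.1 _ _)).
- by move=> x y; rewrite (YL_derivative LV) (linZ (lU.2 _ _)).
Qed.

Lemma eV_mode a u k v : eV a (act (mode u k) v) =
  YV (gen u) k (eV a v) - (if k == 0 then form u (val a) else 0) *: eV a v.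
Proof. by rewrite (YL_gen LV) (linD (lf_le LV _)) (linZ (lf_le LV _)) addrK. Qed.

Lemma vanish_nat0 x z : exists G : nat, forall i : nat, (G <= i)%N -> YL x i%:Z z = 0.
Proof.
have [G PG] := vanish_nat tU x z 0; exists G => i Gi.
by apply: PG Gi _ _; rewrite add0r.
Qed.

(** In the induction on v the state z is replaced by g_i z and is therefore quantified inside,
    whereas g_j only rescales e^b (x) vac for j >= 0. *)
Lemma Phi_eV_evac a b v z l m n : Phi (tr YV YL (eV a v) (evac b) z) l m n = 0.
Proof.
pose S := [set v | forall l m n z, Phi (tr YV YL (eV a v) (evac b) z) l m n = 0].
suff: S v by apply.
have lT l' m' n' z' := linear_comp (Phi_tr_linear1 lV lU tV tU (evac b) z' l' m' n') (lf_le LV a).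
apply: V_ind; first split=> [l' m' n' z'|x y Sx Sy l' m' n' z'|c x Sx l' m' n' z'].
- exact: (lin0 (lT l' m' n' z')).
- by rewrite [LHS](linD (lT l' m' n' z')) Sx Sy addr0.
- by rewrite [LHS](linZ (lT l' m' n' z')) Sx scaler0.
- by move=> l' m' n' z'; apply: Phi_evac.
move=> u k {}v Sv {}l {}m {}n {}z.
rewrite eV_mode -scaleNr addrC.
rewrite [LHS](Phi_tr_linear1 lV lU tV tU (evac b) z l m n) Sv scaler0 add0r.
have [G PG] := vanish_nat0 (gen u) z.
have PJ (j : nat) : (1 <= j)%N -> YV (gen u) j%:Z (evac b) = 0.
  by move=> j1; rewrite YV_gen_evac; case: eqP j1 => [->|_ _] //; rewrite scale0r.
have [I0 PI] := Phi_iterate_left lV lU tV tU (Phi_gen LV LV u) (Phi_gen LV LF u)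
  (eV a v) k l m n PG PJ.
rewrite (PI I0 (leqnn _)).
rewrite (sum_nat0 (m := 0) (n := I0)) => [|i _]; last first.
  by rewrite Sv (lin0 (lU.1 _ _)) scaler0.
rewrite (sum_nat0 (m := 0) (n := G)) => [|i _]; last by rewrite Sv scaler0.
rewrite (sum_nat0 (m := 0) (n := 1)) => [|i _]; last first.
  rewrite YV_gen_evac (linZ (Phi_tr_linear2 lV lU tV tU _ _ _ _ _)).
  by rewrite Sv !scaler0.
by rewrite !scaler0 !subr0.
Qed.

(** A mode in the second state also changes x into g_j x. Hence the first state has to be arbitrary
    before the induction on v starts. *)
Lemma Phi_eV b x v z l m n : Phi (tr YV YL x (eV b v) z) l m n = 0.
Proof.
pose S := [set v | forall l m n x z, Phi (tr YV YL x (eV b v) z) l m n = 0].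
suff: S v by apply.
have lT l' m' n' x' z' := linear_comp (Phi_tr_linear2 lV lU tV tU x' z' l' m' n') (lf_le LV b).
apply: V_ind; first split=> [l' m' n' x' z'|v1 v2 S1 S2 l' m' n' x' z'|c v1 S1 l' m' n' x' z'].
- exact: (lin0 (lT l' m' n' x' z')).
- by rewrite [LHS](linD (lT l' m' n' x' z')) S1 S2 addr0.
- by rewrite [LHS](linZ (lT l' m' n' x' z')) S1 scaler0.
- move=> l' m' n' x' z'.
  apply: (lf_ind LV (S := [set x | Phi (tr YV YL x (eV b vac) z') l' m' n' = 0])) x'.
    exact: (subspace_ker (Phi_tr_linear1 lV lU tV tU (eV b vac) z' l' m' n')).
  by move=> a v'; apply: Phi_eV_evac.
move=> u k {}v Sv {}l {}m {}n {}x {}z.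
rewrite eV_mode -scaleNr addrC.
rewrite [LHS](Phi_tr_linear2 lV lU tV tU x z l m n) Sv scaler0 add0r.
have [G PG] := vanish_nat0 (gen u) z.
have [J PJ'] := vanish_nat tV (gen u) x 0.
have PJ (j : nat) : (J <= j)%N -> YV (gen u) j%:Z x = 0.
  by move=> Jj; apply: PJ' Jj _ _; rewrite add0r.
have [I0 PI] := Phi_iterate_right lV lU tV tU (Phi_gen LV LV u) (Phi_gen LV LF u)
  (eV b v) k l m n PG PJ.
rewrite (PI I0 (leqnn _)).
rewrite (sum_nat0 (m := 0) (n := I0)) => [|i _]; last first.
  by rewrite Sv (lin0 (lU.1 _ _)) scaler0.
rewrite (sum_nat0 (m := 0) (n := G)) => [|i _]; last by rewrite Sv scaler0.
rewrite (sum_nat0 (m := 0) (n := J)) => [|i _]; last by rewrite Sv scaler0.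
by rewrite !scaler0 !subr0.
Qed.

Lemma lattice_jacobi : jacobi YV YL.
Proof.
move=> x y z l m n; apply/(jacobi_coefE lU tV tU).
apply: (lf_ind LV (S := [set y | Phi (tr YV YL x y z) l m n = 0])) y.
  exact: (subspace_ker (Phi_tr_linear2 lV lU tV tU x z l m n)).
by move=> b v; apply: Phi_eV.
Qed.

End JacobiVacuum.

End LatticeFields.

(** * The concrete fields *)

Section Convolution.
Context {K : fieldType} {h : lmodType K} {L : zmodClosed h} {V U W : lmodType K}.
Context (F : lattice L -> lattice L -> V -> U -> W).
Context (Fl : forall a b w, linear (fun v => F a b v w)).
Context (Fr : forall a b v, linear (F a b v)).

(** The shape of [YW] at a fixed n, with the coefficient as a parameter; bilinearity of the
    coefficients lets the supports be enlarged. *)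
Definition conv (x : VL L V) (y : VL L U) : VL L W :=
  \sum_(a <- msupp x) \sum_(b <- msupp y) exp_tensor (a + b) (F a b x@_a y@_b).

Lemma exp_tensor0 (a : lattice L) : exp_tensor a (0 : W) = 0.
Proof. by apply/malgP => k; rewrite mcoeffU mul0rn mcoeff0. Qed.

Lemma convEw (x : VL L V) (y : VL L U) (D1 D2 : {fset lattice L}) :
  (msupp x `<=` D1)%fset -> (msupp y `<=` D2)%fset ->
  conv x y = \sum_(a <- D1) \sum_(b <- D2) exp_tensor (a + b) (F a b x@_a y@_b).
Proof.
move=> xD yD; rewrite /conv (big_fset_incl _ xD) => [|a _ /mcoeff_outdom x0].
  apply: eq_bigr => a _; rewrite (big_fset_incl _ yD) => // b _ /mcoeff_outdom y0.
  by rewrite y0 (lin0 (Fr _ _ _)) exp_tensor0.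
by apply: big1 => b _; rewrite x0 (lin0 (Fl _ _ _)) exp_tensor0.
Qed.

Lemma conv_exp a b v w : conv (exp_tensor a v) (exp_tensor b w)
  = exp_tensor (a + b) (F a b v w).
Proof.
rewrite (@convEw _ _ [fset a]%fset [fset b]%fset) ?msuppU_le //.
by rewrite !big_seq_fset1 !mcoeffUU.
Qed.

End Convolution.

Section ConvolutionLinear.
Context {K : numFieldType} {h : lmodType K} {L : zmodClosed h} {V U W : lmodType K}.
Context (F : lattice L -> lattice L -> V -> U -> W).
Context (Fl : forall a b w, linear (fun v => F a b v w)).
Context (Fr : forall a b v, linear (F a b v)).

Lemma conv_linear_l y : linear (fun x => conv F x y).
Proof.
move=> c x x'; set D := (msupp x `|` msupp x' `|` msupp (c *: x + x'))%fset.
rewrite !(@convEw _ _ _ _ _ _ F Fl Fr _ y D (msupp y)) /D ?fsubset_refl //.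
- rewrite scaler_sumr -big_split /=; apply: eq_bigr => a _.
  rewrite scaler_sumr -big_split /=; apply: eq_bigr => b _.
  by rewrite mcoeffD dsumZE Fl exp_tensor_linear.
- by apply/fsubsetP=> s; rewrite !inE => ->; rewrite orbT.
- by apply/fsubsetP=> s; rewrite !inE => ->.
- by apply/fsubsetP=> s; rewrite !inE => ->; rewrite ?orbT.
Qed.

Lemma conv_linear_r x : linear (conv F x).
Proof.
move=> c y y'; set D := (msupp y `|` msupp y' `|` msupp (c *: y + y'))%fset.
rewrite !(@convEw _ _ _ _ _ _ F Fl Fr x _ (msupp x) D) /D ?fsubset_refl //.
- rewrite scaler_sumr -big_split /=; apply: eq_bigr => a _.
  rewrite scaler_sumr -big_split /=; apply: eq_bigr => b _.
  by rewrite mcoeffD dsumZE Fr exp_tensor_linear.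
- by apply/fsubsetP=> s; rewrite !inE => ->; rewrite orbT.
- by apply/fsubsetP=> s; rewrite !inE => ->.
- by apply/fsubsetP=> s; rewrite !inE => ->; rewrite ?orbT.
Qed.

End ConvolutionLinear.

Section LatticeModule.
Context {K : numFieldType} {h : lmodType K} (form : h -> h -> K).
Context (formC : forall x y, form x y = form y x).
Context (formL : forall c x y z, form (c *: x + y) z = c * form x z + form y z).
Context (L : zmodClosed h) (eps : lattice L -> lattice L -> K).
Context (YM : M1 form -> int -> M1 form -> M1 form).
Context (YM_va : is_vertex_algebra YM (M1_vac form)).
Context {U : lmodType K} (rho : heis h -> U -> U) (UC : condition_C form L rho).
Context (YU : M1 form -> int -> U -> U) (YU_mod : is_va_module YM (M1_vac form) YU).
Context (YM_modes : forall (u : h) (n : int) (v : M1 form),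
  YM (M1_incl form u) n v = M1_act (mode u n) v).
Context (YU_modes : forall (u : h) (n : int) (w : U),
  YU (M1_incl form u) n w = rho (mode u n) w).
Let lY : linear_fields YU. Proof. by case: YU_mod. Qed.
Let tY : truncated YU. Proof. by case: YU_mod. Qed.
Local Notation YWU := (YW eps rho YU).
Local Notation act := (@M1_act K h form).

Let cl n a b w : linear (fun v => eps a b *: YW_coef rho YU a b v n w).
Proof.
move=> c x y; rewrite (YW_coef_linear_v formC formL UC lY tY) scalerDr !scalerA.
by rewrite mulrC.
Qed.

Let cr n a b v : linear (fun w => eps a b *: YW_coef rho YU a b v n w).
Proof.
move=> c x y; rewrite (YW_coef_linear_w formC formL UC lY tY) scalerDr !scalerA.
by rewrite mulrC.
Qed.

Lemma YW_linear : linear_fields YWU.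
Proof.
split=> [x n|n y]; first exact: (conv_linear_r (cl n) (cr n) x).
exact: (conv_linear_l (cl n) (cr n) y).
Qed.

Lemma YW_exp a b v n w : YWU (exp_tensor a v) n (exp_tensor b w)
  = exp_tensor (a + b) (eps a b *: YW_coef rho YU a b v n w).
Proof. exact: (conv_exp (cl n) (cr n)). Qed.

Lemma YW_truncated : truncated YWU.
Proof.
have ly := YW_linear.
move=> x y; apply: (VL_ind (S := [set x | exists N : int, forall n, N <= n -> YWU x n y = 0])) x.
  split=> [|x x' [N xN] [N' xN']|c x [N xN]].
  - by exists 0 => n _; exact: (lin0 (ly.2 _ _)).
  - exists (`|N| + `|N'|) => n Nn; rewrite (linD (ly.2 _ _)) xN ?xN' ?addr0 //; lia.
  - by exists N => n Nn; rewrite (linZ (ly.2 _ _)) xN ?scaler0.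
move=> a v; apply: (VL_ind (S := [set y | exists N : int, forall n, N <= n ->
    YWU (exp_tensor a v) n y = 0])) y.
  split=> [|y y' [N yN] [N' yN']|c y [N yN]].
  - by exists 0 => n _; exact: (lin0 (ly.1 _ _)).
  - exists (`|N| + `|N'|) => n Nn; rewrite (linD (ly.1 _ _)) yN ?yN' ?addr0 //; lia.
  - by exists N => n Nn; rewrite (linZ (ly.1 _ _)) yN ?scaler0.
move=> b w; have [N PN] := YW_coef_trunc formC formL UC lY tY a b v w.
exists N => n Nn; rewrite YW_exp PN // scaler0; exact: exp_tensor0.
Qed.

Lemma Phi_theis_M1 u v w l m n : Phi (theis rho act YU u v w) l m n = 0.
Proof.
have [_ tM _ _ _] := YM_va; have [_ _ _ jU] := YU_mod.
rewrite (@Phi_eq _ _ _ (tr YM YU (M1_incl form u) v w)).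
- apply/(jacobi_coefE lY tM tY); exact: jU.
- by move=> x y /=; rewrite YU_modes.
- by move=> x y /=; rewrite YU_modes.
- by move=> x y /=; rewrite YM_modes.
Qed.

Lemma YW_lattice_fields :
  lattice_fields form eps act (M1_vac form) (@exp_tensor K h L (M1 form)) rho YU
    (@exp_tensor K h L U) YWU.
Proof.
have [_ _ vU _] := YU_mod.
apply: Build_lattice_fields => //.
- exact: Phi_theis_M1.
- exact: exp_tensor_linear.
- exact: VL_ind.
- exact: YW_linear.
- exact: YW_truncated.
- move=> a b v mu w n Ew; rewrite YW_exp.
  by rewrite (YW_coef_eigen formC formL UC YU b v n Ew).
Qed.

End LatticeModule.

Section HeisenbergFields.
Context {K : numFieldType} {h : lmodType K} (form : h -> h -> K).

(* An element of the Heisenberg algebra is a sum of modes and a multiple of the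
   central element, which acts as a scalar. *)
Lemma mode_stable (U : lmodType K) (rho : heis h -> U -> U) (S : set U) :
  is_heis_module form rho -> has_level rho 1 -> subspace S ->
  (forall u n v, S v -> S (rho (mode u n) v)) -> forall x v, S v -> S (rho x v).
Proof.
move=> hm hl [S0 SD SZ] Smode x v Sv.
have lx : linear (fun x : heis h => rho x v) by have [_ + _] := hm; apply.
pose md (x : dsum int h) : heis h := (x, 0).
have lmd : linear (fun x => rho (md x) v).
  move=> c y z; rewrite -lx; congr (rho _ v); congr (_, _).
  by rewrite /= scaler0 addr0.
have -> : rho x v = rho (md x.1) v + x.2 *: v.
  transitivity (rho (x.2 *: central + md x.1) v); last first.
    by rewrite lx hl scale1r addrC.
  congr (rho _ v); case: x => x1 x2 /=; congr (_, _).
    by rewrite /= scaler0 add0r.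
  by rewrite /= [_ *: _]mulr1 addr0.
apply: (SD); last exact: SZ.
rewrite [x.1]monalgE (lin_sum lmd).
by apply: (big_ind (fun z => S z)) => [|y z|n _]; [exact: S0|exact: SD|exact: Smode].
Qed.

Context (formC : forall x y, form x y = form y x).
Context (formL : forall c x y z, form (c *: x + y) z = c * form x z + form y z).

Lemma M1_mode_ind (S : set (M1 form)) : subspace S -> S (M1_vac form) ->
  (forall u n v, S v -> S (M1_act (mode u n) v)) -> forall v, S v.
Proof.
move=> sS Svac Smode; apply: induced_ind => // x v Sv.
exact: (mode_stable (M1_module form) (M1_level formC formL) sS Smode).
Qed.

End HeisenbergFields.

(** * Vacuum, creation property and the embedding of M(1) *)

Section VertexAxioms.
Context {K : numFieldType} {h : lmodType K} (form : h -> h -> K).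
Context (formC : forall x y, form x y = form y x).
Context (formL : forall c x y z, form (c *: x + y) z = c * form x z + form y z).
Context (L : zmodClosed h) (eps : lattice L -> lattice L -> K).
Local Notation pr := (@pairing K h form L).
Context (prE : forall a b, form (val a) (val b) = (pr a b)%:~R).
Context (EC : is_cocycle form eps).
Context {V : lmodType K} (act : heis h -> V -> V) (VC : condition_C form L act).
Context (vac : V) (act_vac : forall u n, 0 <= n -> act (mode u n) vac = 0).
Context (act0 : forall u v, act (mode u 0) v = 0).
Context {VV : lmodType K} (eV : lattice L -> V -> VV).

Section Vacuum.
Context {U : lmodType K} (rho : heis h -> U -> U) (YU : V -> int -> U -> U).
Context {UU : lmodType K} (eU : lattice L -> U -> UU) (YL : VV -> int -> UU -> UU).
Context (LF : lattice_fields form eps act vac eV rho YU eU YL).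

Lemma lattice_vacuum n z : YL (eV 0 vac) n z = if n == - 1 then z else 0.
Proof.
have ly := lf_lL LF.
apply: (lf_ind LF (S := [set z | YL (eV 0 vac) n z = if n == - 1 then z else 0])) z.
  case: (n == -1); (split=> [|x y /= ex ey|c x /= ex] /=);
    rewrite ?(lin0 (ly.1 _ _)) ?(linD (ly.1 _ _)) ?(linZ (ly.1 _ _)) ?ex ?ey ?addr0 ?scaler0 //.
move=> b w /=; have UC := lf_C LF.
have := YL_evac formC formL VC act_vac LF b n (eigen0 LF w); rewrite /evac => ->.
rewrite (X_zero formC formL UC) (eps0l EC) scale1r add0r (pr0 formL prE) !addr0.
by case: eqP => // _; rewrite (lin0 (lf_le LF _)).
Qed.

End Vacuum.

Context (YM : V -> int -> V -> V) (YV : VV -> int -> VV -> VV).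
Context (LV : lattice_fields form eps act vac eV act YM eV YV).
Context (YM_creation : forall v, YM v (-1) vac = v /\ (forall n, 0 <= n -> YM v n vac = 0)).

Lemma ESum_creation a v n : - 1 <= n ->
  ESum act a (YWfam act act YM a (0 : lattice L) v vac) n = if n == - 1 then v else 0.
Proof.
move=> n1; have Mm : is_heis_module form act by case: VC.
have P0 := EP_zero formC formL VC; have l0 r := lin0 (EM_linear Mm (val a) r).
have lY := lf_lY LV.
rewrite /ESum (fsum1 (i0 := 0)) => [|s s0]; last first.
  do 2![apply: fsum0 => ?]; rewrite /YWfam /DM P0 (negPf s0) scaler0.
  by rewrite (lin0 (lY.2 _ _)) l0.
rewrite (fsum1 (i0 := 0)) => [|q q0]; last first.
  apply: fsum0 => ?; rewrite /YWfam (EP_vac formC formL VC act_vac) (negPf q0).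
  by rewrite (lin0 (lY.1 _ _)) l0.
have Y0 k : 0 <= k -> YM v k vac = 0 by case: (YM_creation v) => _; apply.
rewrite (fsum1 (i0 := 0)) => [|r r0].
  rewrite EM0 /YWfam /DM P0 EP0 eqxx scale1r.
  have -> : n - 0 - 0 + 0 = n by lia.
  by case: eqP => [->|nN]; [case: (YM_creation v)|apply: Y0; lia].
have [rn|rn] := ltP r 0; first exact: EM_neg.
rewrite /YWfam /DM P0 EP0 eqxx scale1r Y0 ?l0 //; lia.
Qed.

Lemma lattice_creation x : YV x (-1) (eV 0 vac) = x /\
  (forall n, 0 <= n -> YV x n (eV 0 vac) = 0).
Proof.
have ly := lf_lL LV; have le := lf_le LV.
suff H n : - 1 <= n -> YV x n (eV 0 vac) = if n == - 1 then x else 0.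
  split=> [|n n0]; first by rewrite H // eqxx.
  by rewrite H ?ifF //; lia.
move=> n1; apply: (lf_ind LV (S := [set x | YV x n (eV 0 vac) = if n == - 1 then x else 0])) x.
  case: (n == -1); (split=> [|x y /= ex ey|c x /= ex] /=);
    rewrite ?(lin0 (ly.2 _ _)) ?(linD (ly.2 _ _)) ?(linZ (ly.2 _ _)) ?ex ?ey ?addr0 ?scaler0 //.
move=> a v /=.
rewrite (lf_YL LV _ _ _ (mu := 0)); last exact: (eigenV act0).
rewrite prC // pr0 // !addr0 ESum_creation //.
have [_ /(_ a)[-> _] _ _] := EC; rewrite scale1r.
by case: eqP => // _; rewrite (lin0 (le _)).
Qed.

Lemma lattice_embedding u n v : eV 0 (YM u n v) = YV (eV 0 u) n (eV 0 v).
Proof.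
rewrite (lf_YL LV _ _ _ (mu := 0)); last exact: (eigenV act0).
rewrite (eps0l EC) scale1r (pr0 formL prE) !addr0.
by rewrite (ESum_zero formC formL VC VC (lf_lY LV)).
Qed.

End VertexAxioms.

Lemma dsumU_inj (K : fieldType) (I : choiceType) (V : lmodType K) (i : I) :
  injective (fun x : V => << x *g i >> : dsum I V).
Proof.
move=> x y xy; have := congr1 (fun g : dsum I V => g@_i) xy.
by rewrite /= !mcoeffUU.
Qed.

Section Structure.
Context {K : numFieldType} {h : lmodType K} (form : h -> h -> K).
Context (formC : forall x y, form x y = form y x).
Context (formL : forall c x y z, form (c *: x + y) z = c * form x z + form y z).
Context (L : zmodClosed h) (eps : lattice L -> lattice L -> K).

(** By polarisation 2<a,b> is a difference of even integers. As [pairing] is a choice with a default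
    value, the existence of the integer is all that is needed. *)
Lemma pairingE : (forall a : lattice L, exists k : int, form (val a) (val a) = (2 * k)%:~R) ->
  forall a b : lattice L, form (val a) (val b) = (pairing form a b)%:~R.
Proof.
move=> ev a b; suff [k kE] : exists k : int, form (val a) (val b) = k%:~R.
  exact: (@xgetPex _ 0 [set k : int | form (val a) (val b) = k%:~R] (ex_intro _ k kE)).
have [ka Ea] := ev a; have [kb Eb] := ev b; have [k Ek] := ev (a + b).
exists (k - ka - kb); apply: (@mulfI K 2%:~R); first by rewrite intr_eq0.
move: Ek; rewrite raddfD (formD formL) !(formDr formC formL) Ea Eb [form (val b) _]formC.
rewrite -intrM => E.
have -> : 2 * (k - ka - kb) = 2 * k - 2 * ka - 2 * kb by lia.
by rewrite !intrB -E; ring.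
Qed.

Context (prE : forall a b : lattice L, form (val a) (val b) = (pairing form a b)%:~R).
Context (EC : is_cocycle form eps).
Context (YM : M1 form -> int -> M1 form -> M1 form).
Context (YM_va : is_vertex_algebra YM (M1_vac form)).
Context (YM_modes : forall (u : h) (n : int) (v : M1 form),
  YM (M1_incl form u) n v = M1_act (mode u n) v).
Local Notation act := (@M1_act K h form).
Local Notation vac := (M1_vac form).
Local Notation Y := (YW eps act YM).
Local Notation VC := (M1_condition formC formL L).

Lemma va_adjoint_module : is_va_module YM vac YM.
Proof. by case: YM_va => ? ? ? _ ?; split. Qed.

Let LV := YW_lattice_fields formC formL eps YM_va VC va_adjoint_module YM_modes YM_modes.

Let act_vac u n : 0 <= n -> act (mode u n) vac = 0.
Proof. exact: M1_mode_vac. Qed.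

Let act0 u v : act (mode u 0) v = 0.
Proof. exact: (M1_mode0 formC formL). Qed.

Section Module.
Context {U : lmodType K} (rho : heis h -> U -> U) (UC : condition_C form L rho).
Context (YU : M1 form -> int -> U -> U) (YU_mod : is_va_module YM vac YU).
Context (YU_modes : forall (u : h) (n : int) (w : U),
  YU (M1_incl form u) n w = rho (mode u n) w).

Let LF := YW_lattice_fields formC formL eps YM_va UC YU_mod YM_modes YU_modes.

Lemma YW_module : is_va_module Y (exp_tensor 0 vac) (YW eps rho YU).
Proof.
split.
- exact: (lf_lL LF).
- exact: (lf_tL LF).
- exact: (lattice_vacuum formC formL prE EC VC act_vac LF).
- exact: (lattice_jacobi formC formL prE EC VC act_vac act0
    (@M1_mode_ind K h form formC formL) LV LF).
Qed.

End Module.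

Lemma YW_vertex_algebra : is_vertex_algebra Y (exp_tensor 0 vac).
Proof.
have [lL tL vL jL] := YW_module VC va_adjoint_module YM_modes.
have [_ _ _ cM _] := YM_va; split=> //.
exact: (lattice_creation formC formL prE EC VC act_vac act0 LV cM).
Qed.

Lemma YW_embedding : is_vertex_embedding YM vac Y (exp_tensor 0 vac)
  (@exp_tensor K h L (M1 form) 0).
Proof.
split=> [|||u n v].
- exact: exp_tensor_linear.
- exact: (@dsumU_inj K (lattice L) (M1 form) 0).
- by [].
- exact: (lattice_embedding formC formL prE EC VC act0 LV).
Qed.

End Structure.

(** * Irreducibility *)

(** Nested intervals: step n keeps the left or right third, avoiding the n-th real, and the supremum
    of the left ends lies in all of the intervals. *)
Lemma real_uncountable (R : realType) : ~ countable [set: R].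
Proof.
move=> /countable_injP[f fi]; pose g n := xget 0 [set x : R | f x = n].
have gf x : g (f x) = x.
  apply: fi; rewrite ?inE //.
  exact: (@xgetPex R 0 [set y | f y = f x] (ex_intro _ x erefl)).
pose c (p : R * R) := (2%:R * p.1 + p.2) / 3%:R.
pose d (p : R * R) := (p.1 + 2%:R * p.2) / 3%:R.
pose step n p := if g n < d p then (d p, p.2) else (p.1, c p).
pose I := fix I n : R * R := if n is n'.+1 then step n' (I n') else (0, 1).
have stepP n p : p.1 < p.2 ->
  [/\ p.1 <= (step n p).1, (step n p).1 < (step n p).2, (step n p).2 <= p.2
    & forall x, (step n p).1 <= x <= (step n p).2 -> x != g n].
  by move=> lp; rewrite /step; case: ltP => gd; rewrite /= /c /d in gd *; split; try lra;
    move=> x ?; apply/eqP => ?; lra.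
have IP n : (I n).1 < (I n).2 by elim: n => [|n IHn] /=; [lra|case: (stepP n _ IHn)].
have Imono n k : (I n).1 <= (I (n + k)%N).1 /\ (I (n + k)%N).2 <= (I n).2.
  elim: k => [|k [IH1 IH2]]; first by rewrite addn0.
  rewrite addnS /=; have [l1 _ l2 _] := stepP (n + k)%N _ (IP (n + k)%N).
  by split; [apply: le_trans l1|apply: le_trans l2 _].
have Iub m n : (I m).1 <= (I n).2.
  have [mn|/ltnW mn] := leqP m n.
    have [l1 _] := Imono m (n - m)%N; rewrite subnKC // in l1.
    exact: le_trans l1 (ltW (IP n)).
  have [_ l2] := Imono n (m - n)%N; rewrite subnKC // in l2.
  exact: le_trans (ltW (IP m)) l2.
pose A := [set x | exists n, x = (I n).1].
have Ane : A !=set0 by exists (I 0%N).1; exists 0%N.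
have r1 n : (I n).1 <= sup A.
  by apply: ub_le_sup; [exists (I 0%N).2 => x [m ->]; apply: Iub|exists n].
have r2 n : sup A <= (I n).2 by apply: ge_sup => // x [m ->]; apply: Iub.
have [_ _ _ /(_ (sup A))] := stepP (f (sup A)) _ (IP (f (sup A))).
rewrite gf eqxx => H.
by apply: notF; apply: H; rewrite (r1 (f (sup A)).+1) (r2 (f (sup A)).+1).
Qed.

(** * Polynomials in an operator and its resolvents *)

Section PolynomialAction.
Context {F : closedFieldType} {W : lmodType F} (T : W -> W) (lT : linear T).

Definition poly_act (p : {poly F}) (w : W) : W := \sum_(i < size p) p`_i *: iter i T w.

Lemma poly_actE n (p : {poly F}) w : (size p <= n)%N -> poly_act p w = \sum_(i < n) p`_i *: iter i T w.
Proof.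
move=> pn; rewrite /poly_act (big_ord_widen n (fun i => p`_i *: iter i T w) pn).
rewrite [RHS](bigID (fun i : 'I_n => (i < size p)%N)) /= [X in _ + X]big1 ?addr0 // => i.
by rewrite -leqNgt => pi; rewrite nth_default // scale0r.
Qed.

Lemma poly_act_linear w : linear (poly_act^~ w).
Proof.
move=> c p q; pose n := maxn (size (c *: p + q)) (maxn (size p) (size q)).
rewrite !(@poly_actE n) ?leq_max ?leqnn ?orbT // scaler_sumr -big_split.
by apply: eq_bigr => i _; rewrite coefD coefZ scalerDl scalerA.
Qed.

Lemma iter_linear_op i : linear (iter i T).
Proof. by elim: i => [|i IHi] c x y //=; rewrite IHi lT. Qed.

Lemma poly_act_op p : linear (poly_act p).
Proof.
move=> c x y; rewrite /poly_act scaler_sumr -big_split; apply: eq_bigr => i _ /=.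
by rewrite iter_linear_op scalerDr !scalerA mulrC.
Qed.

Lemma poly_act_iter p w : poly_act p (T w) = T (poly_act p w).
Proof.
rewrite /poly_act (lin_sum lT); apply: eq_bigr => i _.
by rewrite (linZ lT) -iterSr.
Qed.

Lemma poly_actX p w : poly_act (p * 'X) w = T (poly_act p w).
Proof.
rewrite (@poly_actE (size p).+1) ?size_mulX_leq //; last first.
  by have [->|p0] := eqVneq p 0; rewrite ?mul0r ?size_poly0 // size_mulX.
rewrite big_ord_recl coefMX eqxx scale0r add0r /poly_act (lin_sum lT).
by apply: eq_bigr => i _; rewrite coefMX /= (linZ lT).
Qed.

Lemma poly_act_root p z w : poly_act (p * ('X - z%:P)) w = poly_act p (T w - z *: w).
Proof.
have -> : p * ('X - z%:P) = (- z) *: p + p * 'X.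
  by rewrite mulrBr -mul_polyC polyCN mulNr addrC [p * z%:P]mulrC.
rewrite (poly_act_linear w) poly_actX -poly_act_iter.
by rewrite addrC -scaleNr [in RHS]addrC (poly_act_op p) addrC.
Qed.

Lemma poly_act1 w : poly_act 1 w = w.
Proof. by rewrite /poly_act size_poly1 big_ord1 coef1 scale1r. Qed.

(** Over an algebraically closed field p splits, and every factor T - z is injective. *)
Lemma poly_act_inj (p : {poly F}) w : (forall z w, T w = z *: w -> w = 0) ->
  p != 0 -> poly_act p w = 0 -> w = 0.
Proof.
move=> Tinj p0; have [rs ->] := closed_field_poly_normal p.
rewrite (linZ (poly_act_linear w)) => /eqP; rewrite scaler_eq0 lead_coef_eq0 (negPf p0) /=.
elim: rs w => [|z rs IHrs] w; first by rewrite big_nil poly_act1 => /eqP.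
rewrite big_cons mulrC poly_act_root => /IHrs /eqP; rewrite subr_eq0 => /eqP.
exact: Tinj.
Qed.

End PolynomialAction.

(* Amitsur: if no [T - z] has a kernel, the resolvents [(T - z)^-1 w0] are linearly
   independent, so there are only countably many [z]. *)
Lemma countable_span_eigenvector (F : closedFieldType) (W : lmodType F) (T : W -> W)
    (E : nat -> W) (w0 : W) : linear T -> ~ countable [set: F] -> w0 != 0 ->
  (forall w, exists n (c : nat -> F), w = \sum_(0 <= j < n) c j *: E j) ->
  (forall z, exists v, T v - z *: v = w0) ->
  exists z w, w != 0 /\ T w = z *: w.
Proof.
move=> lT Fu w00 span res; apply: contrapT => noeig.
have Tinj z w : T w = z *: w -> w = 0.
  by move=> Tw; apply: contrapT => /eqP w0'; apply: noeig; exists z, w.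
have [v vE] := choice res.
have /choice[n nE] : forall z, exists n, exists c : nat -> F, v z = \sum_(0 <= j < n) c j *: E j.
  by move=> z; apply: span.
have {nE} /choice[c cE] := nE.
(* If each class n z = m were finite, the field would be countable. An infinite class contains m + 1
   points whose v z all lie in the span of m vectors. *)
apply: Fu; have -> : [set: F] = \bigcup_(m in [set: nat]) [set z | n z = m].
  by apply/seteqP; split=> // z _; exists (n z).
apply: bigcup_countable => // m _; apply: finite_set_countable.
apply: contrapT => inf; have [B BA Bm] := infinite_set_fset m.+1 inf.
pose s := enum_fset B; have us : uniq s by apply: fset_uniq.
pose N := size s; pose A := \matrix_(i < N, j < m) c s`_i j.
have [k kA k0] : exists2 k : 'rV[F]_N, k *m A = 0 & k != 0.
  have : kermx A != 0.
    rewrite -mxrank_eq0 mxrank_ker -lt0n subn_gt0.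
    exact: leq_ltn_trans (rank_leq_col A) Bm.
  by case/rowV0Pn => k /sub_kermxP kA k0; exists k.
have vs0 : \sum_(i < N) k 0 i *: v s`_i = 0.
  transitivity (\sum_(j < m) (k *m A) 0 j *: E j); last first.
    by apply: big1 => j _; rewrite kA mxE scale0r.
  transitivity (\sum_(i < N) \sum_(j < m) (k 0 i * A i j) *: E j).
    apply: eq_bigr => i _; rewrite cE.
    have -> : n s`_i = m by apply: BA; apply: mem_nth.
    rewrite big_mkord scaler_sumr; apply: eq_bigr => j _.
    by rewrite scalerA mxE.
  rewrite exchange_big; apply: eq_bigr => j _ /=.
  by rewrite -scaler_suml mxE.
(* Since (T - s_i) v(s_i) = w0, applying P(T) to the relation between the v(s_i) yields q(T) w0 =
   0. *)
pose P := \prod_(i < N) ('X - (s`_i)%:P).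
pose Q i := \prod_(j < N | j != i) ('X - (s`_j)%:P).
have PQ i : P = Q i * ('X - (s`_i)%:P) by rewrite /P (bigD1 i) //= mulrC.
pose q := \sum_(i < N) k 0 i *: Q i.
have qw0 : poly_act T q w0 = 0.
  rewrite /q (lin_sum (poly_act_linear T w0)).
  transitivity (\sum_(i < N) k 0 i *: poly_act T P (v s`_i)).
    apply: eq_bigr => i _; rewrite (linZ (poly_act_linear T w0)) (PQ i).
    by rewrite (poly_act_root lT) vE.
  transitivity (poly_act T P (\sum_(i < N) k 0 i *: v s`_i)); last first.
    by rewrite vs0 (lin0 (poly_act_op lT P)).
  rewrite (lin_sum (poly_act_op lT P)).
  by apply: eq_bigr => i _; rewrite (linZ (poly_act_op lT P)).
(* At the point s_i every Q_j with j different from i vanishes, and Q_i does not. *)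
have q0 : q != 0.
  have [i ki] : exists i, k 0 i != 0 by apply/rV0Pn.
  apply/eqP => /(congr1 (horner^~ s`_i)); rewrite /q hornerE horner_sum (bigD1 i) //=.
  rewrite big1 ?addr0 => [|j ji].
    rewrite hornerZ /Q horner_prod => /eqP; rewrite mulf_eq0 (negPf ki) /=.
    apply/negP/prodf_neq0 => j ji; rewrite hornerXsubC subr_eq0 nth_uniq //.
    by rewrite eq_sym.
  rewrite hornerZ /Q horner_prod (bigD1 i) 1?eq_sym //= hornerXsubC subrr.
  by rewrite mul0r mulr0.
by move/eqP: w00; apply; apply: (poly_act_inj lT Tinj q0).
Qed.

Lemma subspace_sum (K : fieldType) (W : lmodType K) (S : set W) (I : Type) (r : seq I)
  (F : I -> W) : subspace S -> (forall i, S (F i)) -> S (\sum_(i <- r) F i).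
Proof.
move=> [S0 SD SZ] SF.
by apply: (big_ind (fun z => S z)) => [|y z|i _]; [exact: S0|exact: SD|exact: SF].
Qed.

Lemma seq_span_subspace (K : fieldType) (W : lmodType K) (E : nat -> W) :
  subspace [set w | exists n (c : nat -> K), w = \sum_(0 <= j < n) c j *: E j].
Proof.
split=> [|x y [n [c ->]] [n' [c' ->]]|d x [n [c ->]]] /=.
- by exists 0%N, (fun _ => 0); rewrite big_geq.
- exists (n + n')%N, (fun j => (if (j < n)%N then c j else 0) + if (j < n')%N then c' j else 0).
  rewrite [RHS](eq_bigr (fun j => (if (j < n)%N then c j else 0) *: E j
    + (if (j < n')%N then c' j else 0) *: E j)) => [|j _]; last by rewrite scalerDl.
  rewrite big_split /=; congr (_ + _).
    rewrite [RHS](@sum_nat_widen _ _ n) ?leq_addr // => [|i]; last first.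
      by move=> ni; rewrite ltnNge ni scale0r.
    by apply: eq_big_nat => j /andP[_ ->].
  rewrite [RHS](@sum_nat_widen _ _ n') ?leq_addl // => [|i]; last first.
    by move=> ni; rewrite ltnNge ni scale0r.
  by apply: eq_big_nat => j /andP[_ ->].
- exists n, (fun j => d * c j); rewrite scaler_sumr.
  by apply: eq_bigr => j _; rewrite scalerA.
Qed.

(** * Zero modes act by scalars *)

Section ZeroModes.
Context {K : numClosedFieldType} {h : vectType K} (form : h -> h -> K).
Context (formC : forall x y, form x y = form y x).
Context (formL : forall c x y z, form (c *: x + y) z = c * form x z + form y z).
Context {U : lmodType K} (rho : heis h -> U -> U).
Context (hm : is_heis_module form rho) (hl : has_level rho 1).
Context (irr : irreducible_under rho) (Ku : ~ countable [set: K]).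

Lemma irreducible_modes (S : set U) w : subspace S ->
  (forall u n v, S v -> S (rho (mode u n) v)) -> S w -> w != 0 -> forall v, S v.
Proof.
move=> sS Sm Sw w0 v; have [|S0|->] // := irr.2 S sS.
  by move=> x z; apply: (mode_stable hm hl sS Sm).
by move: w0; rewrite (S0 _ Sw) eqxx.
Qed.

Definition heis_word w0 (s : seq (nat * int)) : U :=
  foldr (fun p w => rho (mode (vbasis {:h})`_p.1 p.2) w) w0 s.

Definition heis_words w0 (j : nat) : U := if choice.unpickle j is Some s then heis_word w0 s else 0.

(** As h has a finite basis, the words in its modes form a countable type, enumerated by [unpickle].
    Their span on w0 is stable under all modes. *)
Lemma irreducible_countable_span w0 : w0 != 0 -> forall w,
  exists n (c : nat -> K), w = \sum_(0 <= j < n) c j *: heis_words w0 j.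
Proof.
move=> w00; have sS := seq_span_subspace (heis_words w0); set S := [set w | _] in sS.
have [S0 SD SZ] := sS.
have SF j : S (heis_words w0 j).
  exists j.+1, (fun i => (i == j)%:R); rewrite big_nat_recr //= eqxx scale1r.
  rewrite sum_nat0 ?add0r // => i /andP[_ ij].
  by rewrite (ltn_eqF ij) scale0r.
have Sword s : S (heis_word w0 s).
  by have := SF (choice.pickle s); rewrite /heis_words choice.pickleK.
apply: (irreducible_modes sS) (Sword [::]) w00 => u n v [N [c ->]].
rewrite (lin_sum (rho_lin hm _)); apply: subspace_sum => // j.
rewrite (linZ (rho_lin hm _)); apply: (SZ).
rewrite (coord_vbasis (memvf u)) (lin_sum (rho_mode_lin hm _ _)).
apply: subspace_sum => // i; rewrite (linZ (rho_mode_lin hm _ _)); apply: (SZ).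
rewrite /heis_words; case: choice.unpickle => [s|]; first exact: (Sword ((i : nat, n) :: s)).
by rewrite (lin0 (rho_lin hm _)).
Qed.

(** Zero modes commute with all modes, so kernels and images of the operators T - z are
    submodules. *)
Lemma zero_mode_scalar u : exists z, forall w, rho (mode u 0) w = z *: w.
Proof.
set T := rho (mode u 0); have lT : linear T by exact: (rho_lin hm).
have Tm v n w : T (rho (mode v n) w) = rho (mode v n) (T w).
  by rewrite /T (mode_comm formC formL hm hl) mul0r; case: ifP; rewrite scale0r addr0.
have [w0 w00] := irr.1.
have ker z w : w != 0 -> T w = z *: w -> exists z, forall w, T w = z *: w.
  move=> wn Tw; exists z; apply: (@irreducible_modes [set v | T v = z *: v] w) => //.
    split=> [|x y /= ex ey|c x /= ex] /=.
    - by rewrite (lin0 lT) scaler0.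
    - by rewrite (linD lT) ex ey scalerDr.
    - by rewrite (linZ lT) ex !scalerA mulrC.
  by move=> v n x /= ex; rewrite Tm ex (linZ (rho_lin hm _)).
(* If w0 lies in every image, there is an eigenvector, and its eigenspace is everything. If it is
   missing from the image for some z, that image is zero and T is z. *)
have [res|/existsNP[z nz]] := pselect (forall z, exists v, T v - z *: v = w0).
  have [z [w [wn Tw]]] := countable_span_eigenvector lT Ku w00
    (irreducible_countable_span w00) res.
  exact: ker wn Tw.
have [[w /eqP Tw]|/forallNP Tz] := pselect (exists w, T w - z *: w != 0); last first.
  by exists z => w; apply/eqP; rewrite -subr_eq0; apply/negP => /negP; apply: Tz.
case: nz; apply: (@irreducible_modes [set w | exists v, T v - z *: v = w] (T w - z *: w)) => //=.
- split=> [|x y [v <-] [v' <-]|c x [v <-]] /=.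
  + by exists 0; rewrite (lin0 lT) scaler0 subr0.
  + by exists (v + v'); rewrite (linD lT) scalerDr opprD addrACA.
  + by exists (c *: v); rewrite (linZ lT) scalerBr !scalerA mulrC.
- move=> v n x [y <-]; exists (rho (mode v n) y).
  by rewrite Tm (linB (rho_lin hm _)) (linZ (rho_lin hm _)).
- by exists w.
- exact/eqP.
Qed.

End ZeroModes.

Lemma dsumU_coef (K : fieldType) (I : choiceType) (W : lmodType K) (i j : I) (w : W) :
  (<< w *g i >> : dsum I W)@_j = if i == j then w else 0.
Proof. by rewrite mcoeffU; case: eqP. Qed.

(** * Submodules of C[L] (x) U *)

Section Irreducible.
Context {K : numClosedFieldType} {h : vectType K} (form : h -> h -> K).
Context (formC : forall x y, form x y = form y x).
Context (formL : forall c x y z, form (c *: x + y) z = c * form x z + form y z).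
Context (nondeg : forall u, (forall v, form u v = 0) -> u = 0).
Context (Ku : ~ countable [set: K]).
Context (L : zmodClosed h) (eps : lattice L -> lattice L -> K).
Local Notation pr := (@pairing K h form L).
Context (prE : forall a b, form (val a) (val b) = (pr a b)%:~R).
Context (EC : is_cocycle form eps).
Context {V : lmodType K} (act : heis h -> V -> V) (VC : condition_C form L act).
Context (vac : V) (act_vac : forall u n, 0 <= n -> act (mode u n) vac = 0).
Context {VV : lmodType K} (eV : lattice L -> V -> VV).
Context {U : lmodType K} (rho : heis h -> U -> U) (YU : V -> int -> U -> U).
Context (YL : VV -> int -> VL L U -> VL L U).
Local Notation eU := (@exp_tensor K h L U).
Context (LF : lattice_fields form eps act vac eV rho YU eU YL).
Context (irr : irreducible_under rho).

Let UC := lf_C LF.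
Let hm : is_heis_module form rho. Proof. by case: UC. Qed.
Let hl : has_level rho 1. Proof. by case: UC. Qed.
Let le a : linear (eU a) := lf_le LF a.
Let ly := lf_lL LF.
Let YLgen u b m w := YL_gen formC formL prE EC VC act_vac LF u b m w.

Lemma mcoeff_linear (b : lattice L) : linear (fun z : VL L U => z@_b).
Proof. by move=> c x y; rewrite mcoeffD dsumZE. Qed.

Lemma exp_coef (a b : lattice L) (w : U) : (eU a w)@_b = if a == b then w else 0.
Proof. exact: dsumU_coef. Qed.

(** The finite series E^+(-a, x) w has a last coefficient, and at that exponent E^- contributes its
    constant term only. *)
Lemma top_coefficient (a : lattice L) w : w != 0 -> exists n, X rho (val a) n w != 0.
Proof.
move=> w0; have [Q0 QP] := C_EP_finite formC formL UC a w.
have ex : exists q : nat, EP rho (val a) q%:Z w != 0 by exists 0%N; rewrite EP0.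
have bd q : EP rho (val a) q%:Z w != 0 -> (q <= Q0)%N.
  by move=> ew; rewrite leqNgt; apply/negP => Qq; move: ew; rewrite QP ?eqxx //; lia.
case: (ex_maxnP ex bd) => Q EQ Qmax; exists (Q%:Z - 1).
rewrite (XE UC _ (Q := Q.+1)) => [|q qQ]; last first.
  apply/eqP/negPn/negP => eq; have := Qmax (absz q).
  by rewrite gez0_abs; [move=> /(_ eq); lia|lia].
rewrite big_nat_recr //= sum_nat0 => [|q /andP[_ qQ]]; last by rewrite EM_neg //; lia.
have -> : Q%:Z - 1 - (Q%:Z - 1) = 0 by lia.
by rewrite add0r EM0.
Qed.

Section Submodule.
Context (S : set (VL L U)) (sS : subspace S) (SY : forall x n z, S z -> S (YL x n z)).

Let S0 : S 0. Proof. by case: sS. Qed.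
Let SD x y : S x -> S y -> S (x + y). Proof. by case: sS => _ + _; apply. Qed.
Let SZ (c : K) x : S x -> S (c *: x). Proof. by case: sS => _ _; apply. Qed.

Lemma submodule_fiber b w : S (eU b w) -> w != 0 -> forall v, S (eU b v).
Proof.
move=> Sw w0; apply: (irreducible_modes hm hl irr (S := [set v | S (eU b v)])) Sw w0.
  split=> [|x y Sx Sy|c x Sx] /=.
  - by rewrite (lin0 (le b)).
  - have -> : eU b (x + y) = eU b x + eU b y := linD (le b) x y.
    exact: (SD Sx Sy).
  - have -> : eU b (c *: x) = c *: eU b x := linZ (le b) c x.
    exact: (SZ c Sx).
move=> u n v Sv /=; pose c := if n == 0 then form u (val b) else 0.
have -> : eU b (rho (mode u n) v) = YL (gen act vac eV u) n (eU b v) + (- c) *: eU b v.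
  by rewrite YLgen (linD (le b)) -/c (linZ (le b)) scaleNr addrK.
by apply: SD; [apply: SY|apply: SZ].
Qed.

Lemma zero_mode_coef u lam z b : (forall w, rho (mode u 0) w = lam *: w) ->
  (YL (gen act vac eV u) 0 z)@_b = (lam + form u (val b)) *: z@_b.
Proof.
move=> ul; have l1 := linear_comp (mcoeff_linear b) (ly.1 (gen act vac eV u) 0).
have lD := linear_comp (@linear_scale K _ (lam + form u (val b))) (mcoeff_linear b).
apply/eqP; rewrite -subr_eq0; apply/eqP.
apply: (lf_ind LF (S := [set z | (YL (gen act vac eV u) 0 z)@_b
  - (lam + form u (val b)) *: z@_b = 0])) z => [|c w] /=.
  split=> [|x y /= ex ey|c x /= ex] /=.
  - by rewrite (lin0 l1) (lin0 lD) subrr.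
  - by rewrite (linD l1) (linD lD) opprD addrACA ex ey addr0.
  - by rewrite (linZ l1) (linZ lD) -scalerBr ex scaler0.
have -> : YL (gen act vac eV u) 0 (eU c w) = eU c ((lam + form u (val c)) *: w).
  by apply: (etrans (YLgen u c 0 w)); rewrite eqxx ul -scalerDl.
have E1 := exp_coef c b ((lam + form u (val c)) *: w).
have E2 := exp_coef c b w.
apply: (etrans (congr2 (fun x y => x - (lam + form u (val b)) *: y) E1 E2)).
by have [->|_] := eqVneq c b; [rewrite subrr|rewrite scaler0 subrr].
Qed.

(** The other summands are removed one by one. For <u, d - b> nonzero, the eigenvalue of the zero
    mode of u at d, minus this mode, kills the summand at d and rescales the one at b by a nonzero
    factor. *)
Lemma submodule_component b z : S z -> S (eU b z@_b).
Proof.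
suff H (D : seq (lattice L)) : forall z, S z ->
    (forall c, z@_c != 0 -> (c == b) || (c \in D)) -> S (eU b z@_b).
  move=> Sz; apply: (H (msupp z)) Sz _ => c zc; apply/orP; right.
  by rewrite -mcoeff_neq0.
elim: D => [|d D IHD] {}z Sz zD.
  suff -> : eU b z@_b = z by [].
  apply/malgP => c; rewrite exp_coef; case: eqP => [->|bc] //=.
  apply/esym/eqP/negPn/negP => /zD; rewrite orbF => /eqP cb; exact: bc.
have [db|db] := eqVneq d b.
  by apply: IHD Sz _ => c /zD; rewrite inE db orbA orbb.
have [u ub] : exists u, form u (val d - val b) != 0.
  apply: contrapT => /forallNP nu; move/eqP: db; apply; apply: val_inj.
  apply/eqP; rewrite -subr_eq0; apply/eqP; apply: nondeg => v.
  by rewrite formC; apply/eqP/negPn/negP/nu.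
have [lam ul] := zero_mode_scalar formC formL hm hl irr Ku u.
pose z' := (lam + form u (val d)) *: z + (- 1) *: YL (gen act vac eV u) 0 z.
have z'E c : z'@_c = (form u (val d) - form u (val c)) *: z@_c.
  rewrite /z' mcoeff_linear (linZ (mcoeff_linear c)) (zero_mode_coef _ _ ul) scaleN1r.
  by rewrite -scalerBl opprD addrACA subrr add0r.
have Sz' : S z' by apply: SD; apply: SZ => //; apply: SY.
have := IHD z' Sz'; rewrite z'E (linZ (le b)) => H.
pose e := form u (val d) - form u (val b).
have e0 : e != 0.
  by move: ub; rewrite (formDr formC formL) [form u (- _)]formC (formN formL) [form (val b) u]formC.
rewrite -[eU b z@_b]scale1r -(mulVf e0) -scalerA; apply: SZ; apply: H => c.
rewrite z'E; case: (eqVneq c d) => [->|cd]; first by rewrite subrr scale0r eqxx.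
rewrite scaler_eq0 negb_or => /andP[_ /zD]; rewrite inE (negPf cd); exact.
Qed.

Lemma submodule_full z : S z -> z != 0 -> S = [set: VL L U].
Proof.
move=> Sz z0; have [b zb] : exists b, z@_b != 0.
  apply: contrapT => /forallNP nz; move/eqP: z0; apply; apply/malgP => c.
  by rewrite mcoeff0; apply/eqP/negPn/negP/nz.
have Sb := submodule_fiber (submodule_component b Sz) zb.
apply/seteqP; split=> // x _; apply: (lf_ind LF sS) => c.
set w := z@_b in zb; pose a := c - b.
have [lam al] := zero_mode_scalar formC formL hm hl irr Ku (val a).
(* The mode a(0) is a scalar on U, and Condition C_L makes this scalar an integer. *)
have [mu Ew] : exists mu : int, eigen rho a mu w.
  have [mu mE] := @C_integer _ _ _ _ _ _ UC a lam w zb (al w).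
  by exists mu; rewrite /eigen al mE.
have [n nX] := top_coefficient a zb.
apply: (@submodule_fiber c (eps a b *: X rho (val a) n w)); last first.
  by rewrite scaler_eq0 negb_or nX andbT; case: EC => + _ _ _; apply.
have := SY (evac vac eV a) (n - pr a b - mu) (Sb w).
rewrite (YL_evac formC formL VC act_vac LF b _ Ew).
have -> : a + b = c by rewrite /a subrK.
by have -> : n - pr a b - mu + pr a b + mu = n by lia.
Qed.

End Submodule.

Lemma lattice_irreducible : va_irreducible YL.
Proof.
split=> [|S sS SY].
  have [w w0] := irr.1; exists (eU 0 w); apply/negP => /eqP.
  by rewrite -(lin0 (le 0)) => /dsumU_inj /eqP; apply/negP.
have SY' x n z : S z -> S (YL x n z) by apply: (SY (x, n)).
have [[z [Sz /eqP z0]]|nz] := pselect (exists z, S z /\ z <> 0).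
  by right; apply: submodule_full Sz z0.
left=> z Sz /=; apply: contrapT => z0; apply: nz; by exists z.
Qed.

End Irreducible.

Theorem theorem3p6 (R : realType) (h : vectType R[i])
    (form : {symmetric h}) (form_nondeg : nondegenerate form)
    (L : zmodClosed h)
    (L_even : forall a : lattice L, exists k : int,
        form (val a) (val a) = (2 * k)%:~R)
    (eps : lattice L -> lattice L -> R[i])
    (eps_cocycle : is_cocycle form eps)
    (YM : M1 form -> int -> M1 form -> M1 form)
    (YM_va : is_vertex_algebra YM (M1_vac form))
    (YM_modes : forall (u : h) (n : int) (v : M1 form),
        YM (M1_incl form u) n v = M1_act (mode u n) v)
    (U : lmodType R[i]) (rho : heis h -> U -> U)
    (U_condition : condition_C form L rho)
    (YU : M1 form -> int -> U -> U)
    (YU_mod : is_va_module YM (M1_vac form) YU)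
    (YU_modes : forall (u : h) (n : int) (w : U),
        YU (M1_incl form u) n w = rho (mode u n) w) :
  let Y := YW eps (@M1_act _ _ form) YM in
  let YWU := YW eps rho YU in
  let vac := exp_tensor (0 : lattice L) (M1_vac form) in
  [/\ is_vertex_algebra Y vac,
      is_vertex_embedding YM (M1_vac form) Y vac (@exp_tensor _ _ L _ 0),
      is_va_module Y vac YWU
    & irreducible_under rho -> va_irreducible YWU].

Proof.
move=> Y YWU vac.
have formC x y : form x y = form y x by rewrite hermC expr0 mul1r.
have formL c x y z : form (c *: x + y) z = c * form x z + form y z.
  by rewrite linearPl.
have prE := pairingE formC formL L_even.
split.
- exact: (YW_vertex_algebra formC formL prE eps_cocycle YM_va YM_modes).
- exact: (YW_embedding formC formL prE eps_cocycle YM_va YM_modes).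
- exact: (YW_module formC formL prE eps_cocycle YM_va YM_modes U_condition YU_mod YU_modes).
- have nondeg u : (forall v, form u v = 0) -> u = 0.
    move=> u0; apply/eqP; rewrite -memv0 -(eqP form_nondeg).
    by apply/mem_orthovP => v _; exact: u0.
  have Ku : ~ countable [set: R[i]].
    move=> /countable_injP[f fi]; apply: (@real_uncountable R).
    apply/countable_injP; exists (fun x => f (x%:C)%C) => x y _ _ fxy.
    by have [] : (x%:C)%C = (y%:C)%C by apply: fi fxy; rewrite inE.
  move=> irr.
  have LF := YW_lattice_fields formC formL eps YM_va U_condition YU_mod YM_modes YU_modes.
  exact: (lattice_irreducible formC formL nondeg Ku prE eps_cocycle
    (M1_condition formC formL L) (@M1_mode_vac _ _ form) LF irr).
Qed.
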